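(* Let $Y$ be a UMD Banach space that has tile-type $q$, where $q\in[2,\infty)$. Then there is a constant $C$ such that $$\|S^*f\|_{L^{q,\infty}(0,1)}\le C\|f\|_{L^q(0,1;Y)}\qquad\text{for all } f\in L^q(0,1;Y),$$ where $S_Nf(x)=\sum_{n=0}^{N-1}\langle f,w_n\rangle w_n(x)$ and $S^*f(x)=\sup_{N\in\mathbb{N}}|S_Nf(x)|_Y$. Consequently, for every $f\in L^q(0,1;Y)$, $S_Nf(x)\to f(x)$ as $N\to\infty$ for almost every $x\in(0,1)$.
   Context: $\mathbb{N}=\{0,1,2,\dots\}$, $\mathbb{R}_+=[0,\infty)$; $\mathscr{D}$ is the collection of dyadic intervals $[2^km,2^k(m+1))$, $k\in\mathbb{Z}$, $m\in\mathbb{N}$. Rademacher functions: $r_i(x)=\sum_{k\in\mathbb{N}}\big(1_{2^{-i}[k,k+1/2)}(x)-1_{2^{-i}[k+1/2,k+1)}(x)\big)$. Walsh functions: $w_n(x)=\prod_{i\ge0}r_i(x)^{n_i}$ for $n=\sum_{i\ge0}n_i2^i$, $n_i\in\{0,1\}$. For $f\in L^1(0,1;Y)$, $\langle f,w_n\rangle=\int_0^1 fw_n\,dx$. A tile is a rectangle $P=I\times|I|^{-1}[n,n+1)$ with $I\in\mathscr{D}$, $n\in\mathbb{N}$; its wave packet is $w_P(x)=|I|^{-1/2}1_I(x)w_n(x/|I|)$. A bitile is $P=I\times|I|^{-1}[2n,2n+2)$, with down-tile $P_d=I\times|I|^{-1}[2n,2n+1)$ and up-tile $P_u=I\times|I|^{-1}[2n+1,2n+2)$.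 For a tile or bitile $P=I\times\omega$ write $I_P=I$, $\omega_P=\omega$; $P\le P'$ means $I_P\subseteq I_{P'}$ and $\omega_P\supseteq\omega_{P'}$. For bitiles, $P\le_uP'$ means $P_u\le P'_u$. An up-tree is a collection $\mathbf{T}$ of bitiles for which there is a bitile $T$ (a top, not necessarily in $\mathbf{T}$) with $P\le_uT$ for all $P\in\mathbf{T}$. For $f$ on $\mathbb{R}_+$, $\langle f,w_P\rangle=\int_{\mathbb{R}_+}fw_P\,dx$. Tile-type: a Banach space $Y$ has tile-type $q$ if there is a constant $C$ such that for all $f\in L^q(\mathbb{R}_+;Y)$ $$\Big(\sum_{\mathbf{T}\in\mathscr{T}}\Big\|\sum_{P\in\mathbf{T}}\langle f,w_{P_d}\rangle w_{P_d}\Big\|_{L^q(\mathbb{R}_+;Y)}^q\Big)^{1/q}\le C\|f\|_{L^q(\mathbb{R}_+;Y)}$$ for every collection $\mathscr{T}$ of up-trees with the property: for any two distinct pairs $(P^1,\mathbf{T}^1)$, $(P^2,\mathbf{T}^2)$ with $P^i\in\mathbf{T}^i\in\mathscr{T}$, one has $P^1_d\cap P^2_d=\varnothing$. For infinite families the inequality is understood as uniform over finite subfamilies (finitely many up-trees, each finite). *)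

(* Defs.v *)
From HB Require Import structures.
From mathcomp Require Export all_boot all_order all_algebra finmap.
From mathcomp Require Export all_classical all_reals all_analysis.
Export Order.TTheory GRing.Theory Num.Theory.
Export numFieldNormedType.Exports.

Set Implicit Arguments.
Unset Strict Implicit.
Unset Printing Implicit Defensive.

Local Open Scope classical_set_scope.
Local Open Scope ring_scope.

(* A Banach space is a complete normed space over the reals. A complex Banach
   space is covered through its underlying real space: UMD (with signs) and
   tile-type only involve the real structure. *)

(* The sigma-algebra [G] is a parameter because martingales need strong
   measurability with respect to sub-sigma-algebras. *)
Definition simple_function (T : Type) (Y : Type) (G : set (set T))
    (s : T -> Y) : Prop :=
  finite_set (range s) /\ forall y : Y, G (s @^-1` [set y]).

Definition strongly_measurable (R : realType) (T : Type)
    (Y : completeNormedModType R) (G : set (set T)) (D : set T)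
    (f : T -> Y) : Prop :=
  exists s : nat -> T -> Y, (forall n, simple_function G (s n)) /\
    forall x, D x -> s n x @[n --> \oo] --> f x.

Section bochner.
Context (d : measure_display) (T : measurableType d) (R : realType).
Context (Y : completeNormedModType R).
Variables (mu : {measure set T -> \bar R}) (D : set T).

Definition integrable_simple (s : T -> Y) : Prop :=
  simple_function measurable s /\
  forall y : Y, y != 0 -> (mu (D `&` s @^-1` [set y]) < +oo)%E.

Definition simple_integral (s : T -> Y) : Y :=
  \sum_(y \in range s) fine (mu (D `&` s @^-1` [set y])) *: y.

Definition is_bochner_integral (f : T -> Y) (v : Y) : Prop :=
  strongly_measurable measurable D f /\
  exists s : nat -> T -> Y,
    [/\ forall n, integrable_simple (s n),
        (\int[mu]_(x in D) `|f x - s n x|%:E)%E @[n --> \oo] --> 0%E &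
        simple_integral (s n) @[n --> \oo] --> v].

(* The value is 0 when [f] is not Bochner integrable on [D]. *)
Definition bochner (f : T -> Y) : Y := xget 0 [set v | is_bochner_integral f v].

Definition LYnorm (p : R) (f : T -> Y) : \bar R :=
  ('N[mu]_(p%:E)[(fun x => `|f x|%:E) \_ D])%E.

(* Elements of L^p(D; Y) are represented by functions that are everywhere
   strongly measurable on [D]; every class has such a representative. *)
Definition in_LY (p : R) (f : T -> Y) : Prop :=
  strongly_measurable measurable D f /\ (LYnorm p f < +oo)%E.

End bochner.

Definition weak_Lnorm (d : measure_display) (T : measurableType d)
    (R : realType) (mu : {measure set T -> \bar R}) (D : set T) (p : R)
    (g : T -> \bar R) : \bar R :=
  ereal_sup [set (l%:E * (mu (D `&` [set x | (l%:E < `|g x|)%E])) `^ p^-1)%E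
            | l in [set l : R | 0 < l]].

Section umd.
Context (d : measure_display) (T : measurableType d) (R : realType).
Context (Y : completeNormedModType R) (P : probability T R).

Definition is_filtration (F : nat -> set (set T)) : Prop :=
  [/\ forall n, sigma_algebra setT (F n),
      forall n, F n `<=` measurable &
      forall m n, (m <= n)%N -> F m `<=` F n].

(* E[f_{n+1} | F_n] = f_n is expressed by equality of the integrals over the
   events of F_n. *)
Definition is_Lp_martingale (p : R) (F : nat -> set (set T))
    (f : nat -> T -> Y) : Prop :=
  [/\ is_filtration F,
      forall n, strongly_measurable (F n) setT (f n),
      forall n, (LYnorm P setT p (f n) < +oo)%E &
      forall n A, F n A -> bochner P A (f n.+1) = bochner P A (f n)].

End umd.

(* Finite martingales f_0, ..., f_N are covered by stopping at N. The sums run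
   over the increments f_{n+1} - f_n only, so f_0 is unconstrained. *)
Definition UMD (R : realType) (Y : completeNormedModType R) : Prop :=
  forall p : R, 1 < p -> exists beta : R,
    forall (d : measure_display) (T : measurableType d) (P : probability T R)
      (F : nat -> set (set T)) (f : nat -> T -> Y) (eps : nat -> bool) (N : nat),
    is_Lp_martingale P p F f ->
    (LYnorm P setT p
       (fun x => \sum_(n < N) (-1) ^+ eps n *: (f n.+1 x - f n x))%R
     <= beta%:E *
        LYnorm P setT p (fun x => \sum_(n < N) (f n.+1 x - f n x))%R)%E.

Section walsh.
Context (R : realType).

(* Finitely supported sum: for each [x] at most one term of the sum is nonzero. *)
Definition rademacher (i : nat) (x : R) : R :=
  \sum_(k \in [set: nat])
    (\1_(`[2 ^- i * k%:R, 2 ^- i * (k%:R + 2^-1)[%classic) x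
     - \1_(`[2 ^- i * (k%:R + 2^-1), 2 ^- i * (k%:R + 1)[%classic) x : R).

Definition binary_digit (n i : nat) : nat := odd (n %/ 2 ^ i).

(* The binary digits of [n] of index at least [n] vanish. *)
Definition walsh (n : nat) (x : R) : R :=
  \prod_(i < n) rademacher i x ^+ binary_digit n i.

Context (Y : completeNormedModType R).

Definition walsh_coef (f : R -> Y) (n : nat) : Y :=
  bochner lebesgue_measure `]0, 1[%classic (fun x => walsh n x *: f x).

Definition walsh_sum (f : R -> Y) (N : nat) (x : R) : Y :=
  \sum_(n < N) walsh n x *: walsh_coef f n.

Definition walsh_maximal (f : R -> Y) (x : R) : \bar R :=
  ereal_sup (range (fun N => `|walsh_sum f N x|%:E)).

End walsh.

(* [(k, m, n) : tile] stands for I x |I|^-1 [n, n + 1) and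
   [(k, m, n) : bitile] for I x |I|^-1 [2 n, 2 n + 2), where
   I = [2^k m, 2^k (m + 1)). Both encodings are one-to-one. *)
Definition tile : Type := (int * nat * nat)%type.
Definition bitile : Type := (int * nat * nat)%type.

Definition down_tile (P : bitile) : tile := (P.1, P.2.*2).
Definition up_tile (P : bitile) : tile := (P.1, P.2.*2.+1).

Section tiles.
Context (R : realType).

Definition tile_length (P : tile) : R := 2 ^ P.1.1.

Definition tile_time (P : tile) : set R :=
  `[tile_length P * P.1.2%:R, tile_length P * P.1.2.+1%:R[%classic.

Definition tile_freq (P : tile) : set R :=
  `[(tile_length P)^-1 * P.2%:R, (tile_length P)^-1 * P.2.+1%:R[%classic.

Definition tile_rect (P : tile) : set (R * R) := tile_time P `*` tile_freq P.

Definition tile_le (P P' : tile) : Prop :=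
  tile_time P `<=` tile_time P' /\ tile_freq P' `<=` tile_freq P.

Definition wave_packet (P : tile) (x : R) : R :=
  (Num.sqrt (tile_length P))^-1 * \1_(tile_time P) x *
  walsh P.2 (x / tile_length P).

Definition up_tree (T : {fset bitile}) : Prop :=
  exists top : bitile,
    forall P, P \in T -> tile_le (up_tile P) (up_tile top).

Definition down_disjoint (TT : {fset {fset bitile}}) : Prop :=
  forall (P1 P2 : bitile) (T1 T2 : {fset bitile}),
    P1 \in T1 -> T1 \in TT -> P2 \in T2 -> T2 \in TT ->
    (P1, T1) <> (P2, T2) ->
    tile_rect (down_tile P1) `&` tile_rect (down_tile P2) = set0.

Context (Y : completeNormedModType R).

Definition tile_coef (f : R -> Y) (P : tile) : Y :=
  bochner lebesgue_measure `[0, +oo[%classic (fun x => wave_packet P x *: f x).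

Definition tree_sum (f : R -> Y) (T : {fset bitile}) (x : R) : Y :=
  \sum_(P <- T) wave_packet (down_tile P) x *: tile_coef f (down_tile P).

(* The inequality for infinite families means uniformity over their finite
   subfamilies, which are again admissible; hence finite families suffice. *)
Definition tile_type (q : R) : Prop :=
  exists C : R, forall f : R -> Y,
    in_LY lebesgue_measure `[0, +oo[%classic q f ->
    forall TT : {fset {fset bitile}},
    (forall T, T \in TT -> up_tree T) -> down_disjoint TT ->
    ((\sum_(T <- TT)
        (LYnorm lebesgue_measure `[0%R, +oo[%classic q (tree_sum f T)) `^ q)
       `^ q^-1
     <= C%:E * LYnorm lebesgue_measure `[0%R, +oo[%classic q f)%E.

End tiles.

(* Main.v *)
From HB Require Import structures.
Require Import Defs.
From mathcomp Require Import zify ring lra measurable_realfun.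

(** Carleson's theorem for vector-valued Walsh series, by time-frequency
    analysis.

    By the binary expansion of N, the partial sum S_N f(x) is the sum of the
    terms <f, w_{P_d}> w_{P_d}(x) over the bitiles P whose up-tile contains
    the point (x, N) (linearized_walsh_sum). Let E be the set where some
    partial sum with N < 2^K exceeds lambda, and let N(x) be such an N. As
    long as N < 2^K, everything in sight is constant on the dyadic intervals
    of length 2^-K, so the weak-type bound becomes an inequality between
    finite sums over the 2^K atoms a, with a constant independent of K: the
    sum over E of the norm of the linearized sum is at most a constant times
    |E| (B / |E|)^(1/q), where B bounds the energies of disjoint up-trees
    (carleson_sum_le, discrete_weak_type). Tile-type q supplies B = 2^K C^q
    ||f||_q^q (energy_bound).

    Two numbers measure a collection of bitiles. Its size is at most s when
    every up-tree in it, with top T, has L^q energy at most s |I_T|; its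
    density is at most d when, for every bitile Q above one of its members,
    the points of E in I_Q whose frequency N lies in omega_Q number at most
    d |I_Q|. A tree with top T contributes at most 20 s^(1/q) d |I_T|
    (tree_lemma). Multiplied by a Walsh function, the terms of an up-tree
    become multiples of Haar functions, so the condition on N(x) only
    truncates a martingale; the truncations are dominated by the dyadic
    maximal function of the full sum, and Doob's inequality in L^2 gives the
    bound, since q >= 2. The remaining terms of a tree are disjoint at each
    point.

    Size and density are halved repeatedly. Removing the trees over the
    maximal bitiles of large density costs little because these bitiles meet
    E in disjoint sets (dens_step). Trees of large size are selected with
    the lowest top frequency first; then all their down-tiles are disjoint,
    and tile-type bounds the total length of their tops (size_step). The
    costs of the successive levels form two geometric series, one for the
    sizes above B / |E|, where the density is at most 1, and one for those
    below.

    For the almost everywhere statement, S_N g = g for dyadic step functions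
    g as soon as N is large (walsh_sum_step_fun), the functions with almost
    everywhere convergence form a closed subset of L^q by the maximal
    inequality (ae_convergent_closed), and step functions are dense, because
    an open set is the increasing union of the dyadic intervals that it
    contains (dyadic_set_approximation).

    The Bochner integral enters through its existence, uniqueness and
    linearity on norm-integrable functions; these reduce every coefficient
    of f against a function that is constant on the atoms to a finite
    combination of the integrals of f over the atoms (bochner_step). *)

Set Implicit Arguments.
Unset Strict Implicit.
Unset Printing Implicit Defensive.

(** * Dyadic arithmetic of bitiles *)

Section Division.
Local Open Scope nat_scope.

Lemma divn_exp2 (x a b : nat) : x %/ 2 ^ a %/ 2 ^ b = x %/ 2 ^ (a + b).
Proof. by rewrite -divnMA expnD. Qed.

Lemma divn_double_exp2 (n d : nat) : 0 < d -> n.*2 %/ 2 ^ d = n %/ 2 ^ d.-1.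
Proof. by case: d => // d _; rewrite expnS divnMA -muln2 mulnK. Qed.

Lemma divn_doubleS_exp2 (n d : nat) : 0 < d -> n.*2.+1 %/ 2 ^ d = n %/ 2 ^ d.-1.
Proof.
by case: d => // d _; rewrite expnS divnMA; congr (_ %/ _); lia.
Qed.

Lemma subn_chain a b c : c <= b -> b <= a -> (a - b) + (b - c) = a - c.
Proof. lia. Qed.

End Division.

Section Bitiles.
Local Open Scope nat_scope.
Variable K : nat.

(** The triple (i, m, n) stands for the bitile [2^-i m, 2^-i (m + 1)) x 2^i
    [2 n, 2 n + 2). Time is counted in atoms of length 2^-K, so that the
    times of the bitile are the a < 2^K with a %/ 2^(K - i) = m, and its
    frequencies are the N with N %/ 2^(i+1) = n. Triples that describe no
    bitile of the unit square have no atoms, or frequencies beyond 2^K, and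
    need not be excluded. *)
Definition dbitile : Type := ('I_K * 'I_(2 ^ K) * 'I_(2 ^ K))%type.
HB.instance Definition _ := Finite.on dbitile.

Definition scale_of (P : dbitile) : nat := P.1.1.
Definition time_of (P : dbitile) : nat := P.1.2.
Definition freq_of (P : dbitile) : nat := P.2.

Definition cell (j m : nat) : {set 'I_(2 ^ K)} :=
  finset (fun a : 'I_(2 ^ K) => a %/ 2 ^ (K - j) == m).

(** Containment of two dyadic rectangles of equal area: the time of P is
    inside that of Q, and the frequency x of Q is inside the frequency y of
    P. *)
Definition ancestor (P Q : dbitile) (x y : nat) : bool :=
  [&& scale_of Q <= scale_of P, time_of P %/ 2 ^ (scale_of P - scale_of Q) == time_of Q
    & x %/ 2 ^ (scale_of P - scale_of Q) == y].

Definition below P Q := ancestor P Q (freq_of Q) (freq_of P).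
Definition up_below P Q := ancestor P Q (freq_of Q).*2.+1 (freq_of P).*2.+1.
Definition down_below P Q := ancestor P Q (freq_of Q).*2 (freq_of P).*2.

Lemma dbitile_inj (P Q : dbitile) :
  scale_of P = scale_of Q -> time_of P = time_of Q -> freq_of P = freq_of Q -> P = Q.
Proof.
case: P Q => [[i m] n] [[i' m'] n']; rewrite /scale_of /time_of /freq_of /=.
by move=> /val_inj -> /val_inj -> /val_inj ->.
Qed.

Lemma below_refl P : below P P.
Proof. by rewrite /below /ancestor subnn !divn1 leqnn !eqxx. Qed.

Lemma up_below_refl P : up_below P P.
Proof. by rewrite /up_below /ancestor subnn !divn1 leqnn !eqxx. Qed.

Lemma below_trans P Q S : below P Q -> below Q S -> below P S.
Proof.
move=> /and3P[PQ /eqP tPQ /eqP fPQ] /and3P[QS /eqP tQS /eqP fQS].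
apply/and3P; split; first exact: leq_trans PQ.
- by rewrite -tQS -tPQ divn_exp2 subn_chain.
- by rewrite -fPQ -fQS divn_exp2 addnC subn_chain.
Qed.

Lemma below_scale P Q : below P Q -> scale_of Q <= scale_of P.
Proof. by case/and3P. Qed.

Lemma below_anti P Q : below P Q -> scale_of P = scale_of Q -> P = Q.
Proof.
move=> /and3P[_ /eqP tPQ /eqP fPQ] e; move: tPQ fPQ.
by rewrite e subnn !divn1 => t f; apply: dbitile_inj.
Qed.

Lemma up_below_below P Q : up_below P Q -> below P Q.
Proof.
move=> /and3P[PQ tPQ /eqP fPQ]; apply/and3P; split => //.
have -> : freq_of P = (freq_of P).*2.+1 %/ 2 by lia.
have -> : freq_of Q = (freq_of Q).*2.+1 %/ 2 by lia.
by rewrite -fPQ -[X in _ %/ X %/ _]expn1 -[X in _ == _ %/ X]expn1 !divn_exp2 addnC.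
Qed.

Lemma down_below_below P Q : down_below P Q -> below P Q.
Proof.
move=> /and3P[PQ tPQ /eqP fPQ]; apply/and3P; split => //.
have -> : freq_of P = (freq_of P).*2 %/ 2 by lia.
have -> : freq_of Q = (freq_of Q).*2 %/ 2 by lia.
by rewrite -fPQ -[X in _ %/ X %/ _]expn1 -[X in _ == _ %/ X]expn1 !divn_exp2 addnC.
Qed.

(** The frequency interval of Q is dyadic, hence lies in one half of that of
    P unless the two bitiles have the same scale. *)
Lemma below_up_or_down P Q : below P Q -> up_below P Q || down_below P Q.
Proof.
move=> b; case: (eqVneq (scale_of P) (scale_of Q)) => [/(below_anti b) ->|ne].
  by rewrite up_below_refl.
have /and3P[PQ tPQ /eqP fPQ] := b.
rewrite /up_below /down_below /ancestor PQ tPQ /=.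
case: (scale_of P - scale_of Q) fPQ (subn_eq0 (scale_of P) (scale_of Q)) => [|d] fPQ.
  by move=> /esym; lia.
rewrite divn_double_exp2// divn_doubleS_exp2//= => _.
move: fPQ; rewrite expnSr divnMA.
set z := _ %/ 2 ^ _ => <-; clear; lia.
Qed.

(** A frequency in the up-tile of T, the lowest one; comparing these numbers
    orders the tops. *)
Definition top_freq (T : dbitile) : nat := 2 ^ scale_of T * (freq_of T).*2.+1.

Lemma up_below_top_freq P T : up_below P T -> top_freq T %/ 2 ^ scale_of P = (freq_of P).*2.+1.
Proof.
move=> /and3P[PQ _ /eqP <-]; have -> : scale_of P = scale_of T + (scale_of P - scale_of T) by lia.
by rewrite -divn_exp2 /top_freq mulKn ?expn_gt0 //; congr (_ %/ 2 ^ _); lia.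
Qed.

Lemma down_below_top_freq P T : down_below P T -> (2 ^ scale_of T * (freq_of T).*2) %/ 2 ^ scale_of P = (freq_of P).*2.
Proof.
move=> /and3P[PQ _ /eqP <-]; have -> : scale_of P = scale_of T + (scale_of P - scale_of T) by lia.
by rewrite -divn_exp2 mulKn ?expn_gt0 //; congr (_ %/ 2 ^ _); lia.
Qed.

Definition down_meet P Q := down_below P Q || down_below Q P.

Lemma down_meet_sym P Q : down_meet P Q = down_meet Q P.
Proof. by rewrite /down_meet orbC. Qed.

(** In an up-tree, the frequencies of a member of coarser time lie in the
    up-half of any member of finer time that they meet, so they miss its
    down-half. *)
Lemma up_tree_down_meet P Q T : up_below P T -> up_below Q T -> down_meet P Q -> P = Q.
Proof.
wlog PQ : P Q / down_below P Q.
  move=> h uP uQ; rewrite /down_meet => /orP[d|d]; first by apply: h => //; rewrite /down_meet d.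
  by apply/esym; apply: h => //; rewrite /down_meet d.
move=> /up_below_top_freq tP /up_below_top_freq tQ _.
case: (eqVneq (scale_of P) (scale_of Q)) => [e|ne]; first exact/(below_anti (down_below_below PQ)).
have /and3P[sPQ _ /eqP fPQ] := PQ.
have d0 : 0 < scale_of P - scale_of Q by move: ne; lia.
move: tP; have -> : scale_of P = scale_of Q + (scale_of P - scale_of Q) by lia.
rewrite -divn_exp2 tQ divn_doubleS_exp2//.
by rewrite divn_double_exp2// in fPQ; rewrite fPQ; lia.
Qed.

(** The disjointness behind the selection of trees. If the down-tile of P
    meets that of P1 with P1 of finer time, then P1 is below P, hence below
    T. Otherwise the frequencies of P1, and with them top_freq T1, lie in
    the down-half of P, while top_freq T lies in its up-half, so T1 would be
    the lower top. *)
Lemma selected_down_meet P T P1 T1 : up_below P T -> up_below P1 T1 ->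
  top_freq T <= top_freq T1 -> ~~ below P1 T -> ~~ down_meet P P1.
Proof.
move=> uP uP1 tT nb; apply/negP => /orP[PP1|P1P]; last first.
  by move/negP: nb; apply; apply: below_trans (up_below_below uP); exact: down_below_below.
case: (eqVneq (scale_of P) (scale_of P1)) => [e|ne].
  by move: nb; rewrite -(below_anti (down_below_below PP1) e) (up_below_below uP).
have /and3P[sPQ _ /eqP fPQ] := PP1.
have d0 : 0 < scale_of P - scale_of P1 by move: ne; lia.
have t1 : top_freq T1 %/ 2 ^ scale_of P = (freq_of P).*2.
  have -> : scale_of P = scale_of P1 + (scale_of P - scale_of P1) by lia.
  by rewrite -divn_exp2 (up_below_top_freq uP1) divn_doubleS_exp2// -divn_double_exp2.
have := leq_div2r (2 ^ scale_of P) tT; rewrite t1 (up_below_top_freq uP); lia.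
Qed.

Lemma cell_div_coarser i j m (a : 'I_(2 ^ K)) :
  j <= i -> i <= K -> a \in cell i m -> a %/ 2 ^ (K - j) = m %/ 2 ^ (i - j).
Proof.
move=> ji iK; rewrite inE => /eqP <-; rewrite divn_exp2; congr (_ %/ 2 ^ _); lia.
Qed.

Lemma cellS_mem j m (a : 'I_(2 ^ K)) : j < K ->
  (a \in cell j m) = (a \in cell j.+1 m.*2) || (a \in cell j.+1 m.*2.+1).
Proof.
move=> jK; rewrite !inE.
have -> : K - j = (K - j.+1) + 1 by lia.
rewrite -divn_exp2 expn1; set z := _ %/ 2 ^ _; lia.
Qed.

Lemma cell_half_disj j m (a : 'I_(2 ^ K)) :
  (a \in cell j.+1 m.*2) -> (a \in cell j.+1 m.*2.+1) = false.
Proof. by rewrite !inE => /eqP ->; lia. Qed.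

Lemma sum_cellS (V : nmodType) (F : 'I_(2 ^ K) -> V) j m : j < K ->
  (\sum_(a in cell j m) F a =
   \sum_(a in cell j.+1 m.*2) F a + \sum_(a in cell j.+1 m.*2.+1) F a)%R.
Proof.
move=> jK; rewrite (bigID (mem (cell j.+1 m.*2))) /=.
congr (_ + _)%R; apply: eq_bigl => a; rewrite (cellS_mem _ _ jK).
  by case: (a \in cell j.+1 m.*2); rewrite ?andbF.
by case: (boolP (a \in cell j.+1 m.*2)) => [/cell_half_disj ->|]; rewrite ?andbT.
Qed.

Lemma card_cell j m : j <= K -> m < 2 ^ j -> #|cell j m| = 2 ^ (K - j).
Proof.
move=> jK; have [d [dK ->]] : exists d, d <= K /\ j = K - d.
  by exists (K - j); lia.
rewrite subKn //; elim: d m dK => {jK} [|d IH] m dK hm.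
  move: hm; rewrite expn0 subn0 => hm.
  rewrite -[RHS](cards1 (Ordinal hm)); apply: eq_card => a.
  by rewrite !inE subnn expn0 divn1.
rewrite -sum1_card sum_cellS; last lia.
have e : (K - d.+1).+1 = K - d by lia.
have h2 : 2 ^ (K - d) = (2 ^ (K - d.+1)).*2 by rewrite -e expnS mul2n.
rewrite !sum1_card e !IH ?h2 ?expnS ?mul2n ?addnn//; lia.
Qed.

End Bitiles.

(** * Size, density and trees in the finite model *)

Section Discrete.
Local Open Scope ring_scope.
Context (R : realType) (Y : normedModType R) (q : R) (K : nat).
Hypothesis hq : 2 <= q.
Context (v : dbitile K -> 'I_(2 ^ K) -> Y) (U : {set dbitile K}).
Context (eps : nat -> 'I_(2 ^ K) -> R).
Hypothesis v_supp : forall P a, a \notin cell K (scale_of P) (time_of P) -> v P a = 0.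
Hypothesis eps_sq : forall t a, eps t a * eps t a = 1.
Hypothesis v_haar : forall P t, P \in U ->
  (t %/ 2 ^ scale_of P = (freq_of P).*2.+1)%N ->
  exists c : Y, forall a, a \in cell K (scale_of P) (time_of P) ->
    v P a = (eps t a * (-1) ^+ (a %/ 2 ^ (K - (scale_of P).+1))%N) *: c.

Lemma eps_norm t a : `|eps t a| = 1.
Proof.
have /eqP := eps_sq t a; rewrite -expr2 sqrf_eq1 => /orP[/eqP ->|/eqP ->].
  by rewrite normr1.
by rewrite normrN1.
Qed.

Definition tree_fun (T : {set dbitile K}) a := \sum_(P in T) v P a.

(** The q-th power of the L^q norm of a tree, up to the length of the atoms. *)
Definition energy T := \sum_a `|tree_fun T a| `^ q.

Definition size_le (Ps : {set dbitile K}) (s : R) := forall (T : {set dbitile K}) (top : dbitile K),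
  T \subset Ps -> (forall P, P \in T -> up_below P top) ->
  energy T <= s * (2 ^ (K - scale_of top))%:R.

Lemma size_leS (P1 P2 : {set dbitile K}) s : P1 \subset P2 -> size_le P2 s -> size_le P1 s.
Proof. by move=> P12 h T top TP; apply: h; exact: (fintype.subset_trans TP P12). Qed.

Lemma scale_of_lt (P : dbitile K) : (scale_of P < K)%N.
Proof. exact: ltn_ord. Qed.

Lemma cell_mem_lt j m (a : 'I_(2 ^ K)) : (j <= K)%N -> a \in cell K j m -> (m < 2 ^ j)%N.
Proof.
move=> jK; rewrite inE => /eqP <-; rewrite ltn_divLR ?expn_gt0//.
by rewrite -expnD subnKC.
Qed.

(** Wave packets have constant modulus on their time interval. *)
Lemma norm_wave P a b : P \in U ->
  a \in cell K (scale_of P) (time_of P) -> b \in cell K (scale_of P) (time_of P) -> `|v P a| = `|v P b|.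
Proof.
move=> PU ha hb.
have [c h] := v_haar PU (up_below_top_freq (up_below_refl P)).
by rewrite (h a ha) (h b hb) !normrZ !eps_norm !normrX !normrN1 !expr1n.
Qed.

Lemma wave_le (Ps : {set dbitile K}) s P a : Ps \subset U -> size_le Ps s -> P \in Ps ->
  a \in cell K (scale_of P) (time_of P) -> `|v P a| `^ q <= s.
Proof.
move=> PU sP PP aP; have := sP (finset.set1 P) P.
rewrite finset.sub1set PP => /(_ isT) h.
have {}h : energy (finset.set1 P) <= s * (2 ^ (K - scale_of P))%:R.
  by apply: h => Q; rewrite finset.inE => /eqP ->; exact: up_below_refl.
have : \sum_(b in cell K (scale_of P) (time_of P)) `|v P a| `^ q <= energy (finset.set1 P).
  rewrite [leRHS](bigID (mem (cell K (scale_of P) (time_of P)))) /=.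
  rewrite -[leLHS]addr0 lerD//; last by apply: sumr_ge0 => b _; exact: powR_ge0.
  apply: ler_sum => b bP; rewrite /tree_fun big_set1.
  by rewrite (norm_wave (fintype.subsetP PU _ PP) aP bP).
rewrite sumr_const (card_cell (ltnW (scale_of_lt P)) (cell_mem_lt (ltnW (scale_of_lt P)) aP)).
by move=> h2; have := le_trans h2 h; rewrite -[leLHS]mulr_natr ler_pM2r// ltr0n expn_gt0.
Qed.

(** After multiplication by the sign eps t, a term of an up-tree is a
    multiple of a Haar function: its mean over a cell vanishes when the cell
    contains the support, and the function is constant on the cell
    otherwise. *)
Lemma cell_sum_wave P t j (a : 'I_(2 ^ K)) : P \in U -> (j <= K)%N ->
  (t %/ 2 ^ scale_of P = (freq_of P).*2.+1)%N ->
  \sum_(b in cell K j (a %/ 2 ^ (K - j))) eps t b *: v P b =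
  if (scale_of P < j)%N then (2 ^ (K - j))%:R *: (eps t a *: v P a) else 0.
Proof.
move=> PU jK tP; have [c hc] := v_haar PU tP.
have hc' b : b \in cell K (scale_of P) (time_of P) ->
    eps t b *: v P b = (-1) ^+ (b %/ 2 ^ (K - (scale_of P).+1))%N *: c.
  by move=> bP; rewrite hc// scalerA mulrA eps_sq mul1r.
case: ifPn => Pj.
  rewrite (eq_bigr (fun=> eps t a *: v P a)).
    rewrite sumr_const card_cell// ?scaler_nat//.
    by rewrite ltn_divLR ?expn_gt0// -expnD subnKC.
  move=> b; rewrite inE => /eqP ba.
  have e i : (i <= j)%N -> (b %/ 2 ^ (K - i) = a %/ 2 ^ (K - i))%N.
    move=> ij; have -> : (K - i = (K - j) + (j - i))%N by rewrite subn_chain.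
    by rewrite -!divn_exp2 ba.
  have bc : (b \in cell K (scale_of P) (time_of P)) = (a \in cell K (scale_of P) (time_of P)).
    by rewrite !inE e// ltnW.
  case: (boolP (a \in cell K (scale_of P) (time_of P))) => aP.
    by rewrite !hc' ?bc// e.
  by rewrite !v_supp ?bc// !scaler0.
rewrite -leqNgt in Pj.
case: (pickP (mem (cell K (scale_of P) (time_of P)))) => [d /= dP|P0]; last first.
  by rewrite big1// => b _; rewrite v_supp ?scaler0//; have := P0 b => /= ->.
have PK := scale_of_lt P.
have mP := cell_mem_lt (ltnW PK) dP.
have [ea|na] := eqVneq (time_of P %/ 2 ^ (scale_of P - j))%N (a %/ 2 ^ (K - j))%N; last first.
  rewrite big1// => b; rewrite inE => /eqP ba.
  rewrite v_supp ?scaler0//; apply: contra na => bP.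
  by rewrite -(cell_div_coarser Pj (ltnW PK) bP) ba.
transitivity (\sum_(b in cell K (scale_of P) (time_of P)) eps t b *: v P b).
  rewrite (bigID (mem (cell K (scale_of P) (time_of P)))) /= [X in _ + X]big1 ?addr0; last first.
    by move=> b /andP[_ bP]; rewrite v_supp ?scaler0.
  apply: eq_bigl => b; apply: andb_idl => bP.
  by rewrite inE (cell_div_coarser Pj (ltnW PK) bP) ea.
rewrite sum_cellS// (eq_bigr (fun=> c)); last first.
  move=> b bP; rewrite hc'; last by rewrite cellS_mem// bP.
  by move: bP; rewrite inE => /eqP ->; rewrite -signr_odd odd_double scale1r.
rewrite [X in _ + X](eq_bigr (fun=> - c)); last first.
  move=> b bP; rewrite hc'; last by rewrite cellS_mem// bP orbT.
  move: bP; rewrite inE => /eqP ->.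
  by rewrite -signr_odd /= odd_double expr1 scaleN1r.
have m2 : ((time_of P).*2.+1 < 2 ^ (scale_of P).+1)%N by rewrite expnS mul2n; move: mP; clear; lia.
by rewrite !sumr_const !card_cell// ?mulNrn ?subrr// ltnW.
Qed.

Context (E : {set 'I_(2 ^ K)}) (N : 'I_(2 ^ K) -> nat).

Definition in_up (P : dbitile K) n := (n %/ 2 ^ scale_of P == (freq_of P).*2.+1)%N.

(** The part of E where the frequency N(a) is in the frequency interval of
    Q. *)
Definition dens_set (Q : dbitile K) : {set 'I_(2 ^ K)} :=
  finset (fun a => [&& a \in E, a \in cell K (scale_of Q) (time_of Q)
                     & (N a %/ 2 ^ (scale_of Q).+1 == freq_of Q)%N]).

Definition dens_le (Ps : {set dbitile K}) (d : R) := forall P Q, P \in Ps ->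
  below P Q -> #|dens_set Q|%:R <= d * (2 ^ (K - scale_of Q))%:R.

Lemma dens_leS (P1 P2 : {set dbitile K}) d : P1 \subset P2 -> dens_le P2 d -> dens_le P1 d.
Proof. by move=> P12 h P Q PP; apply: h; exact: (fintype.subsetP P12). Qed.

(** The terms of the bitiles whose up-tile contains the point (a, N(a)). *)
Definition linearized_sum (Ps : {set dbitile K}) a := \sum_(P in Ps | in_up P (N a)) v P a.

Definition carleson_sum (Ps : {set dbitile K}) := \sum_(a in E) `|linearized_sum Ps a|.

(** * The contribution of one tree *)

Section Tree.
Context (Ts : {set dbitile K}) (top : dbitile K) (s : R).
Hypothesis TU : Ts \subset U.
Hypothesis Ttop : forall P, P \in Ts -> below P top.
Hypothesis Ts_size : size_le Ts s.
Hypothesis s0 : 0 < s.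

Let sig := s `^ q^-1.

Let q0 : 0 < q. Proof. by apply: lt_le_trans hq. Qed.

Let sig_gt0 : 0 < sig. Proof. exact: powR_gt0. Qed.

Let sigq : sig `^ q = s.
Proof. by rewrite /sig -powRrM mulVf ?gt_eqF// powRr1// ltW. Qed.

Let Tu : {set dbitile K} := finset (fun P => (P \in Ts) && up_below P top).
Let t := top_freq top.
Let u a := `|tree_fun Tu a|.

(** A single bitile is an up-tree with itself as top. *)
Lemma tree_wave_le P a : P \in Ts -> `|v P a| <= sig.
Proof.
move=> PT; case: (boolP (a \in cell K (scale_of P) (time_of P))) => aP; last first.
  by rewrite v_supp// normr0 ltW.
have := wave_le TU Ts_size PT aP; rewrite -sigq => h.
rewrite leNgt; apply/negP => lt.
have := @gt0_ltr_powR R q q0 _ _ _ _ lt.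
rewrite !nnegrE normr_ge0 (ltW sig_gt0) => /(_ isT isT).
by rewrite ltNge h.
Qed.

(** Where the top is below the down-tiles, the frequencies of a bitile of
    coarser time lie in the down-half of the finer ones; so at each point at
    most one up-tile contains (a, N(a)). *)
Lemma down_part_le a : 
  `|\sum_(P in Ts | in_up P (N a) && ~~ up_below P top) v P a| <= sig.
Proof.
case: (pickP (fun P : dbitile K => [&& P \in Ts, in_up P (N a) && ~~ up_below P top
   & a \in cell K (scale_of P) (time_of P)])) => [P /and3P[PT /andP[Pa Pd] aP]|none]; last first.
  rewrite big1 ?normr0 ?ltW// => P /and3P[PT Pa Pd]; rewrite v_supp//.
  by have := none P; rewrite /= PT Pa Pd /= => ->.
rewrite (bigD1 P) /=; last by rewrite PT Pa Pd.
rewrite big1 ?addr0 ?tree_wave_le// => Q /andP[/and3P[QT Qa Qd] QP].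
apply/v_supp/negP => aQ.
have dP : down_below P top by have := below_up_or_down (Ttop PT); rewrite (negbTE Pd).
have dQ : down_below Q top by have := below_up_or_down (Ttop QT); rewrite (negbTE Qd).
move: dP dQ => /down_below_top_freq dP /down_below_top_freq dQ.
have aux (P1 P2 : dbitile K) : (scale_of P1 < scale_of P2)%N -> in_up P1 (N a) -> in_up P2 (N a) ->
    ((2 ^ scale_of top * (freq_of top).*2) %/ 2 ^ scale_of P1 = (freq_of P1).*2)%N ->
    ((2 ^ scale_of top * (freq_of top).*2) %/ 2 ^ scale_of P2 = (freq_of P2).*2)%N -> False.
  move=> lt /eqP u1 /eqP u2 d1 d2; move: u2 d2.
  rewrite -(subnKC (ltnW lt)) -!divn_exp2 u1 d1.
  rewrite divn_double_exp2 ?subn_gt0// divn_doubleS_exp2 ?subn_gt0// => ->.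
  by clear; lia.
have [lt|gt|e] := ltngtP (scale_of P) (scale_of Q); first exact: (aux P Q).
  exact: (aux Q P).
move/negP: QP; apply; apply/eqP; apply: dbitile_inj => //.
  by move: aP aQ; rewrite !inE -e => /eqP -> /eqP ->.
by move: Pa Qa; rewrite /in_up e => /eqP -> /eqP; clear; lia.
Qed.

(** The sum of the terms of coarse scale is the conditional expectation of
    the whole tree. *)
Lemma partial_sum_up j (a : 'I_(2 ^ K)) : (j <= K)%N ->
  \sum_(b in cell K j (a %/ 2 ^ (K - j))) eps t b *: tree_fun Tu b =
  (2 ^ (K - j))%:R *: (eps t a *: \sum_(P in Tu | (scale_of P < j)%N) v P a).
Proof.
move=> jK; under eq_bigr do rewrite /tree_fun scaler_sumr.
rewrite exchange_big /= !scaler_sumr [RHS]big_mkcondr /=.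
apply: eq_bigr => P; rewrite inE => /andP[PT uP].
by rewrite cell_sum_wave ?(fintype.subsetP TU)//; exact: up_below_top_freq.
Qed.

Lemma partial_sum_up_le j c (a : 'I_(2 ^ K)) : (j <= K)%N ->
  \sum_(b in cell K j (a %/ 2 ^ (K - j))) u b <= c * (2 ^ (K - j))%:R ->
  `|\sum_(P in Tu | (scale_of P < j)%N) v P a| <= c.
Proof.
move=> jK h; have p0 : 0 < (2 ^ (K - j))%:R :> R by rewrite ltr0n expn_gt0.
rewrite -(ler_pM2r p0); apply: le_trans h.
have -> : `|\sum_(P in Tu | (scale_of P < j)%N) v P a| * (2 ^ (K - j))%:R
    = `|(2 ^ (K - j))%:R *: (eps t a *: \sum_(P in Tu | (scale_of P < j)%N) v P a)|.
  by rewrite !normrZ eps_norm mul1r mulrC (ger0_norm (ltW p0)).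
rewrite -partial_sum_up//; apply: le_trans (ler_norm_sum _ _ _) _.
by apply: ler_sum => b _; rewrite normrZ eps_norm mul1r.
Qed.

(** The up-tiles of an up-tree are nested in frequency, so that the
    condition on N(a) selects the scales from some j0 on: the sum is a
    difference of two conditional expectations of the tree. *)
Lemma up_part_le a j1 c : (j1 <= K)%N -> (scale_of top <= j1)%N -> 0 <= c ->
  (forall P, P \in Ts -> a \in cell K (scale_of P) (time_of P) -> (scale_of P < j1)%N) ->
  (forall j, (scale_of top <= j <= j1)%N ->
     \sum_(b in cell K j (a %/ 2 ^ (K - j))) u b <= c * (2 ^ (K - j))%:R) ->
  `|\sum_(P in Ts | in_up P (N a) && up_below P top) v P a| <= c *+ 2.
Proof.
move=> j1K tj1 c0 sep avg.
pose eqp m := (N a %/ 2 ^ m == t %/ 2 ^ m)%N.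
have eqpS m m' : (m <= m')%N -> eqp m -> eqp m'.
  by move=> mm /eqP e; rewrite /eqp -(subnKC mm) -!divn_exp2 e.
pose j0 := find eqp (iota 0 K).
have j0P i : (i < K)%N -> eqp i = (j0 <= i)%N.
  move=> iK; apply/idP/idP => [ei|ji].
    rewrite leqNgt; apply/negP => /(before_find 0%N).
    by rewrite nth_iota// add0n ei.
  have hs : has eqp (iota 0 K) by rewrite has_find size_iota; apply: leq_ltn_trans iK.
  apply: eqpS ji _; have := nth_find 0%N hs; rewrite nth_iota//.
  by rewrite -[ltnRHS](size_iota 0 K) -has_find.
(* all scales of the tree are at least that of its top *)
pose j2 := maxn (scale_of top) (minn j0 j1).
have j2j1 : (j2 <= j1)%N by rewrite geq_max tj1 geq_minr.
have -> : \sum_(P in Ts | in_up P (N a) && up_below P top) v P a =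
    \sum_(P in Tu | (scale_of P < j1)%N) v P a - \sum_(P in Tu | (scale_of P < j2)%N) v P a.
  rewrite big_mkcondr [X in X - _]big_mkcondr [X in _ - X]big_mkcondr /= -sumrB.
  rewrite (bigID (fun P => up_below P top)) /= [X in _ + X]big1 ?addr0; last first.
    by move=> P /andP[_ /negbTE ->]; rewrite andbF.
  apply: eq_big => P; first by rewrite inE.
  move=> /andP[PT uP]; rewrite uP andbT.
  have iT : (scale_of top <= scale_of P)%N by have := below_scale (Ttop PT).
  have up_eqp : in_up P (N a) = eqp (scale_of P).
    by rewrite /in_up /eqp -/t /t (up_below_top_freq uP).
  rewrite up_eqp j0P ?scale_of_lt// /j2 !ltnNge geq_max geq_min iT /=.
  have [aP|aP] := boolP (a \in cell K (scale_of P) (time_of P)); last first.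
    by rewrite v_supp//; do 3?case: ifP => _; rewrite ?subrr ?subr0.
  have lt := sep P PT aP.
  rewrite (leqNgt j1) lt /= orbF.
  by case: (j0 <= scale_of P)%N; rewrite /= ?subr0 ?subrr.
rewrite mulr2n; apply: le_trans (ler_normB _ _) _; apply: lerD.
  by apply: partial_sum_up_le => //; apply: avg; rewrite tj1 leqnn.
apply: partial_sum_up_le; first exact: leq_trans j1K.
by apply: avg; rewrite j2j1 leq_maxl.
Qed.

Context (d : R).
Hypothesis Ts_dens : dens_le Ts d.
Hypothesis d0 : 0 <= d.

(** The bound 2 c + sigma of the two parts is written with c squared, as the
    maximal function is controlled in L^2. *)
Lemma linearized_sum_le a j1 c : (j1 <= K)%N -> (scale_of top <= j1)%N -> 0 <= c ->
  (forall P, P \in Ts -> a \in cell K (scale_of P) (time_of P) -> (scale_of P < j1)%N) ->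
  (forall j, (scale_of top <= j <= j1)%N ->
     \sum_(b in cell K j (a %/ 2 ^ (K - j))) u b <= c * (2 ^ (K - j))%:R) ->
  `|linearized_sum Ts a| <= sig *+ 2 + c ^+ 2 / sig.
Proof.
move=> j1K tj1 c0 sep avg.
have h1 := up_part_le j1K tj1 c0 sep avg; have h2 := down_part_le a.
have -> : linearized_sum Ts a = \sum_(P in Ts | in_up P (N a) && up_below P top) v P a +
    \sum_(P in Ts | in_up P (N a) && ~~ up_below P top) v P a.
  rewrite /linearized_sum (bigID (fun P => up_below P top)) /=.
  by congr (_ + _); apply: eq_bigl => P; rewrite andbA.
apply: le_trans (ler_normD _ _) _; apply: le_trans (lerD h1 h2) _.
have : 0 <= (c - sig) ^+ 2 / sig by rewrite divr_ge0 ?sqr_ge0// ltW.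
have -> : (c - sig) ^+ 2 / sig = c ^+ 2 / sig - c *+ 2 + sig.
  by field; rewrite gt_eqF.
lra.
Qed.

(** The Bellman function of Doob's maximal inequality in L^2: with c the
    largest mean of u over the cells containing the given one, the integral
    of the square of the maximal function is at most the integral of 4 u^2 -
    4 c u + 2 c^2. It is additive over the two halves of a cell and does not
    increase when c is replaced by the maximum of c and the mean. *)
Definition doob_bound c j m := sig *+ 2 * (2 ^ (K - j))%:R + sig^-1 *
  (4 * \sum_(b in cell K j m) u b ^+ 2 - 4 * c * \sum_(b in cell K j m) u b
   + 2 * c ^+ 2 * (2 ^ (K - j))%:R).

(** The terms that do not vanish on a half cell without bitiles of the tree
    come from coarser scales, hence they need N(a) in the frequency interval
    that Q, the bitile over the parent cell, shares with the tree. Density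
    bounds the number of such points by d times the length of the parent,
    twice that of the half. *)
Lemma tree_free_cell j m m' c P : (j < K)%N -> (scale_of top <= j)%N -> (m < 2 ^ j)%N ->
  (m' %/ 2 = m)%N -> P \in Ts -> (j <= scale_of P)%N ->
  (time_of P %/ 2 ^ (scale_of P - j) = m)%N -> 0 <= c ->
  (forall P, P \in Ts -> (j < scale_of P)%N -> (time_of P %/ 2 ^ (scale_of P - j.+1))%N != m') ->
  (forall l, (scale_of top <= l <= j.+1)%N ->
    \sum_(b in cell K l (m' %/ 2 ^ (j.+1 - l))) u b <= c * (2 ^ (K - l))%:R) ->
  \sum_(a in E | a \in cell K j.+1 m') `|linearized_sum Ts a| <=
    2 * d * doob_bound c j.+1 m'.
Proof.
move=> jK tj mj m'm PT jP tP c0 free avg.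
have mK : (m < 2 ^ K)%N by apply: leq_trans mj _; rewrite leq_exp2l// ltnW.
have nK : (freq_of top %/ 2 ^ (j - scale_of top) < 2 ^ K)%N.
  by apply: leq_ltn_trans (leq_div _ _) _; exact: ltn_ord.
pose Q : dbitile K := (Ordinal jK, Ordinal mK, Ordinal nK).
have sQ : scale_of Q = j by [].
have PQ : below P Q.
  apply/and3P; split => //; first by rewrite sQ tP.
  have /and3P[_ _ /eqP <-] := Ttop PT.
  by rewrite /freq_of /= sQ divn_exp2 addnC subn_chain.
have hitQ := Ts_dens PT PQ; rewrite sQ in hitQ.
have m'K : (m' < 2 ^ j.+1)%N.
  by rewrite expnS; move: mj; rewrite -m'm ltn_divLR// mulnC.
have bnd a : a \in E -> a \in cell K j.+1 m' ->
    `|linearized_sum Ts a| <= if a \in dens_set Q then sig *+ 2 + c ^+ 2 / sig else 0.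
  move=> aE am'.
  have sep P' : P' \in Ts -> a \in cell K (scale_of P') (time_of P') -> (scale_of P' < j.+1)%N.
    move=> P'T aP'; rewrite ltnNge; apply/negP => jP'.
    have := free P' P'T jP'; rewrite -(cell_div_coarser jP' (ltnW (scale_of_lt P')) aP').
    by move: am'; rewrite inE => ->.
  case: ifPn => [_|nhit].
    apply: (@linearized_sum_le a j.+1) => //; first exact: leqW.
    move=> l lj; have := avg l lj.
    by rewrite -(cell_div_coarser _ jK am')//; case/andP: lj.
  rewrite /linearized_sum big1 ?normr0// => P' /andP[P'T upP'].
  apply/v_supp/negP => aP'; move/negP: nhit; apply.
  have P'j := sep _ P'T aP'; rewrite ltnS in P'j.
  rewrite inE aE /= sQ; apply/andP; split.
    rewrite inE /time_of /= -m'm; move: am'; rewrite inE => /eqP <-.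
    by rewrite -divnMA -expnSr subnSK.
  rewrite /freq_of /=; have /and3P[tP' _ /eqP fP'] := Ttop P'T.
  have -> : (N a %/ 2 ^ j.+1 = freq_of P' %/ 2 ^ (j - scale_of P'))%N.
    have -> : freq_of P' = ((freq_of P').*2.+1 %/ 2 ^ 1)%N by rewrite expn1; clear; lia.
    move/eqP: upP' => <-; rewrite !divn_exp2; congr (_ %/ 2 ^ _)%N.
    by move: P'j; clear; lia.
  by rewrite -fP' divn_exp2 addnC subn_chain.
apply: (@le_trans _ _ (#|dens_set Q|%:R * (sig *+ 2 + c ^+ 2 / sig))).
  rewrite mulr_natl -sumr_const.
  apply: (@le_trans _ _ (\sum_(a in E | a \in cell K j.+1 m')
     if a \in dens_set Q then sig *+ 2 + c ^+ 2 / sig else 0)).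
    by apply: ler_sum => a /andP[aE am']; exact: bnd.
  rewrite -big_mkcondr /= [leRHS]big_mkcond [leLHS]big_mkcond /=.
  apply: ler_sum => a _; case: (a \in dens_set Q); rewrite ?andbF//.
  rewrite andbT; case: ifP => // _; rewrite addr_ge0 ?mulrn_wge0 ?(ltW sig_gt0)//.
  by rewrite divr_ge0 ?sqr_ge0 ?(ltW sig_gt0).
apply: (@le_trans _ _ (d * (2 ^ (K - j))%:R * (sig *+ 2 + c ^+ 2 / sig))).
  rewrite ler_wpM2r// addr_ge0 ?mulrn_wge0 ?(ltW sig_gt0)//.
  by rewrite divr_ge0 ?sqr_ge0 ?(ltW sig_gt0).
have -> : (2 ^ (K - j))%:R = 2 * (2 ^ (K - j.+1))%:R :> R.
  by rewrite -natrM -expnS subnSK.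
have -> : d * (2 * (2 ^ (K - j.+1))%:R) * (sig *+ 2 + c ^+ 2 / sig) =
    2 * d * (sig *+ 2 * (2 ^ (K - j.+1))%:R + sig^-1 * (c ^+ 2 * (2 ^ (K - j.+1))%:R)).
  by ring.
rewrite ler_wpM2l ?mulr_ge0// lerD2l ler_wpM2l ?invr_ge0 ?(ltW sig_gt0)//.
rewrite -(card_cell jK m'K).
have -> : (#|cell K j.+1 m'|)%:R = \sum_(b in cell K j.+1 m') (1 : R).
  by rewrite sumr_const.
rewrite !mulr_sumr -sumrB -big_split /=.
apply: ler_sum => b _; have := sqr_ge0 (2 * u b - c); lra.
Qed.

Lemma doob_boundS c j m : (j < K)%N ->
  doob_bound c j m = doob_bound c j.+1 m.*2 + doob_bound c j.+1 m.*2.+1.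
Proof.
move=> jK; rewrite /doob_bound !(sum_cellS _ _ jK).
have -> : (2 ^ (K - j))%:R = 2 * (2 ^ (K - j.+1))%:R :> R.
  by rewrite -natrM -expnS subnSK.
ring.
Qed.

Lemma doob_bound_max c j m (M := (2 ^ (K - j))%:R : R) :
  doob_bound (Num.max c (\sum_(b in cell K j m) u b / M)) j m <= doob_bound c j m.
Proof.
rewrite /doob_bound -/M; set A := \sum_(b in _) _ / M.
have M0 : 0 < M by rewrite ltr0n expn_gt0.
have -> : \sum_(b in cell K j m) u b = A * M.
  by rewrite /A -mulr_suml mulfVK// gt_eqF.
rewrite lerD2l ler_wpM2l ?invr_ge0 ?(ltW sig_gt0)//.
rewrite -!addrA lerD2l; case: (leP c A) => [cA|//].
rewrite -subr_ge0.
have -> : - (4 * c * (A * M)) + 2 * c ^+ 2 * M - (- (4 * A * (A * M)) + 2 * A ^+ 2 * M)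
   = 2 * (A - c) ^+ 2 * M by ring.
by apply: mulr_ge0 (ltW M0); apply: mulr_ge0; rewrite ?sqr_ge0.
Qed.

(** Descent from the top: a half that contains bitiles of the tree is
    treated by induction, with c updated to the mean over the half; the
    others by tree_free_cell. *)
Lemma tree_induct e j m c : (j + e = K)%N -> (scale_of top <= j)%N -> (m < 2 ^ j)%N ->
  (exists2 P, P \in Ts & (j <= scale_of P)%N && (time_of P %/ 2 ^ (scale_of P - j) == m)%N) ->
  0 <= c ->
  (forall l, (scale_of top <= l <= j)%N ->
    \sum_(b in cell K l (m %/ 2 ^ (j - l))) u b <= c * (2 ^ (K - l))%:R) ->
  \sum_(a in E | a \in cell K j m) `|linearized_sum Ts a| <= 2 * d * doob_bound c j m.
Proof.
elim: e j m c => [|e IH] j m c jK tj mj [P PT /andP[jP /eqP tP]] c0 avg.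
  have KP : (K <= scale_of P)%N by rewrite -[X in (X <= _)%N]jK addn0.
  by have := scale_of_lt P; rewrite ltnNge KP.
have {}jK1 : (j < K)%N by rewrite -jK addnS ltnS leq_addr.
have half m' : (m' %/ 2 = m)%N ->
    \sum_(a in E | a \in cell K j.+1 m') `|linearized_sum Ts a| <= 2 * d * doob_bound c j.+1 m'.
  move=> m'm; pose M : R := (2 ^ (K - j.+1))%:R.
  have M0 : 0 < M by rewrite ltr0n expn_gt0.
  (* the running maximum of the means, updated at the half cell *)
  pose c' := Num.max c (\sum_(b in cell K j.+1 m') u b / M).
  apply: (@le_trans _ _ (2 * d * doob_bound c' j.+1 m')); last first.
    by rewrite ler_wpM2l ?mulr_ge0//; exact: doob_bound_max.
  have c'0 : 0 <= c' by rewrite le_max c0.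
  have avg' l : (scale_of top <= l <= j.+1)%N ->
      \sum_(b in cell K l (m' %/ 2 ^ (j.+1 - l))) u b <= c' * (2 ^ (K - l))%:R.
    move=> /andP[tl]; rewrite leq_eqVlt ltnS => /orP[/eqP ->|lj].
      rewrite subnn divn1 -/M -ler_pdivrMr// mulr_suml.
      by rewrite le_max lexx orbT.
    rewrite subSn// expnS divnMA m'm.
    apply: (le_trans (avg l _)); first by rewrite tl.
    by rewrite ler_wpM2r ?ler0n// le_max lexx.
  case: (pickP (fun P : dbitile K => [&& P \in Ts, (j.+1 <= scale_of P)%N &
      (time_of P %/ 2 ^ (scale_of P - j.+1) == m')%N])) => [P' /and3P[P'T jP' tP']|none].
    apply: IH => //; first by rewrite addSnnS.
    - exact: leqW.
    - by rewrite expnS; move: mj; rewrite -m'm ltn_divLR// mulnC.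
    - by exists P' => //; rewrite jP'.
  apply: (tree_free_cell jK1 tj mj m'm PT jP tP c'0) => // P' P'T jP'.
  by apply/negP => tP'; have := none P'; rewrite /= P'T jP' tP'.
rewrite (doob_boundS _ _ jK1) mulrDr.
rewrite (bigID (mem (cell K j.+1 m.*2))) /=; apply: lerD.
  apply: le_trans (half m.*2 _); last by rewrite -muln2 mulnK.
  rewrite le_eqVlt; apply/orP; left; apply/eqP; apply: eq_bigl => a.
  by rewrite (cellS_mem _ _ jK1) -andbA; case: (a \in cell K j.+1 m.*2); rewrite ?andbF ?andbT.
apply: le_trans (half m.*2.+1 _); last by clear; lia.
rewrite le_eqVlt; apply/orP; left; apply/eqP; apply: eq_bigl => a.
rewrite (cellS_mem _ _ jK1) -andbA; case: (boolP (a \in cell K j.+1 m.*2)).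
  by move=> /cell_half_disj ->; rewrite !andbF.
by rewrite andbT.
Qed.

(** Since q >= 2, u^2 <= sigma^2 + sigma^2 (u / sigma)^q pointwise; the size
    bounds the sum of the last term. *)
Lemma sum_sq_le : \sum_(b in cell K (scale_of top) (time_of top)) u b ^+ 2 <=
  #|cell K (scale_of top) (time_of top)|%:R * sig ^+ 2 + sig ^+ 2 * (2 ^ (K - scale_of top))%:R.
Proof.
have Tue : energy Tu <= s * (2 ^ (K - scale_of top))%:R.
  apply: Ts_size; first by apply/fintype.subsetP => P; rewrite inE => /andP[].
  by move=> P; rewrite inE => /andP[].
apply: (@le_trans _ _ (\sum_(b in cell K (scale_of top) (time_of top))
    (sig ^+ 2 + sig ^+ 2 / s * u b `^ q))).
  apply: ler_sum => b _; have [us|us] := leP (u b) sig.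
    rewrite -[leLHS]addr0; apply: lerD.
      by rewrite ler_pXn2r// nnegrE ?normr_ge0// ltW.
    by apply: mulr_ge0 (powR_ge0 _ _); apply: divr_ge0; rewrite ?sqr_ge0// ltW.
  rewrite -[leLHS]add0r; apply: lerD; first exact: sqr_ge0.
  have -> : u b = sig * (u b / sig) by rewrite mulrC divfK// gt_eqF.
  set w := u b / sig.
  have w1 : 1 <= w by rewrite ler_pdivlMr// mul1r ltW.
  have w0 : 0 <= w by apply: le_trans w1.
  rewrite powRM ?(ltW sig_gt0)// sigq exprMn -mulrA ler_wpM2l ?sqr_ge0//.
  rewrite mulrA mulVf ?gt_eqF// mul1r -powR_mulrn//.
  exact: ler_powR.
rewrite big_split /= sumr_const mulr_natl lerD2l -mulr_sumr.
apply: (@le_trans _ _ (sig ^+ 2 / s * energy Tu)).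
  rewrite ler_wpM2l ?divr_ge0 ?sqr_ge0 ?(ltW s0)//.
  rewrite /energy [leRHS](bigID (mem (cell K (scale_of top) (time_of top)))) /=.
  by rewrite lerDl sumr_ge0// => b _; exact: powR_ge0.
apply: le_trans (ler_wpM2l _ Tue) _; first by rewrite divr_ge0 ?sqr_ge0 ?(ltW s0).
by rewrite mulrA divfK// gt_eqF.
Qed.

(** The induction is started with c the mean of u over the top interval,
    where the terms of doob_bound in c are nonpositive. *)
Lemma tree_lemma :
  \sum_(a in E) `|linearized_sum Ts a| <= 20 * sig * d * (2 ^ (K - scale_of top))%:R.
Proof.
set M : R := (2 ^ (K - scale_of top))%:R.
have M0 : 0 < M by rewrite ltr0n expn_gt0.
have tK := ltnW (scale_of_lt top).
have supp a : a \notin cell K (scale_of top) (time_of top) -> linearized_sum Ts a = 0.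
  move=> aT; rewrite /linearized_sum big1// => P /andP[PT _]; apply: v_supp.
  apply: contra aT => aP; have /and3P[tP /eqP <- _] := Ttop PT.
  by rewrite inE (cell_div_coarser tP (ltnW (scale_of_lt P)) aP).
have rhs0 : 0 <= 20 * sig * d * M.
  by rewrite !mulr_ge0 ?(ltW sig_gt0) ?(ltW M0).
have [tm|tm] := ltnP (time_of top) (2 ^ scale_of top)%N; last first.
  rewrite big1// => a _; rewrite supp ?normr0//; apply/negP => /(cell_mem_lt tK).
  by rewrite ltnNge tm.
have [/existsP[P PT]|/existsPn noP] := boolP [exists P, P \in Ts]; last first.
  rewrite big1// => a _; rewrite /linearized_sum big1 ?normr0// => P /andP[PT _].
  by have := noP P; rewrite PT.
have -> : \sum_(a in E) `|linearized_sum Ts a| =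
    \sum_(a in E | a \in cell K (scale_of top) (time_of top)) `|linearized_sum Ts a|.
  rewrite [RHS]big_mkcondr; apply: eq_bigr => a _.
  by case: ifPn => // /supp ->; rewrite normr0.
pose c := \sum_(b in cell K (scale_of top) (time_of top)) u b / M.
have c0 : 0 <= c by rewrite sumr_ge0// => b _; rewrite divr_ge0 ?normr_ge0 ?(ltW M0).
have cM : \sum_(b in cell K (scale_of top) (time_of top)) u b = c * M.
  by rewrite /c -mulr_suml mulfVK// gt_eqF.
apply: le_trans (tree_induct (subnKC tK) (leqnn _) tm _ c0 _) _.
- exists P => //; have /and3P[tP e _] := Ttop PT.
  by rewrite tP e.
- move=> l /andP[l1 l2]; have -> : l = scale_of top by apply/eqP; rewrite eqn_leq l1 l2.
  by rewrite subnn divn1 cM.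
rewrite /doob_bound -/M cM; have := sum_sq_le; rewrite -/M card_cell// -/M.
set S := \sum_(b in _) _ => hS.
have -> : 20 * sig * d * M = 2 * d * (sig *+ 2 * M + sig^-1 * (8 * (sig ^+ 2 * M))).
  by field; rewrite gt_eqF.
rewrite ler_wpM2l ?mulr_ge0// lerD2l ler_wpM2l ?invr_ge0 ?(ltW sig_gt0)//.
have := mulr_ge0 (sqr_ge0 c) (ltW M0); move: hS; rewrite [M * _]mulrC expr2; lra.
Qed.

End Tree.
Let q0 : 0 < q. Proof. by apply: lt_le_trans hq. Qed.

(** The bitiles outside P' are distributed among the tops of M by g, and
    each share is a tree. *)
Lemma carleson_sum_remove_trees (Ps P' M : {set dbitile K}) (g : dbitile K -> dbitile K) s d :
  Ps \subset U -> size_le Ps s -> dens_le Ps d -> 0 < s -> 0 <= d ->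
  P' \subset Ps ->
  (forall P, P \in Ps -> P \notin P' -> (g P \in M) && below P (g P)) ->
  carleson_sum Ps <= carleson_sum P' + 20 * s `^ q^-1 * d * \sum_(T in M) (2 ^ (K - scale_of T))%:R.
Proof.
move=> PU sP dP s0 d0 P'P gM.
pose tr T := finset (fun P => [&& P \in Ps, P \notin P' & g P == T]).
have trP T : tr T \subset Ps by apply/fintype.subsetP => P; rewrite inE => /andP[].
have split a : linearized_sum Ps a = linearized_sum P' a + \sum_(T in M) linearized_sum (tr T) a.
  rewrite /linearized_sum (bigID (mem P')) /=; congr (_ + _).
    apply: eq_bigl => P; rewrite andbAC; congr (_ && _).
    by apply: andb_idl => /(fintype.subsetP P'P).
  rewrite (partition_big g (mem M)) /=; last first.
    by move=> P /andP[/andP[PP _] PP']; case/andP: (gM _ PP PP').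
  apply: eq_bigr => T _; apply: eq_bigl => P; rewrite inE.
  by case: (P \in Ps); case: (P \in P'); case: (in_up _ _); rewrite ?andbT ?andbF.
apply: (@le_trans _ _ (carleson_sum P' + \sum_(T in M) \sum_(a in E) `|linearized_sum (tr T) a|)).
  rewrite exchange_big /= -big_split /=; apply: ler_sum => a _.
  by rewrite split; apply: le_trans (ler_normD _ _) _; rewrite lerD2l ler_norm_sum.
rewrite lerD2l mulr_sumr; apply: ler_sum => T _.
apply: tree_lemma => //.
- exact: (fintype.subset_trans (trP T)).
- by move=> P; rewrite inE => /and3P[PP PP' /eqP <-]; case/andP: (gM _ PP PP').
- exact: size_leS sP.
- exact: dens_leS dP.
Qed.

(** A common point makes both the times and the frequencies of the two
    bitiles nested. *)
Lemma dens_set_comparable Q Q' a : a \in dens_set Q -> a \in dens_set Q' ->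
  (scale_of Q <= scale_of Q')%N -> below Q' Q.
Proof.
rewrite !inE => /and3P[_ /eqP aQ /eqP nQ] /and3P[_ /eqP aQ' /eqP nQ'] QQ'.
apply/and3P; split => //.
- by rewrite -aQ' -aQ divn_exp2 subn_chain// ltnW// scale_of_lt.
- by rewrite -nQ -nQ' divn_exp2 addSn subnKC.
Qed.

(** The maximal bitiles Q with more than (d / 2) |I_Q| points have disjoint
    density sets, so their total length is at most 2 |E| / d. *)
Lemma dens_step (Ps : {set dbitile K}) s d :
  Ps \subset U -> size_le Ps s -> dens_le Ps d -> 0 < s -> 0 < d ->
  exists P' : {set dbitile K}, [/\ P' \subset Ps, dens_le P' (d / 2) &
    carleson_sum Ps <= carleson_sum P' + 40 * s `^ q^-1 * #|E|%:R].
Proof.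
move=> PU sP dP s0 d0.
pose bad (Q : dbitile K) := d / 2 * (2 ^ (K - scale_of Q))%:R < #|dens_set Q|%:R.
pose P' : {set dbitile K} := finset (fun P => (P \in Ps) && [forall Q, below P Q ==> ~~ bad Q]).
pose M : {set dbitile K} := finset (fun Q => bad Q && [forall Q', (bad Q' && below Q Q') ==> (Q' == Q)]).
have bad_max P Q : bad Q -> below P Q -> exists T, (T \in M) && below P T.
  move=> bQ PQ; have Qp : [pred T | bad T && below P T] Q by rewrite /= PQ andbT.
  case: (arg_minnP (fun T => scale_of T) Qp) => T /andP[bT PT] minT.
  exists T; rewrite PT andbT inE bT; apply/forallP => T'; apply/implyP => /andP[bT' TT'].
  have := minT T'; rewrite /= bT' (below_trans PT TT') => /(_ isT) le.
  by apply/eqP/esym/(below_anti TT')/eqP; rewrite eqn_leq le (below_scale TT').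
have gex P : exists T, (P \in Ps) ==> (P \notin P') ==> (T \in M) && below P T.
  have [PP|] := boolP (P \in Ps); last by exists P.
  have [|] := boolP (P \in P'); first by exists P.
  rewrite inE PP /= negb_forall => /existsP[Q]; rewrite negb_imply negbK => /andP[PQ bQ].
  exact: bad_max bQ PQ.
pose g P := xchoose (gex P).
have gP P : P \in Ps -> P \notin P' -> (g P \in M) && below P (g P).
  by move=> PP PP'; have := xchooseP (gex P); rewrite -/(g P) PP PP'.
have P'P : P' \subset Ps by apply/fintype.subsetP => P; rewrite inE => /andP[].
exists P'; split => //.
  move=> P Q; rewrite inE => /andP[PP /forallP/(_ Q)/implyP PQ] /PQ.
  by rewrite /bad -leNgt.
apply: le_trans (carleson_sum_remove_trees PU sP dP s0 (ltW d0) P'P gP) _.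
rewrite lerD2l.
suff: \sum_(T in M) (2 ^ (K - scale_of T))%:R <= 2 / d * #|E|%:R.
  move=> h; apply: le_trans (ler_wpM2l _ h) _.
    by apply: mulr_ge0 (ltW d0); apply: mulr_ge0 (powR_ge0 _ _).
  rewrite le_eqVlt; apply/orP; left; apply/eqP.
  by field; rewrite gt_eqF.
have triv : finset.trivIset [set dens_set T | T in M]%SET.
  apply/finset.trivIsetP => A B /imsetP[Q QM ->] /imsetP[Q' QM' ->] neq.
  rewrite -finset.setI_eq0; apply/eqP/finset.setP => a; rewrite finset.in_setI finset.in_set0.
  apply/negP => /andP[aQ aQ']; move/negP: neq; apply.
  move: QM QM'; rewrite !finset.inE => /andP[bQ /forallP mQ] /andP[bQ' /forallP mQ'].
  have [le|/ltnW le] := leqP (scale_of Q) (scale_of Q').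
    have QQ : below Q' Q := dens_set_comparable aQ aQ' le.
    by have := mQ' Q; rewrite bQ QQ /= => /eqP ->.
  have QQ : below Q Q' := dens_set_comparable aQ' aQ le.
  by have := mQ Q'; rewrite bQ' QQ /= => /eqP ->.
apply: (@le_trans _ _ (2 / d * \sum_(T in M) #|dens_set T|%:R)).
  rewrite mulr_sumr; apply: ler_sum => T; rewrite inE => /andP[bT _].
  have -> : (2 ^ (K - scale_of T))%:R = 2 / d * (d / 2 * (2 ^ (K - scale_of T))%:R) :> R.
    by field; rewrite gt_eqF.
  by rewrite ler_wpM2l ?divr_ge0 ?(ltW d0)// ltW.
rewrite ler_wpM2l ?divr_ge0 ?(ltW d0)// -natr_sum ler_nat.
have inj : {in M &, injective dens_set}.
  move=> Q Q'; rewrite !finset.inE => /andP[bQ /forallP mQ] /andP[bQ' /forallP mQ'] e.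
  have : (0 < #|dens_set Q|)%N.
    rewrite -(ltr0n R); apply: le_lt_trans bQ.
    by rewrite mulr_ge0 ?divr_ge0 ?(ltW d0).
  move=> /card_gt0P[a aQ]; have aQ' := aQ; rewrite e in aQ'.
  have [le|/ltnW le] := leqP (scale_of Q) (scale_of Q').
    by have := mQ' Q; rewrite bQ (dens_set_comparable aQ aQ' le) /= => /eqP ->.
  by have := mQ Q'; rewrite bQ' (dens_set_comparable aQ' aQ le) /= => /eqP ->.
rewrite -(big_imset (fun A : {set 'I_(2 ^ K)} => #|A|) inj) /= (eqP triv).
apply: subset_leq_card; apply/fintype.subsetP => a /bigcupP[A /imsetP[Q _ ->]].
by rewrite inE => /andP[].
Qed.

Context (B : R).
Hypothesis B0 : 0 < B.

Definition tree_seq_ok (l : seq ({set dbitile K} * dbitile K)) :=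
  all (fun x : {set dbitile K} * dbitile K => [&& x.1 \subset U, x.1 != finset.set0 & [forall P in x.1, up_below P x.2]]) l &&
  pairwise (fun x y : {set dbitile K} * dbitile K =>
    [forall P in x.1, forall Q in y.1, ~~ down_meet P Q]) l.

Hypothesis energy_le : forall l, tree_seq_ok l -> \sum_(x <- l) energy x.1 <= B.

Lemma energy0 : energy finset.set0 = 0.
Proof.
rewrite /energy big1// => a _; rewrite /tree_fun big_set0 normr0 powR0//.
by rewrite gt_eqF.
Qed.

Definition oversized (Ps : {set dbitile K}) s (x : {set dbitile K} * dbitile K) :=
  [&& x.1 \subset Ps, [forall P in x.1, up_below P x.2]
    & s * (2 ^ (K - scale_of x.2))%:R < energy x.1].

Lemma size_leP (Ps : {set dbitile K}) s :
  (forall x, ~~ oversized Ps s x) -> size_le Ps s.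
Proof.
move=> h T top TP uT; have := h (T, top).
rewrite /oversized /= TP leNgt; apply: contra => ->.
by rewrite andbT; apply/forall_inP.
Qed.

(** Among the oversized trees choose one whose top frequency is minimal,
    remove every bitile below its top, and repeat; selected_down_meet shows
    that the selected trees are disjoint. *)
Lemma select_trees n (Ps : {set dbitile K}) s d : (#|Ps| <= n)%N ->
  Ps \subset U -> size_le Ps s -> dens_le Ps d -> 0 < s -> 0 <= d ->
  exists (P' : {set dbitile K}) l, [/\ P' \subset Ps, size_le P' (s / 2),
    tree_seq_ok l, all (oversized Ps (s / 2)) l &
    carleson_sum Ps <= carleson_sum P' + 20 * s `^ q^-1 * d * \sum_(x <- l) (2 ^ (K - scale_of x.2))%:R].
Proof.
elim: n Ps => [|n IH] Ps cP PU sP dP s0 d0.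
  exists Ps, [::]; split => //; last by rewrite big_nil mulr0 addr0.
  have -> : Ps = finset.set0 by apply/eqP; rewrite -cards_eq0 -leqn0.
  move=> T top; rewrite finset.subset0 => /eqP -> _; rewrite energy0.
  by apply: mulr_ge0 => //; apply: divr_ge0 => //; exact: ltW.
case: (pickP (oversized Ps (s / 2))) => [x0 x0P|none]; last first.
  exists Ps, [::]; split => //; last by rewrite big_nil mulr0 addr0.
  by apply: size_leP => x; rewrite none.
case: (arg_minnP (fun x => top_freq x.2) x0P) => x xP xmin {x0 x0P}.
have /and3P[x1 /forall_inP x2 x3] := xP.
pose Ps1 := finset (fun P => (P \in Ps) && ~~ below P x.2).
have Ps1P : Ps1 \subset Ps by apply/fintype.subsetP => P; rewrite inE => /andP[].
have x0 : x.1 != finset.set0.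
  apply: contraTneq x3 => ->; rewrite energy0 -leNgt.
  by apply: mulr_ge0 => //; apply: divr_ge0 => //; exact: ltW.
have Ps1n : (#|Ps1| <= n)%N.
  rewrite -ltnS; apply: leq_trans cP; apply: proper_card.
  apply/fintype.properP; split => //; have /set0Pn[P Px] := x0.
  exists P; first exact: (fintype.subsetP x1).
  by rewrite inE (up_below_below (x2 _ Px)) andbF.
have [P' [l [P'P sP' okl ol Ll]]] := IH Ps1 Ps1n (fintype.subset_trans Ps1P PU)
  (size_leS Ps1P sP) (dens_leS Ps1P dP) s0 d0.
exists P', (x :: l); split => //.
- exact: fintype.subset_trans Ps1P.
- have /andP[ok1 ok2] := okl; rewrite /tree_seq_ok /= ok1 ok2 x0 !andbT.
  rewrite (fintype.subset_trans x1 PU) /=; apply/andP; split; first exact/forall_inP.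
  apply/allP => y yl; have /allP/(_ y yl)/and3P[y1 /forall_inP y2 y3] := ol.
  apply/forall_inP => P Px; apply/forall_inP => Q Qy.
  apply: (selected_down_meet (x2 _ Px) (y2 _ Qy)).
    apply: xmin; rewrite /oversized (fintype.subset_trans y1 Ps1P) y3 andbT.
    exact/forall_inP.
  by have := fintype.subsetP y1 _ Qy; rewrite inE => /andP[].
- rewrite /= xP; apply: sub_all ol => y /and3P[y1 y2 y3].
  by rewrite /oversized (fintype.subset_trans y1 Ps1P) y2.
have := @carleson_sum_remove_trees Ps Ps1 (finset.set1 x.2) (fun=> x.2) s d PU sP dP s0 d0 Ps1P.
rewrite big_set1 => h.
have {}h := h _; rewrite big_cons mulrDr addrA.
apply: (le_trans (h _)); last by rewrite addrAC lerD2r.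
by move=> P PP; rewrite !inE PP /= negbK eqxx.
Qed.

(** The tops of the selected trees have total length at most 2 B / s,
    because each tree has energy at least half its share s |I_T|. *)
Lemma size_step (Ps : {set dbitile K}) s d :
  Ps \subset U -> size_le Ps s -> dens_le Ps d -> 0 < s -> 0 <= d ->
  exists P' : {set dbitile K}, [/\ P' \subset Ps, size_le P' (s / 2) &
    carleson_sum Ps <= carleson_sum P' + 40 * (s `^ q^-1 / s) * d * B].
Proof.
move=> PU sP dP s0 d0.
have [P' [l [P'P sP' okl ol Ll]]] := select_trees (leqnn _) PU sP dP s0 d0.
exists P'; split => //; apply: (le_trans Ll); rewrite lerD2l.
have h : \sum_(x <- l) (2 ^ (K - scale_of x.2))%:R <= 2 / s * B.
  apply: (@le_trans _ _ (2 / s * \sum_(x <- l) energy x.1)); last first.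
    by rewrite ler_wpM2l ?energy_le// divr_ge0// ltW.
  rewrite mulr_sumr big_seq [leRHS]big_seq; apply: ler_sum => x xl.
  have /allP/(_ x xl)/and3P[_ _ /ltW x3] := ol.
  have -> : (2 ^ (K - scale_of x.2))%:R = 2 / s * (s / 2 * (2 ^ (K - scale_of x.2))%:R) :> R.
    by field; rewrite gt_eqF.
  by rewrite ler_wpM2l// divr_ge0// ltW.
have -> : 40 * (s `^ q^-1 / s) * d * B = 20 * s `^ q^-1 * d * (2 / s * B).
  by field; rewrite gt_eqF.
by rewrite ler_wpM2l// mulr_ge0// mulr_ge0// powR_ge0.
Qed.

Lemma size_le_all (Ps : {set dbitile K}) : Ps \subset U -> size_le Ps B.
Proof.
move=> PU T top TP uT.
have [->|T0] := eqVneq T finset.set0.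
  by rewrite energy0 mulr_ge0// ltW.
have := @energy_le [:: (T, top)]; rewrite big_seq1 => h.
have {}h : energy T <= B.
  apply: h; rewrite /tree_seq_ok /= T0 (fintype.subset_trans TP PU) /= !andbT.
  exact/forall_inP.
apply: le_trans h _; rewrite ler_peMr ?(ltW B0)//.
by rewrite ler1n expn_gt0.
Qed.

Lemma dens_le1 (Ps : {set dbitile K}) : dens_le Ps 1.
Proof.
move=> P Q _ _; rewrite mul1r ler_nat.
have [->|/set0Pn[a aQ]] := eqVneq (dens_set Q) finset.set0; first by rewrite cards0.
have aQ' : a \in cell K (scale_of Q) (time_of Q) by move: aQ; rewrite inE => /and3P[].
rewrite -(card_cell (ltnW (scale_of_lt Q)) (cell_mem_lt (ltnW (scale_of_lt Q)) aQ')).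
by apply: subset_leq_card; apply/fintype.subsetP => b; rewrite inE => /and3P[].
Qed.

(** A density below 2^-K leaves no point of E over any bitile. *)
Lemma dens_small_carleson_sum (Ps : {set dbitile K}) d : d * (2 ^ K)%:R < 1 -> dens_le Ps d ->
  carleson_sum Ps = 0.
Proof.
move=> d1 dP; rewrite /carleson_sum big1// => a aE; rewrite /linearized_sum big1 ?normr0//.
move=> P /andP[PP uP]; apply/v_supp/negP => aP.
have aQ : a \in dens_set P.
  rewrite inE aE aP /=; move: uP; rewrite /in_up expnSr divnMA => /eqP ->.
  by rewrite -addn1 -muln2 divnMDl// addn0.
have : (0 < #|dens_set P|)%N by apply/card_gt0P; exists a.
rewrite -(ler1n R) => h1; have h2 := le_trans h1 (dP P P PP (below_refl P)).
have dpos : 0 < d.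
  rewrite ltNge; apply/negP => dneg; move: h2; rewrite leNgt => /negP; apply.
  by apply: le_lt_trans ltr01; rewrite mulr_le0_ge0.
have : d * (2 ^ (K - scale_of P))%:R <= d * (2 ^ K)%:R.
  by rewrite ler_wpM2l ?(ltW dpos)// ler_nat leq_exp2l// leq_subr.
by move=> /(le_trans h2); rewrite leNgt d1.
Qed.

Hypothesis E0 : (0 < #|E|)%N.

Let e : R := #|E|%:R.
Let S := B / e.
Let r := 2 `^ q^-1.
Let sS := S `^ q^-1.

Let e0 : 0 < e. Proof. by rewrite ltr0n. Qed.
Let S0 : 0 < S. Proof. exact: divr_gt0. Qed.
Let r0 : 0 < r. Proof. exact: powR_gt0. Qed.
Let sS0 : 0 < sS. Proof. exact: powR_gt0. Qed.

Lemma root_gt1 : 1 < r.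
Proof.
have := @gt0_ltr_powR R q^-1 _ 1 2 _ _ (ltr1n R 2).
by rewrite powR1 !nnegrE invr_gt0; apply.
Qed.

Lemma root_lt2 : r < 2.
Proof.
have rr : r * r <= 2.
  rewrite /r -powRD; last by rewrite pnatr_eq0 implybT.
  rewrite -[leRHS](@powRr1 _ 2)//; apply: ler_powR; first by rewrite ler1n.
  have : q^-1 <= 2^-1 by rewrite lef_pV2 ?posrE.
  lra.
by rewrite ltNge; apply/negP => r2; have := ler_pM (ltW (ltr0Sn R 1)) (ltW (ltr0Sn R 1)) r2 r2; lra.
Qed.

Lemma root_expn k : (2 ^+ k * S) `^ q^-1 = r ^+ k * sS.
Proof.
rewrite powRM ?exprn_ge0 ?(ltW S0)//; congr (_ * _).
by rewrite -powR_mulrn// powRAC powR_mulrn// ltW.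
Qed.

Lemma root_expV k : (S / 2 ^+ k) `^ q^-1 = r^-1 ^+ k * sS.
Proof.
have rk : r ^+ k != 0 by rewrite expf_neq0// gt_eqF.
apply: (mulIf rk); rewrite [RHS]mulrAC exprVn mulVf// mul1r.
have -> : r ^+ k = (2 ^+ k) `^ q^-1.
  by rewrite -powR_mulrn ?powR_ge0// powRAC powR_mulrn.
have p2 : 0 <= 2 ^+ k :> R by rewrite exprn_ge0.
rewrite -(powRM _ (divr_ge0 (ltW S0) p2) p2).
by rewrite divfK// expf_neq0// pnatr_eq0.
Qed.

(** From size 2^k S down to S by size_step with the trivial density 1; the
    cost of a level is a multiple of (r / 2)^k, and r < 2. *)
Lemma large_sizes k (Ps : {set dbitile K}) : Ps \subset U -> size_le Ps (2 ^+ k * S) ->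
  exists P' : {set dbitile K}, [/\ P' \subset Ps, size_le P' S &
    carleson_sum Ps <= carleson_sum P' + 40 * sS * e * \sum_(i < k) (r / 2) ^+ i].
Proof.
elim: k Ps => [|k IH] Ps PU; rewrite ?expr0 ?mul1r => sP.
  by exists Ps; split => //; rewrite big_ord0 mulr0 addr0.
have p0 : 0 < 2 ^+ k.+1 * S by rewrite mulr_gt0// exprn_gt0.
have [P1 [P1P sP1 L1]] := size_step PU sP (@dens_le1 Ps) p0 ler01.
have e2 : 2 ^+ k.+1 * S / 2 = 2 ^+ k * S by rewrite exprS; field.
rewrite e2 in sP1.
have [P' [P'P sP' L']] := IH P1 (fintype.subset_trans P1P PU) sP1.
exists P'; split => //; first exact: fintype.subset_trans P1P.
rewrite big_ord_recr /= mulrDr addrA; apply: (le_trans L1); apply: lerD => //.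
rewrite root_expn.
have -> : r ^+ k.+1 * sS / (2 ^+ k.+1 * S) = (r / 2) ^+ k.+1 * sS / S.
  by rewrite expr_div_n invfM; ring.
have -> : 40 * ((r / 2) ^+ k.+1 * sS / S) * 1 * B = 40 * sS * e * (r / 2) ^+ k.+1.
  by rewrite /S; field; rewrite !gt_eqF.
rewrite ler_wpM2l ?mulr_ge0 ?(ltW e0) ?(ltW sS0)//.
rewrite exprS ler_piMl ?exprn_ge0 ?divr_ge0 ?(ltW r0)//.
by rewrite ler_pdivrMr// mul1r (ltW root_lt2).
Qed.

(** Size and density are halved together; the cost of a level is a multiple
    of r^-n, and r > 1. *)
Lemma small_sizes n (Ps : {set dbitile K}) : Ps \subset U -> size_le Ps S ->
  exists P' : {set dbitile K}, [/\ P' \subset Ps, size_le P' (S / 2 ^+ n),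
    dens_le P' (2 ^- n) &
    carleson_sum Ps <= carleson_sum P' + 80 * sS * e * \sum_(i < n) r^-1 ^+ i].
Proof.
move=> PU sP; elim: n => [|n [P1 [P1P sP1 dP1 L1]]].
  exists Ps; rewrite expr0 divr1 invr1; split => //; first exact: dens_le1.
  by rewrite big_ord0 mulr0 addr0.
have p0 : 0 < S / 2 ^+ n by rewrite divr_gt0// exprn_gt0.
have d0 : 0 < 2 ^- n :> R by rewrite invr_gt0 exprn_gt0.
have P1U := fintype.subset_trans P1P PU.
have [P2 [P2P sP2 L2]] := size_step P1U sP1 dP1 p0 (ltW d0).
have [P3 [P3P dP3 L3]] := dens_step (fintype.subset_trans P2P P1U)
  (size_leS P2P sP1) (dens_leS P2P dP1) p0 d0.
exists P3; split.
- exact: fintype.subset_trans P3P (fintype.subset_trans P2P P1P).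
- by apply: (size_leS P3P); rewrite exprSr invfM mulrA.
- by rewrite exprSr invfM.
rewrite big_ord_recr /= mulrDr addrA.
apply: (le_trans L1); rewrite [leRHS]addrAC lerD2r.
apply: (le_trans L2); apply: (le_trans (lerD L3 (lexx _))).
rewrite -addrA lerD2l root_expV -/e.
have -> : 40 * (r^-1 ^+ n * sS / (S / 2 ^+ n)) * 2 ^- n * B = 40 * (r^-1 ^+ n * sS) * e.
  by rewrite /S; field; rewrite !gt_eqF// exprn_gt0.
lra.
Qed.

Lemma geom_sum_le (x : R) n : 0 <= x -> x < 1 -> \sum_(i < n) x ^+ i <= (1 - x)^-1.
Proof.
move=> x0 x1; have x1' : 0 < 1 - x by rewrite subr_gt0.
rewrite -div1r ler_pdivlMr// mulrC -opprB mulNr -subrX1 opprB.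
by rewrite gerBl exprn_ge0.
Qed.

Definition carleson_const := 40 / (1 - r / 2) + 80 / (1 - r^-1).

(** The size is at most B at the start, since every tree has energy at most
    B; after K + 1 simultaneous halvings the density is below 2^-K and
    nothing is left. *)
Lemma carleson_sum_le : carleson_sum U <= carleson_const * e * sS.
Proof.
have sU : size_le U (2 ^+ K * S).
  have := size_le_all (fintype.subxx U) => h T top TU uT.
  apply: (le_trans (h T top TU uT)); rewrite ler_wpM2r//.
  rewrite /S mulrA ler_pdivlMr// mulrC ler_wpM2r ?(ltW B0)//.
  by rewrite -natrX ler_nat -[leqRHS]card_ord max_card.
have [P1 [P1U sP1 L1]] := large_sizes (fintype.subxx U) sU.
have [P2 [P2P _ dP2 L2]] := small_sizes K.+1 P1U sP1.
rewrite (dens_small_carleson_sum _ dP2) ?add0r in L2; last first.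
  by rewrite mulrC natrX ltr_pdivrMr ?exprn_gt0// mul1r ltr_eXn2l// ltr1n.
apply: (le_trans L1); apply: (le_trans (lerD L2 (lexx _))).
have g1 := @geom_sum_le (r / 2) K (divr_ge0 (ltW r0) (ltW (ltr0Sn R 1))).
have g2 := @geom_sum_le r^-1 K.+1.
have {}g1 : \sum_(i < K) (r / 2) ^+ i <= (1 - r / 2)^-1.
  by apply: g1; rewrite ltr_pdivrMr// mul1r root_lt2.
have {}g2 : \sum_(i < K.+1) r^-1 ^+ i <= (1 - r^-1)^-1.
  by apply: g2; rewrite ?invr_ge0 ?(ltW r0)// invf_lt1// root_gt1.
rewrite /carleson_const.
have se : 0 <= sS * e by rewrite mulr_ge0// ltW.
have := ler_wpM2l se g1; have := ler_wpM2l se g2; lra.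
Qed.

Lemma discrete_weak_type lam : 0 <= lam ->
  (forall a, a \in E -> lam <= `|linearized_sum U a|) ->
  lam `^ q * e <= carleson_const `^ q * B.
Proof.
move=> lam0 h.
have C0 : 0 <= carleson_const.
  rewrite addr_ge0// divr_ge0// subr_ge0.
    by rewrite ler_pdivrMr// mul1r (ltW root_lt2).
  by rewrite invf_le1// (ltW root_gt1).
have : lam * e <= carleson_const * e * sS.
  apply: le_trans carleson_sum_le; rewrite mulrC /e mulr_natl -sumr_const.
  by apply: ler_sum => a; exact: h.
rewrite mulrAC ler_pM2r// => {}h.
have := @ge0_ler_powR R q (ltW q0) _ _ _ _ h.
rewrite !nnegrE lam0 mulr_ge0 ?(ltW sS0)// => /(_ isT isT).
rewrite powRM ?(ltW sS0)// /sS -powRrM mulVf ?gt_eqF// powRr1 ?(ltW S0)//.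
by rewrite /S mulrA ler_pdivlMr.
Qed.

End Discrete.

Local Open Scope classical_set_scope.
Local Open Scope ring_scope.

(** * Simple functions *)

Section FiniteFibres.
Context (d : measure_display) (T : measurableType d).

(** Simple functions with values in any type, with an explicit list of
    values. Pairs of simple functions are again of this kind, so that sums
    and products are images of a common refinement. *)
Definition finite_fibres (X : choiceType) (p : T -> X) (r : seq X) : Prop :=
  [/\ uniq r, forall t, p t \in r & forall x, measurable (p @^-1` [set x])].

Lemma finite_fibres_preimage (X : choiceType) (p : T -> X) r (B : set X) :
  finite_fibres p r -> measurable (p @^-1` B).
Proof.
move=> [ur pr mp].
have -> : p @^-1` B = \big[setU/set0]_(x <- r | `[< B x >]) (p @^-1` [set x]).
  apply/seteqP; split=> [t Bt|t].
    rewrite -big_filter -bigcup_seq; exists (p t) => //=.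
    by rewrite mem_filter pr andbT; apply/asboolP.
  rewrite -big_filter -bigcup_seq => -[x /=]; rewrite mem_filter => /andP[/asboolP Bx _].
  by move=> /= ->.
by apply: bigsetU_measurable => x _.
Qed.

Lemma finite_fibres_comp (X Z : choiceType) (p : T -> X) (h : X -> Z) r :
  finite_fibres p r -> finite_fibres (h \o p) (undup (map h r)).
Proof.
move=> fp; have [ur pr mp] := fp; split; first exact: undup_uniq.
  by move=> t; rewrite mem_undup; apply: map_f.
by move=> z; rewrite comp_preimage; apply: finite_fibres_preimage fp.
Qed.

Lemma finite_fibres_pair (X Z : choiceType) (p : T -> X) (p' : T -> Z) r r' :
  finite_fibres p r -> finite_fibres p' r' ->
  finite_fibres (fun t => (p t, p' t)) [seq (x, z) | x <- r, z <- r'].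
Proof.
move=> [ur pr mp] [ur' pr' mp']; split.
- by apply: allpairs_uniq => // -[? ?] [? ?] _ _ [-> ->].
- by move=> t; apply: allpairs_f.
move=> [x z].
have -> : (fun t => (p t, p' t)) @^-1` [set (x, z)] = p @^-1` [set x] `&` p' @^-1` [set z].
  by apply/seteqP; split=> t /= [-> ->].
exact: measurableI.
Qed.

Lemma simple_functionP (Y : choiceType) (s : T -> Y) :
  simple_function measurable s <-> exists r, finite_fibres s r.
Proof.
split=> [[fs ms]|[r [ur sr ms]]].
  exists (fset_set (range s)); split => // t.
  by rewrite in_fset_set// inE; exists t.
split=> //; apply: (sub_finite_set (B := [set` r])); last exact: finite_seq.
by move=> _ [t _ <-] /=.
Qed.

Lemma finite_fibres_measurable (R : realType) (X : choiceType) (p : T -> X) r (h : X -> R) D :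
  finite_fibres p r -> measurable_fun D (h \o p).
Proof.
move=> fp mD B mB; apply: measurableI => //.
by rewrite comp_preimage; apply: finite_fibres_preimage fp.
Qed.

End FiniteFibres.

Section Bochner.
Context (d : measure_display) (T : measurableType d) (R : realType).
Context (Y : completeNormedModType R).
Context (mu : {measure set T -> \bar R}) (D : set T).
Hypothesis mD : measurable D.

Local Notation m p x := (fine (mu (D `&` p @^-1` [set x]))).

Lemma simple_integralE (s : T -> Y) r : finite_fibres s r ->
  simple_integral mu D s = \sum_(y <- r) m s y *: y.
Proof.
move=> [ur sr ms]; rewrite fsbig_seq// /simple_integral.
apply: fsbig_widen; first by move=> _ [t _ <-] /=.
move=> y [/= _ ny]; suff -> : s @^-1` [set y] = set0.
  by rewrite setI0 measure0 /= scale0r.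
by rewrite -subset0 => t /= ty; apply: ny; exists t.
Qed.

Lemma measure_fibre_comp (X Z : choiceType) (p : T -> X) (h : X -> Z) r z :
  finite_fibres p r ->
  mu (D `&` (h \o p) @^-1` [set z]) =
  (\sum_(x <- r | h x == z) mu (D `&` p @^-1` [set x]))%E.
Proof.
move=> [ur pr mp].
have -> : D `&` (h \o p) @^-1` [set z] =
    \bigcup_(x in [set` [seq x <- r | h x == z]]) (D `&` p @^-1` [set x]).
  apply/seteqP; split=> [t [Dt /= hz]|t [x /=]].
    by exists (p t) => //=; rewrite mem_filter hz eqxx pr.
  by rewrite mem_filter => /andP[/eqP <- _] [Dt /= ->].
rewrite measure_fin_bigcup//.
- by rewrite -fsbig_seq ?filter_uniq// big_filter.
- by apply/trivIsetP => x y _ _ xy; apply/seteqP; split => // t [[_ /= ->] [_ /= e]]; rewrite e eqxx in xy.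
- by move=> x _; apply: measurableI.
Qed.

(** The integral can be computed from any finer partition; linearity and the
    norm inequality follow by applying it to pairs. *)
Lemma simple_integral_comp (X : choiceType) (p : T -> X) (h : X -> Y) r :
  finite_fibres p r ->
  (forall x, h x != 0 -> (mu (D `&` p @^-1` [set x]) < +oo)%E) ->
  simple_integral mu D (h \o p) = \sum_(x <- r) m p x *: h x.
Proof.
move=> fp fin; rewrite (simple_integralE (finite_fibres_comp h fp)).
transitivity (\sum_(z <- undup (map h r)) \sum_(x <- r | h x == z) m p x *: h x).
  apply: eq_bigr => z _; rewrite (measure_fibre_comp h z fp).
  have [->|z0] := eqVneq z 0.
    by rewrite scaler0 big1// => x /eqP ->; rewrite scaler0.
  rewrite -sum_fine; last first.
    move=> x /eqP hx; rewrite ge0_fin_numE// fin//; by rewrite hx.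
  by rewrite scaler_suml; apply: eq_bigr => x /eqP ->.
rewrite (exchange_big_dep xpredT)//=.
rewrite big_seq [RHS]big_seq; apply: eq_bigr => x xr.
rewrite -big_filter (_ : seq.filter _ _ = [:: h x]) ?big_seq1//.
have := undup_uniq (map h r); have : h x \in undup (map h r) by rewrite mem_undup map_f.
move: (undup _) => w; elim: w => // z w IH /=; rewrite inE.
have [->|ne /= hw /andP[_ uw]] := eqVneq (h x) z.
  move=> _ /andP[zw _]; congr (_ :: _); rewrite -(filter_pred0 w).
  by apply: eq_in_filter => y yw; apply/negbTE; apply: contra zw => /eqP ->.
exact: IH.
Qed.

Lemma integral_norm_comp (X : choiceType) (p : T -> X) (h : X -> Y) r :
  finite_fibres p r ->
  (\int[mu]_(x in D) `|h (p x)|%:E =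
   \sum_(x <- r) `|h x|%:E * mu (D `&` p @^-1` [set x]))%E.
Proof.
move=> fp; have [ur pr mp] := fp.
have -> : (fun t => `|h (p t)|%:E) =
    (fun t => \sum_(x <- r) (`|h x|%:E * (\1_(p @^-1` [set x]) t)%:E))%E.
  apply/funext => t; rewrite (bigD1_seq (p t))//= big1 ?adde0.
    by rewrite indicE mem_set// mule1.
  move=> x xp; rewrite indicE memNset ?mule0// => /= e.
  by rewrite e eqxx in xp.
rewrite ge0_integral_sum//; last first.
  move=> x; apply: measurable_funeM; apply/measurable_EFinP.
  by apply: measurable_indic; exact: mp.
apply: eq_bigr => x _; rewrite ge0_integralZl//.
- by rewrite integral_indic// setIC.
- by apply/measurable_EFinP; apply: measurable_indic; exact: mp.
Qed.

Lemma norm_simple_integral_comp (X : choiceType) (p : T -> X) (h : X -> Y) r :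
  finite_fibres p r ->
  (forall x, h x != 0 -> (mu (D `&` p @^-1` [set x]) < +oo)%E) ->
  (`|simple_integral mu D (h \o p)|%:E <= \int[mu]_(x in D) `|h (p x)|%:E)%E.
Proof.
move=> fp fin; rewrite (simple_integral_comp fp fin) (integral_norm_comp h fp).
apply: (@le_trans _ _ (\sum_(x <- r) `|m p x *: h x|)%:E).
  by rewrite lee_fin ler_norm_sum.
rewrite -sumEFin; apply: lee_sum => x _; rewrite normrZ ger0_norm ?fine_ge0//.
have [->|hx] := eqVneq (h x) 0; first by rewrite normr0 mulr0 mul0e.
have mf : mu (D `&` p @^-1` [set x]) \is a fin_num.
  by rewrite ge0_fin_numE ?measure_ge0//; exact: fin.
by rewrite EFinM (fineK mf) [leRHS]muleC.
Qed.

Lemma integrable_simpleP (s : T -> Y) : integrable_simple mu D s <->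
  exists2 r, finite_fibres s r & forall y, y != 0 -> (mu (D `&` s @^-1` [set y]) < +oo)%E.
Proof.
split=> [[/simple_functionP[r fr] h]|[r fr h]]; first by exists r.
by split => //; apply/simple_functionP; exists r.
Qed.

Lemma integrable_pair_fin (s t : T -> Y) r r' :
  finite_fibres s r -> finite_fibres t r' ->
  (forall y, y != 0 -> (mu (D `&` s @^-1` [set y]) < +oo)%E) ->
  (forall y, y != 0 -> (mu (D `&` t @^-1` [set y]) < +oo)%E) ->
  forall z : Y * Y, z != (0, 0) ->
  (mu (D `&` (fun x => (s x, t x)) @^-1` [set z]) < +oo)%E.
Proof.
move=> [_ _ ms] [_ _ mt] fs ft [a b] ab.
have mst : measurable (D `&` (fun x => (s x, t x)) @^-1` [set (a, b)]).
  have -> : (fun x => (s x, t x)) @^-1` [set (a, b)] = s @^-1` [set a] `&` t @^-1` [set b].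
    by apply/seteqP; split=> x /= [-> ->].
  by apply: measurableI => //; exact: measurableI.
have [a0|a0] := eqVneq a 0; last first.
  apply: le_lt_trans (fs a a0); apply: le_measure; rewrite ?inE//.
    exact: measurableI.
  by move=> x [Dx [/= -> _]].
have b0 : b != 0 by apply: contra ab => /eqP ->; rewrite a0.
apply: le_lt_trans (ft b b0); apply: le_measure; rewrite ?inE//.
  exact: measurableI.
by move=> x [Dx [_ /= ->]].
Qed.

Lemma simple_integral_lin (s t : T -> Y) (a b : R) :
  integrable_simple mu D s -> integrable_simple mu D t ->
  integrable_simple mu D (fun x => a *: s x + b *: t x) /\
  simple_integral mu D (fun x => a *: s x + b *: t x) =
  a *: simple_integral mu D s + b *: simple_integral mu D t.
Proof.
move=> /integrable_simpleP[r fr fs] /integrable_simpleP[r' fr' ft].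
have fp := finite_fibres_pair fr fr'; have fin := integrable_pair_fin fr fr' fs ft.
have finh (h : Y * Y -> Y) : h (0, 0) = 0 -> forall z, h z != 0 ->
   (mu (D `&` (fun x => (s x, t x)) @^-1` [set z]) < +oo)%E.
  by move=> h0 z hz; apply: fin; apply: contra hz => /eqP ->; rewrite h0.
pose h z : Y := a *: z.1 + b *: z.2.
have h0 : h (0, 0) = 0 by rewrite /h !scaler0 addr0.
split; last first.
  rewrite (simple_integral_comp (h := h) fp (finh h h0)).
  rewrite (simple_integral_comp (h := fst) fp (finh fst erefl)).
  rewrite (simple_integral_comp (h := snd) fp (finh snd erefl)).
  rewrite !scaler_sumr -big_split; apply: eq_bigr => z _.
  by rewrite /h scalerDr !scalerA ![_ * m _ _]mulrC.
apply/integrable_simpleP; exists (undup (map h [seq (x, z) | x <- r, z <- r'])).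
  exact (finite_fibres_comp h fp).
move=> y y0; rewrite (measure_fibre_comp h y fp).
by apply: lte_sum_pinfty => z /eqP hz; apply: (finh h h0); rewrite hz.
Qed.

Lemma norm_simple_integralB (s t : T -> Y) :
  integrable_simple mu D s -> integrable_simple mu D t ->
  (`|simple_integral mu D s - simple_integral mu D t|%:E <=
   \int[mu]_(x in D) `|s x - t x|%:E)%E.
Proof.
move=> is_ it; have := simple_integral_lin 1 (-1) is_ it; rewrite !scale1r scaleN1r => -[_ <-].
move: is_ it => /integrable_simpleP[r fr fs] /integrable_simpleP[r' fr' ft].
have fp := finite_fibres_pair fr fr'; have fin := integrable_pair_fin fr fr' fs ft.
have := @norm_simple_integral_comp _ _ (fun z => 1 *: z.1 + (-1) *: z.2) _ fp.
rewrite /comp/= => h; apply: le_trans (h _) _.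
  by move=> z hz; apply: fin; apply: contra hz => /eqP ->; rewrite !scaler0 addr0.
by under eq_integral do rewrite scale1r scaleN1r.
Qed.

End Bochner.

(** * Existence, uniqueness and linearity of the Bochner integral *)

Section BochnerTheory.
Context (d : measure_display) (T : measurableType d) (R : realType).
Context (Y : completeNormedModType R).
Context (mu : {measure set T -> \bar R}) (D : set T).
Hypothesis mD : measurable D.

Local Notation sm := (strongly_measurable (Y := Y) measurable D).

Lemma simple_strongly_measurable (s : T -> Y) : simple_function measurable s -> sm s.
Proof. by move=> ss; exists (fun=> s); split=> // x _; exact: cvg_cst. Qed.

Lemma strongly_measurable_lin (a b : R) (f g : T -> Y) :
  sm f -> sm g -> sm (fun x => a *: f x + b *: g x).
Proof.
move=> [s [ss sf]] [t [st tg]]; exists (fun n x => a *: s n x + b *: t n x); split.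
  move=> n; have [r fr] := (simple_functionP (s n)).1 (ss n).
  have [r' fr'] := (simple_functionP (t n)).1 (st n).
  apply/simple_functionP; eexists.
  exact (finite_fibres_comp (fun z => a *: z.1 + b *: z.2) (finite_fibres_pair fr fr')).
by move=> x Dx; apply: cvgD; apply: cvgZl_tmp; [exact: sf|exact: tg].
Qed.

Lemma strongly_measurable_scale (phi : T -> R) r (f : T -> Y) :
  finite_fibres phi r -> sm f -> sm (fun x => phi x *: f x).
Proof.
move=> fp [s [ss sf]]; exists (fun n x => phi x *: s n x); split.
  move=> n; have [r' fr'] := (simple_functionP (s n)).1 (ss n).
  apply/simple_functionP; eexists.
  exact (finite_fibres_comp (fun z : R * Y => z.1 *: z.2) (finite_fibres_pair fp fr')).
by move=> x Dx; apply: cvgZl_tmp; exact: sf.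
Qed.

Lemma strongly_measurable_norm (f : T -> Y) : sm f -> measurable_fun D (fun x => `|f x|).
Proof.
move=> [s [ss sf]]; apply: (measurable_fun_cvg (h := fun n x => `|s n x|)).
  move=> n; have [r fr] := (simple_functionP (s n)).1 (ss n).
  exact (@finite_fibres_measurable _ _ _ _ _ _ (fun y : Y => `|y|) D fr).
by move=> x Dx; apply: cvg_norm; exact: sf.
Qed.

Lemma strongly_measurableB (f g : T -> Y) : sm f -> sm g -> sm (fun x => f x - g x).
Proof.
move=> sf sg; have := strongly_measurable_lin 1 (-1) sf sg.
by congr (sm _); apply/funext => x; rewrite scale1r scaleN1r.
Qed.

Lemma strongly_measurable_enorm (f : T -> Y) : sm f ->
  measurable_fun D (fun x => `|f x|%:E).
Proof. by move=> sf; apply/measurable_EFinP; exact: strongly_measurable_norm. Qed.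

(** Discarding the values of norm above 2 |f x| keeps the pointwise
    convergence and makes the approximants dominated by f. *)
Lemma simple_approximation (f : T -> Y) : sm f ->
  exists t : nat -> T -> Y, [/\ forall n, simple_function measurable (t n),
    forall n x, D x -> `|t n x| <= 2 * `|f x| &
    forall x, D x -> t n x @[n --> \oo] --> f x].
Proof.
move=> smf; have [s [ss sf]] := smf.
have mA n : measurable (D `&` [set x | `|s n x| <= 2 * `|f x|]).
  apply: measurable_fun_le => //.
    exact: strongly_measurable_norm (simple_strongly_measurable (ss n)).
  by apply: measurable_funM => //; exact: strongly_measurable_norm.
pose A n := D `&` [set x | `|s n x| <= 2 * `|f x|].
have fA n : finite_fibres (fun x => x \in A n) [:: true; false].
  split => //; first by move=> x; case: (_ \in _).
  move=> b; have -> : (fun x => x \in A n) @^-1` [set b] = if b then A n else ~` A n.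
    case: b; apply/seteqP; split=> x /=.
    - by move=> h; exact: set_mem h.
    - by move=> h; exact: mem_set h.
    - by move=> h Ax; rewrite (mem_set Ax) in h.
    - by move=> h; exact: memNset h.
  by case: b; [exact: mA|apply: measurableC; exact: mA].
exists (fun n x => if x \in A n then s n x else 0); split.
- move=> n; have [r fr] := (simple_functionP (s n)).1 (ss n).
  apply/simple_functionP; eexists.
  exact (finite_fibres_comp (fun z : bool * Y => if z.1 then z.2 else 0) (finite_fibres_pair (fA n) fr)).
- move=> n x Dx; case: ifPn => [|_]; first by rewrite inE => -[].
  by rewrite normr0 mulr_ge0.
move=> x Dx; have [f0|f0] := eqVneq (f x) 0.
  apply: (@cvg_trans _ ((fun=> 0 : Y) @ \oo)); last by rewrite f0; exact: cvg_cst.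
  apply: near_eq_cvg; apply: nearW => n; case: ifPn => //.
  by rewrite inE => -[_ /=]; rewrite f0 normr0 mulr0 normr_le0 => /eqP.
apply: cvg_trans (sf x Dx); apply: near_eq_cvg.
have lt : `|f x| < 2 * `|f x| by rewrite ltr_pMl ?normr_gt0// ltr1n.
near=> n; rewrite mem_set//; split => //=.
by near: n; exact: cvgr_norm_le (sf x Dx) _ lt.
Unshelve. all: by end_near. Qed.

(** Norm-integrability, which by bochnerP is integrability in the sense of
    Bochner. *)
Definition L1 (f : T -> Y) := sm f /\ (\int[mu]_(x in D) `|f x|%:E < +oo)%E.

Lemma le_L1 (f g : T -> Y) (c : R) : sm f -> L1 g -> 0 <= c ->
  (forall x, D x -> `|f x| <= c * `|g x|) -> L1 f.
Proof.
move=> sf [sg gi] c0 fg; split => //.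
apply: (@le_lt_trans _ _ (\int[mu]_(x in D) (c%:E * `|g x|%:E))%E).
  apply: ge0_le_integral => //.
  - exact: strongly_measurable_enorm.
  - by apply: measurable_funeM; exact: strongly_measurable_enorm.
rewrite ge0_integralZl//; last exact: strongly_measurable_enorm.
by rewrite lte_mul_pinfty ?lee_fin.
Qed.

Lemma L1_integrable (f : T -> Y) (c : R) : L1 f ->
  mu.-integrable D (fun x => (c * `|f x|)%:E).
Proof.
move=> [sf fi]; have : mu.-integrable D (fun x => `|f x|%:E).
  apply/integrableP; split; first exact: strongly_measurable_enorm.
  by under eq_integral do rewrite gee0_abs ?lee_fin//.
by move=> /(integrableZl mD c); apply: eq_integrable => // x _; rewrite EFinM.
Qed.

Lemma integrable_simple_le (s f : T -> Y) (c : R) : simple_function measurable s ->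
  L1 f -> 0 <= c -> (forall x, D x -> `|s x| <= c * `|f x|) -> integrable_simple mu D s.
Proof.
move=> ss L1f c0 sf; split => // y y0.
have [sms si] := le_L1 (simple_strongly_measurable ss) L1f c0 sf.
have mS : measurable (s @^-1` [set y]) by case: ss.
have : (`|y|%:E * mu (D `&` s @^-1` [set y]) < +oo)%E.
  apply: le_lt_trans si; rewrite setIC -integral_indic// -ge0_integralZl//; last first.
    by apply/measurable_EFinP; exact: measurable_indic.
  apply: ge0_le_integral => //.
  - by apply: measurable_funeM; apply/measurable_EFinP; exact: measurable_indic.
  - exact: strongly_measurable_enorm.
  move=> x Dx; rewrite indicE; case: (boolP (x \in _)) => [|_]; last by rewrite mule0.
  by rewrite mule1 => /set_mem /= ->.
have [e|ne] := eqVneq (mu (D `&` s @^-1` [set y])) +oo%E; last by move=> _; rewrite ltey.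
by rewrite e gt0_muley ?lte_fin ?normr_gt0// ltxx.
Qed.

Lemma L1_approximation (f : T -> Y) : L1 f ->
  exists t : nat -> T -> Y, (forall n, integrable_simple mu D (t n)) /\
   (\int[mu]_(x in D) `|f x - t n x|%:E)%E @[n --> \oo] --> 0%E.
Proof.
move=> L1f; have [sf fi] := L1f; have [t [st tf tcvg]] := simple_approximation sf.
exists t; split; first by move=> n; exact: integrable_simple_le (st n) L1f _ (tf n).
rewrite -(integral0 mu D).
apply: (@dominated_cvg _ _ _ mu D mD (fun n x => `|f x - t n x|%:E) (fun=> 0%E)
  (fun x => (3 * `|f x|)%:E)) => //.
- move=> n; apply: strongly_measurable_enorm; apply: strongly_measurableB => //.
  exact: simple_strongly_measurable.
- move=> x Dx; apply: cvg_EFin; first exact: nearW.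
  rewrite -(@normr0 _ Y) -(subrr (f x)); apply: cvg_norm; apply: cvgB; first exact: cvg_cst.
  exact: tcvg.
- exact: L1_integrable.
- move=> n x Dx; rewrite lee_fin ger0_norm//; apply: le_trans (ler_normB _ _) _.
  have := tf n x Dx; lra.
Qed.

Lemma integral_normB_le (f g h : T -> Y) : sm f -> sm g -> sm h ->
  (\int[mu]_(x in D) `|g x - h x|%:E <=
   \int[mu]_(x in D) `|f x - g x|%:E + \int[mu]_(x in D) `|f x - h x|%:E)%E.
Proof.
move=> sf sg sh.
have m1 := strongly_measurable_enorm (strongly_measurableB sf sg).
have m2 := strongly_measurable_enorm (strongly_measurableB sf sh).
rewrite -ge0_integralD//; apply: ge0_le_integral => //.
- exact: strongly_measurable_enorm (strongly_measurableB sg sh).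
- exact: emeasurable_funD.
move=> x _; rewrite -EFinD lee_fin (distrC (f x)).
by have := ler_normD (g x - f x) (f x - h x); rewrite addrA subrK.
Qed.

Lemma ecvg0_le (u : nat -> \bar R) (e : R) : u n @[n --> \oo] --> 0%E -> 0 < e ->
  \forall n \near \oo, (u n <= e%:E)%E.
Proof.
move=> u0 e0; have : nbhs (0%E : \bar R) [set y | (y < e%:E)%E].
  by apply: open_ereal_lt'; rewrite lte_fin.
by move=> /u0 [N _ hN]; exists N => // n /hN /= /ltW.
Qed.

Lemma bochner_unique (f : T -> Y) v w :
  is_bochner_integral mu D f v -> is_bochner_integral mu D f w -> v = w.
Proof.
move=> [sf [s [is_ cs vs]]] [_ [t [it ct wt]]].
apply/eqP; rewrite -subr_eq0 -normr_le0; apply/ler_addgt0Pr => e e0; rewrite add0r.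
have e4 : 0 < e / 4 by rewrite divr_gt0.
near \oo => n.
have h1 : `|v - simple_integral mu D (s n)| <= e / 4.
  by near: n; exact: cvgr_dist_le vs _ e4.
have h2 : `|w - simple_integral mu D (t n)| <= e / 4.
  by near: n; exact: cvgr_dist_le wt _ e4.
have h3 : `|simple_integral mu D (s n) - simple_integral mu D (t n)| <= e / 4 + e / 4.
  rewrite -lee_fin; apply: le_trans (norm_simple_integralB mD (is_ n) (it n)) _.
  apply: le_trans (integral_normB_le sf _ _) _.
  - exact: simple_strongly_measurable (is_ n).1.
  - exact: simple_strongly_measurable (it n).1.
  rewrite EFinD; apply: leeD.
    by near: n; exact: ecvg0_le.
  by near: n; exact: ecvg0_le.
have := ler_distD (simple_integral mu D (s n)) v w.
have := ler_distD (simple_integral mu D (t n)) (simple_integral mu D (s n)) w.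
rewrite (distrC (simple_integral mu D (t n)) w); lra.
Unshelve. all: by end_near. Qed.

Lemma bochner_val (f : T -> Y) v : is_bochner_integral mu D f v -> bochner mu D f = v.
Proof.
by move=> fv; rewrite /bochner; apply: (bochner_unique _ fv); case: xgetP => // /(_ v).
Qed.

(** The integrals of dominated simple approximants form a Cauchy sequence. *)
Lemma bochnerP (f : T -> Y) : L1 f -> is_bochner_integral mu D f (bochner mu D f).
Proof.
move=> L1f; have [t [it ct]] := L1_approximation L1f; have [sf _] := L1f.
have : cauchy_ex (simple_integral mu D (t n) @[n --> \oo]).
  move=> e e0; have e4 : 0 < e / 4 by rewrite divr_gt0.
  have := ecvg0_le ct e4 => -[N _ hN].
  exists (simple_integral mu D (t N)); exists N => // n /= Nn.
  rewrite -ball_normE /=; apply: (@le_lt_trans _ _ (e / 4 + e / 4)); last by lra.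
  rewrite -lee_fin; apply: le_trans (norm_simple_integralB mD (it N) (it n)) _.
  apply: le_trans (integral_normB_le sf _ _) _.
  - exact: simple_strongly_measurable (it N).1.
  - exact: simple_strongly_measurable (it n).1.
  by rewrite EFinD; apply: leeD; apply: hN => /=.
move=> /cauchy_exP /cauchy_cvgP /cvg_ex [v tv].
have fv : is_bochner_integral mu D f v by split => //; exists t; split.
by rewrite (bochner_val fv).
Qed.

Lemma L1_lin (a b : R) (f g : T -> Y) : L1 f -> L1 g -> L1 (fun x => a *: f x + b *: g x).
Proof.
move=> [sf fi] [sg gi]; split; first exact: strongly_measurable_lin.
apply: (@le_lt_trans _ _ (`|a|%:E * \int[mu]_(x in D) `|f x|%:E +
    `|b|%:E * \int[mu]_(x in D) `|g x|%:E)%E).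
  have mf := strongly_measurable_enorm sf; have mg := strongly_measurable_enorm sg.
  rewrite -!ge0_integralZl// -ge0_integralD//; last 2 first.
  - exact: measurable_funeM.
  - exact: measurable_funeM.
  apply: ge0_le_integral => //.
  - exact: strongly_measurable_enorm (strongly_measurable_lin a b sf sg).
  - by apply: emeasurable_funD; exact: measurable_funeM.
  move=> x _; rewrite -!EFinM -EFinD lee_fin; apply: le_trans (ler_normD _ _) _.
  by rewrite !normrZ.
by rewrite lte_add_pinfty// lte_mul_pinfty ?lee_fin.
Qed.

Lemma bochner_lin (a b : R) (f g : T -> Y) : L1 f -> L1 g ->
  bochner mu D (fun x => a *: f x + b *: g x) = a *: bochner mu D f + b *: bochner mu D g.
Proof.
move=> L1f L1g; apply: bochner_val.
have [sf [s [is_ cs vs]]] := bochnerP L1f; have [sg [t [it ct wt]]] := bochnerP L1g.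
split; first exact: strongly_measurable_lin.
exists (fun n x => a *: s n x + b *: t n x); split.
- by move=> n; case: (simple_integral_lin mD a b (is_ n) (it n)).
- pose A n := (`|a|%:E * \int[mu]_(x in D) `|f x - s n x|%:E)%E.
  pose B n := (`|b|%:E * \int[mu]_(x in D) `|g x - t n x|%:E)%E.
  have hA : A n @[n --> \oo] --> 0%E by rewrite -(mule0 `|a|%:E); exact: cvgeZl.
  have hB : B n @[n --> \oo] --> 0%E by rewrite -(mule0 `|b|%:E); exact: cvgeZl.
  have hAB : (A n + B n)%E @[n --> \oo] --> 0%E.
    by rewrite -(adde0 0%E); apply: cvgeD.
  apply: (squeeze_cvge _ (cvg_cst 0%E) hAB).
  apply: nearW => n; rewrite integral_ge0//= /A /B.
  have ms := strongly_measurable_enorm (strongly_measurableB sf (simple_strongly_measurable (is_ n).1)).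
  have mt := strongly_measurable_enorm (strongly_measurableB sg (simple_strongly_measurable (it n).1)).
  rewrite -!ge0_integralZl// -ge0_integralD//; last 2 first.
  - exact: measurable_funeM.
  - exact: measurable_funeM.
  apply: ge0_le_integral => //.
  - apply: strongly_measurable_enorm; apply: strongly_measurableB.
      exact: strongly_measurable_lin.
    apply: simple_strongly_measurable.
    by case: (simple_integral_lin mD a b (is_ n) (it n)) => -[].
  - by apply: emeasurable_funD; exact: measurable_funeM.
  move=> x _; rewrite -!EFinM -EFinD lee_fin -!normrZ.
  apply: le_trans (ler_normD _ _); rewrite !scalerBr opprD addrACA.
  exact: lexx.
- have -> : (fun n => simple_integral mu D (fun x => a *: s n x + b *: t n x)) =
     (fun n => a *: simple_integral mu D (s n) + b *: simple_integral mu D (t n)).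
    by apply/funext => n; case: (simple_integral_lin mD a b (is_ n) (it n)).
  by apply: cvgD; apply: cvgZl_tmp.
Qed.

End BochnerTheory.

Section BochnerMore.
Context (d : measure_display) (T : measurableType d) (R : realType).
Context (Y : completeNormedModType R).
Context (mu : {measure set T -> \bar R}) (D : set T).
Hypothesis mD : measurable D.

Lemma L10 : L1 mu D (fun=> 0 : Y).
Proof.
split.
  apply: simple_strongly_measurable; apply/simple_functionP; exists [:: 0]; split => //.
    by move=> t; rewrite inE.
  move=> x; have [->|/eqP x0] := eqVneq x 0.
    by rewrite (_ : _ @^-1` _ = setT)//; apply/seteqP; split.
  by rewrite (_ : _ @^-1` _ = set0)//; apply/seteqP; split => // t /= /esym.
by under eq_integral do rewrite normr0; rewrite integral0.
Qed.

Lemma L1_sum (I : Type) (r : seq I) (c : I -> R) (F : I -> T -> Y) :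
  (forall i, L1 mu D (F i)) -> L1 mu D (fun x => \sum_(i <- r) c i *: F i x) /\
  bochner mu D (fun x => \sum_(i <- r) c i *: F i x) =
  \sum_(i <- r) c i *: bochner mu D (F i).
Proof.
move=> hF; elim: r => [|i r [IH1 IH2]].
  have e : (fun x : T => \sum_(i <- [::]) c i *: F i x) = (fun=> 0 : Y).
    by apply/funext => x; rewrite big_nil.
  rewrite e big_nil; split; first exact: L10.
  by have /= := bochner_lin mD 0 0 L10 L10; rewrite !scale0r !addr0.
have e : (fun x : T => \sum_(j <- i :: r) c j *: F j x) =
    (fun x => c i *: F i x + 1 *: \sum_(j <- r) c j *: F j x).
  by apply/funext => x; rewrite big_cons scale1r.
rewrite e big_cons; split; first exact: L1_lin.
by rewrite bochner_lin// IH2 scale1r.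
Qed.

Lemma L1_scale (phi : T -> R) r (c : R) (f : T -> Y) : finite_fibres phi r ->
  (forall x, `|phi x| <= c) -> L1 mu D f -> L1 mu D (fun x => phi x *: f x).
Proof.
move=> fp pc hf.
have c0 : 0 <= c by exact: le_trans (normr_ge0 _) (pc point).
apply: (le_L1 mD (strongly_measurable_scale fp hf.1) hf c0) => x _.
by rewrite normrZ ler_wpM2r.
Qed.

Lemma finite_fibres_indic (A : set T) : measurable A ->
  finite_fibres (\1_A : T -> R) [:: 1; 0].
Proof.
move=> mA; split.
- by rewrite /= inE oner_neq0.
- by move=> t; rewrite indicE !inE; case: (_ \in _); rewrite eqxx ?orbT.
move=> x; have [->|x1] := eqVneq x 1.
  rewrite (_ : _ @^-1` _ = A)//; apply/seteqP; split=> t /=; rewrite indicE.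
    by case: (boolP (t \in A)) => [/set_mem//|_] /eqP; rewrite eq_sym oner_eq0.
  by move=> At; rewrite mem_set.
have [->|x0] := eqVneq x 0.
  rewrite (_ : _ @^-1` _ = ~` A); first exact: measurableC.
  apply/seteqP; split=> t /=; rewrite indicE.
    by case: (boolP (t \in A)) => [_ /eqP|/negP h _ At]; [rewrite oner_eq0|apply: h; rewrite inE].
  by move=> At; rewrite memNset.
rewrite (_ : _ @^-1` _ = set0)//; apply/seteqP; split=> t //=; rewrite indicE.
by case: (_ \in _) => /= e; rewrite -e eqxx in x0 x1.
Qed.

Lemma bochner_indic (A : set T) (y : Y) : measurable A -> (mu (D `&` A) < +oo)%E ->
  L1 mu D (fun x => \1_A x *: y) /\
  bochner mu D (fun x => \1_A x *: y) = fine (mu (D `&` A)) *: y.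
Proof.
move=> mA fA; pose h (b : R) := b *: y; have fi := finite_fibres_indic mA.
have A1 : (\1_A : T -> R) @^-1` [set 1] = A.
  apply/seteqP; split=> t /=; rewrite indicE.
    by case: (boolP (t \in A)) => [/set_mem//|_] /eqP; rewrite eq_sym oner_eq0.
  by move=> At; rewrite mem_set.
have hfin x : h x != 0 -> (mu (D `&` (\1_A : T -> R) @^-1` [set x]) < +oo)%E.
  have [->|x1] := eqVneq x 1; first by rewrite A1.
  have [->|x0] := eqVneq x 0; first by rewrite /h scale0r eqxx.
  move=> _; rewrite (_ : _ @^-1` _ = set0) ?setI0 ?measure0//.
  apply/seteqP; split=> t //=; rewrite indicE.
  by case: (_ \in _) => /= e; rewrite -e eqxx in x0 x1.
have ss : simple_function measurable (fun x => \1_A x *: y).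
  by apply/simple_functionP; eexists; exact (finite_fibres_comp h fi).
have is_ : integrable_simple mu D (fun x => \1_A x *: y).
  split => // z z0; rewrite (measure_fibre_comp _ mD h z fi).
  by apply: lte_sum_pinfty => x /eqP hx; apply: hfin; rewrite hx.
have si : simple_integral mu D (fun x => \1_A x *: y) = fine (mu (D `&` A)) *: y.
  rewrite (simple_integral_comp (mu := mu) mD (h := h) fi hfin) !big_cons big_nil /h.
  by rewrite A1 scale0r scaler0 !addr0 scale1r.
split.
  split; first exact: simple_strongly_measurable.
  rewrite (integral_norm_comp _ mD h fi) !big_cons big_nil /h A1.
  rewrite scale0r normr0 mul0e !adde0 scale1r.
  by rewrite lte_mul_pinfty ?lee_fin.
apply: bochner_val => //; split; first exact: simple_strongly_measurable.
exists (fun=> (fun x => \1_A x *: y)); split => //.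
  by under eq_fun do (under eq_integral do rewrite subrr normr0); rewrite integral0; exact: cvg_cst.
by rewrite si; exact: cvg_cst.
Qed.

(** Integration over a part of the domain is integration of the extension by
    zero. *)
Lemma bochner_restrict (D' : set T) (f : T -> Y) : measurable D' -> D `<=` D' ->
  L1 mu D f -> L1 mu D' (fun x => \1_D x *: f x) /\
  bochner mu D' (fun x => \1_D x *: f x) = bochner mu D f.
Proof.
move=> mD' DD' L1f; have [sf [s [is_ cs vs]]] := bochnerP mD L1f.
pose r1 (s : T -> Y) := fun x => \1_D x *: s x.
have r1D g x : D x -> r1 g x = g x by move=> Dx; rewrite /r1 indicE mem_set// scale1r.
have r1C g x : ~ D x -> r1 g x = 0 by move=> Dx; rewrite /r1 indicE memNset// scale0r.
have sm1 g : strongly_measurable measurable D g -> strongly_measurable measurable D' (r1 g).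
  move=> [t [st tg]]; exists (fun n => r1 (t n)); split.
    move=> n; have [r fr] := (simple_functionP (t n)).1 (st n).
    apply/simple_functionP; eexists.
    exact (finite_fibres_comp (fun z : R * Y => z.1 *: z.2)
      (finite_fibres_pair (finite_fibres_indic mD) fr)).
  move=> x _; have [Dx|Dx] := pselect (D x).
    by under eq_fun do rewrite (r1D _ _ Dx); rewrite (r1D _ _ Dx); exact: tg.
  by under eq_fun do rewrite (r1C _ _ Dx); rewrite (r1C _ _ Dx); exact: cvg_cst.
have int1 g : (\int[mu]_(x in D') `|r1 g x|%:E = \int[mu]_(x in D) `|g x|%:E)%E.
  rewrite integral_mkcond [RHS]integral_mkcond; apply: eq_integral => x _.
  rewrite !patchE; have [Dx|Dx] := pselect (D x).
    by rewrite !mem_set ?r1D//; exact: DD'.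
  by rewrite [in RHS]memNset// r1C// normr0; case: ifP.
have L1' : L1 mu D' (r1 f) by split; [exact: sm1|rewrite int1; exact: L1f.2].
split => //; apply: bochner_val => //; split; first exact: sm1.
have fib n (y : Y) : y != 0 -> D' `&` r1 (s n) @^-1` [set y] = D `&` (s n) @^-1` [set y].
  move=> y0; apply/seteqP; split=> x /=.
    move=> [_]; have [Dx|Dx] := pselect (D x); first by rewrite r1D.
    by rewrite r1C// => e; rewrite -e eqxx in y0.
  by move=> [Dx e]; split; [exact: DD'|rewrite r1D].
have rr n : exists r, finite_fibres (s n) r /\ finite_fibres (r1 (s n)) r.
  have [r fr] := (simple_functionP (s n)).1 (is_ n).1.
  have [r' fr'] : exists r', finite_fibres (r1 (s n)) r'.
    eexists; exact (finite_fibres_comp (fun z : R * Y => z.1 *: z.2)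
      (finite_fibres_pair (finite_fibres_indic mD) fr)).
  exists (undup (r ++ r')); split; [case: fr|case: fr'] => _ h1 h2; split => //;
    rewrite ?undup_uniq// => t; by rewrite mem_undup mem_cat h1 ?orbT.
exists (fun n => r1 (s n)); split.
- move=> n; have [r [fr fr']] := rr n; split; first by apply/simple_functionP; exists r.
  by move=> y y0; rewrite fib//; case: (is_ n) => _; exact.
- under eq_fun => n.
    under eq_integral => x _ do rewrite -scalerBr.
    rewrite (int1 (fun x => f x - s n x)); over.
  exact: cs.
- have -> : (fun n => simple_integral mu D' (r1 (s n))) =
      (fun n => simple_integral mu D (s n)).
    apply/funext => n; have [r [fr fr']] := rr n.
    rewrite (simple_integralE _ _ fr') (simple_integralE _ _ fr).
    apply: eq_bigr => y _; have [->|y0] := eqVneq y 0; first by rewrite !scaler0.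
    by rewrite fib.
  exact: vs.
Qed.

End BochnerMore.

Lemma L1_eq_on (d : measure_display) (T : measurableType d) (R : realType)
    (Y : completeNormedModType R) (mu : {measure set T -> \bar R}) (D : set T)
    (f g : T -> Y) : measurable D -> (forall x, D x -> f x = g x) -> L1 mu D f ->
  L1 mu D g /\ bochner mu D g = bochner mu D f.
Proof.
move=> mD fg L1f.
have L1g : L1 mu D g.
  have [[s [ss sf]] fi] := L1f; split; first by exists s; split=> // x Dx; rewrite -fg//; exact: sf.
  rewrite (eq_integral (fun x => `|f x|%:E))// => x; rewrite inE => Dx.
  by rewrite fg.
split => //.
have [_ <-] := bochner_restrict mD mD (@subset_refl _ D) L1f.
have [_ <-] := bochner_restrict mD mD (@subset_refl _ D) L1g.
congr (bochner _ _ _); apply/funext => x; rewrite indicE.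
by case: (boolP (x \in D)) => [/set_mem/fg ->//|_]; rewrite !scale0r.
Qed.


(** * Moments of order q *)

Section LYnorm.
Context (d : measure_display) (T : measurableType d) (R : realType).
Context (Y : completeNormedModType R).
Context (mu : {measure set T -> \bar R}) (D : set T).
Hypothesis mD : measurable D.

Lemma LYnorm_powR (q : R) (f : T -> Y) : 0 < q ->
  (LYnorm mu D q f `^ q = \int[mu]_(x in D) (`|f x| `^ q)%:E)%E.
Proof.
move=> q0; rewrite /LYnorm poweR_Lnorm ?gt_eqF// [RHS]integral_mkcond.
apply: eq_integral => x _; rewrite !patchE; case: ifP => _.
  by rewrite gee0_abs ?lee_fin// poweR_EFin.
by rewrite abse0 poweR0r// gt_eqF.
Qed.

Lemma LYnorm_ge0 (q : R) (f : T -> Y) : (0 <= LYnorm mu D q f)%E.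
Proof. exact: Lnorm_ge0. Qed.

Lemma measurable_norm_powR (q : R) (f : T -> Y) : 0 <= q ->
  strongly_measurable measurable D f -> measurable_fun D (fun x => (`|f x| `^ q)%:E).
Proof.
move=> q0 sf; apply/measurable_EFinP.
apply: (measurableT_comp (f := fun x => x `^ q)); first exact: measurable_powR.
exact: strongly_measurable_norm.
Qed.

Lemma in_LY_int (q : R) (f : T -> Y) : 0 < q -> in_LY mu D q f <->
  strongly_measurable measurable D f /\ (\int[mu]_(x in D) (`|f x| `^ q)%:E < +oo)%E.
Proof.
move=> q0; rewrite /in_LY -LYnorm_powR//; split=> -[sf h]; split => //.
  exact: poweR_lty.
by apply: lty_poweRy h; rewrite gt_eqF.
Qed.

Lemma in_LY_L1 (q : R) (f : T -> Y) : 1 <= q -> (mu D < +oo)%E ->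
  in_LY mu D q f -> L1 mu D f.
Proof.
move=> q1 Doo; have q0 : 0 < q by apply: lt_le_trans q1.
move=> /(in_LY_int f q0)[sf fi]; split => //.
have mp := measurable_norm_powR (ltW q0) sf.
apply: (@le_lt_trans _ _ (\int[mu]_(x in D) (1 + (`|f x| `^ q)%:E))%E).
  apply: ge0_le_integral => //.
  - exact: strongly_measurable_enorm.
  - by apply: emeasurable_funD.
  move=> x _; rewrite -EFinD lee_fin; have [f1|f1] := leP `|f x| 1.
    by rewrite -[leLHS]addr0 lerD// powR_ge0.
  by rewrite -[leLHS]add0r lerD// le1r_powR// ltW.
rewrite ge0_integralD//.
by rewrite lte_add_pinfty// integral_cst// mul1e.
Qed.

End LYnorm.

(** * Walsh functions and dyadic intervals *)

Section WalshFunctions.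
Context (R : realType).
Implicit Types (x y : R) (i j k n r : nat).

(** The number m of the dyadic interval [2^-i m, 2^-i (m + 1)) that contains
    x. *)
Definition dyadic_index i x : nat := Num.truncn (2 ^+ i * x).

Lemma dyadic_indexE i x m : 0 <= x ->
  (dyadic_index i x == m) = (m%:R <= 2 ^+ i * x < m.+1%:R).
Proof. by move=> x0; rewrite /dyadic_index truncn_eq// mulr_ge0// exprn_ge0. Qed.

Lemma dyadic_index_div i k x : 0 <= x ->
  dyadic_index i x = (dyadic_index (i + k) x %/ 2 ^ k)%N.
Proof.
move=> x0; apply/eqP; rewrite dyadic_indexE//.
have := dyadic_indexE (i + k) (dyadic_index (i + k) x) x0; rewrite eqxx => /esym/andP[h1 h2].
set D := dyadic_index (i + k) x in h1 h2 *.
have p0 : 0 < 2 ^+ k :> R by rewrite exprn_gt0.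
have e2 : 2 ^+ (i + k) * x = 2 ^+ i * x * 2 ^+ k by rewrite exprD; ring.
rewrite e2 in h1 h2; apply/andP; split.
  rewrite -(ler_pM2r p0); apply: le_trans h1.
  by rewrite -natrX -natrM ler_nat leq_divM.
rewrite -(ltr_pM2r p0); apply: lt_le_trans h2 _.
by rewrite -natrX -natrM ler_nat ltn_ceil// expn_gt0.
Qed.

Lemma dyadic_index_scale i k x : dyadic_index i (2 ^+ k * x) = dyadic_index (k + i) x.
Proof. by rewrite /dyadic_index exprD mulrA [2 ^+ i * _]mulrC. Qed.

Lemma dyadic_index_lt i x : 0 <= x -> x < 1 -> (dyadic_index i x < 2 ^ i)%N.
Proof.
move=> x0 x1; rewrite /dyadic_index truncn_lt_nat ?mulr_ge0 ?exprn_ge0//.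
by rewrite natrX -[ltRHS]mulr1 ltr_pM2l// exprn_gt0.
Qed.

(** At each point exactly one of the half intervals in the defining sum
    contributes, the one whose number is the dyadic index of the next
    generation. *)
Lemma rademacherE i x : 0 <= x -> rademacher i x = (-1) ^+ dyadic_index i.+1 x.
Proof.
move=> x0; set m := dyadic_index i.+1 x; pose u := 2 ^+ i * x.
have p0 : 0 < 2 ^- i :> R by rewrite invr_gt0 exprn_gt0.
have xu : x = 2 ^- i * u by rewrite /u mulKf// expf_neq0// pnatr_eq0.
have u2 : 2 ^+ i.+1 * x = 2 * u by rewrite exprS mulrA.
have d0 k : k.*2%:R = 2 * k%:R :> R by rewrite -mul2n natrM.
have d1 k : k.*2.+1%:R = 2 * k%:R + 1 :> R by rewrite -addn1 natrD d0.
have d2 k : k.*2.+2%:R = 2 * k%:R + 2 :> R by rewrite -addn2 natrD d0.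
have half1 k : (x \in `[2 ^- i * k%:R, 2 ^- i * (k%:R + 2^-1)[) = (m == k.*2).
  rewrite dyadic_indexE// u2 in_itv /= {1 2}xu ler_pM2l// ltr_pM2l//.
  rewrite d0 d1.
  by apply/andP/andP => -[h1 h2]; split; lra.
have half2 k : (x \in `[2 ^- i * (k%:R + 2^-1), 2 ^- i * (k%:R + 1)[) = (m == k.*2.+1).
  rewrite dyadic_indexE// u2 in_itv /= {1 2}xu ler_pM2l// ltr_pM2l//.
  rewrite d1 d2.
  by apply/andP/andP => -[h1 h2]; split; lra.
rewrite /rademacher.
under eq_fsbigr => k _ do rewrite !indicE !mem_setE half1 half2.
rewrite -(@fsbig_widen _ _ _ _ [set m./2])//; last first.
  move=> k [_ /= km]; have -> : (m == k.*2) = false.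
    by apply/eqP => e; apply: km; rewrite e doubleK.
  have -> : (m == k.*2.+1) = false; last by rewrite subrr.
  by apply/eqP => e; apply: km; rewrite e /= uphalf_double.
rewrite fsbig_set1 -signr_odd; have := odd_double_half m.
case: (odd m) => /= e.
  have -> : (m == m./2.*2) = false by apply/eqP; move: e; clear; lia.
  have -> : (m == m./2.*2.+1) = true by apply/eqP; move: e; clear; lia.
  by rewrite /= sub0r.
have -> : (m == m./2.*2) = true by apply/eqP; move: e; clear; lia.
have -> : (m == m./2.*2.+1) = false by apply/eqP; move: e; clear; lia.
by rewrite /= subr0.
Qed.

Lemma rademacher_sqr i x : 0 <= x -> rademacher i x ^+ 2 = 1.
Proof. by move=> x0; rewrite rademacherE// sqrr_sign. Qed.

Lemma rademacher_scale i k x : 0 <= x ->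
  rademacher (k + i) x = rademacher i (2 ^+ k * x).
Proof.
move=> x0; rewrite !rademacherE// ?mulr_ge0 ?exprn_ge0//.
by rewrite dyadic_index_scale addnS.
Qed.

Lemma walsh_digits n L x : (n < 2 ^ L)%N ->
  walsh n x = \prod_(i < L) rademacher i x ^+ binary_digit n i.
Proof.
have aux L1 L2 : (n < 2 ^ L1)%N -> (L1 <= L2)%N ->
    \prod_(i < L2) rademacher i x ^+ binary_digit n i =
    \prod_(i < L1) rademacher i x ^+ binary_digit n i.
  move=> nL; move/subnKC <-; rewrite big_split_ord /= [X in _ * X]big1 ?mulr1//.
  move=> i _; rewrite /binary_digit divn_small ?expr0//.
  by apply: leq_trans nL _; rewrite leq_exp2l// leq_addr.
move=> nL; have nn : (n < 2 ^ n)%N by exact: ltn_expl.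
by rewrite /walsh; have [le|/ltnW le] := leqP n L; [rewrite -(aux n L)|rewrite (aux L n)].
Qed.

(** The binary digits of 2^k n + r are those of r followed by those of n. *)
Lemma walsh_split n k r x : (r < 2 ^ k)%N -> 0 <= x ->
  walsh (2 ^ k * n + r) x = walsh n (2 ^+ k * x) * walsh r x.
Proof.
move=> rk x0; pose L := n.
have nL : (n < 2 ^ L)%N by exact: ltn_expl.
rewrite (walsh_digits _ rk) (walsh_digits _ nL) (@walsh_digits _ (k + L)); last first.
  rewrite expnD; apply: (@leq_trans (2 ^ k * n.+1)%N); last by rewrite leq_mul2l nL orbT.
  by rewrite mulnS addnC ltn_add2r.
rewrite big_split_ord /= mulrC; congr (_ * _); apply: eq_bigr => i _.
  rewrite -rademacher_scale//; congr (_ ^+ _); rewrite /binary_digit expnD.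
  by rewrite divnMA mulnC divnMDl ?expn_gt0// (divn_small rk) addn0.
congr (_ ^+ _); rewrite /binary_digit.
have -> : (2 ^ k = 2 ^ i * (2 ^ (k - i).-1).*2)%N.
  rewrite -mul2n -expnS prednK ?subn_gt0//.
  by rewrite -expnD subnKC// ltnW.
rewrite -mulnA mulnC divnMDl ?expn_gt0// oddD -doubleMl odd_double//.
Qed.

Lemma walsh0 x : walsh 0 x = 1.
Proof. by rewrite /walsh big_ord0. Qed.

Lemma walsh1 x : 0 <= x -> walsh 1 x = (-1) ^+ dyadic_index 1 x.
Proof. by move=> x0; rewrite /walsh big_ord1 rademacherE. Qed.

Lemma walsh_sqr n x : 0 <= x -> walsh n x * walsh n x = 1.
Proof.
move=> x0; rewrite /walsh -big_split /= big1// => i _.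
by rewrite -expr2 exprAC rademacher_sqr// expr1n.
Qed.

Lemma walsh_const r k x y : (r < 2 ^ k)%N -> 0 <= x -> 0 <= y ->
  dyadic_index k x = dyadic_index k y -> walsh r x = walsh r y.
Proof.
move=> rk x0 y0 xy; rewrite !(walsh_digits _ rk); apply: eq_bigr => i _.
rewrite !rademacherE//.
by rewrite !(@dyadic_index_div i.+1 (k - i.+1))// subnKC// xy.
Qed.

(** The Dirichlet kernel of order 2^k is the normalized indicator of a
    dyadic interval: from k to k + 1 it is multiplied by 1 + r_k(x) r_k(y). *)
Lemma walsh_kernel k x y : 0 <= x < 1 -> 0 <= y < 1 ->
  \sum_(j < 2 ^ k) walsh j x * walsh j y =
  if dyadic_index k x == dyadic_index k y then 2 ^+ k else 0.
Proof.
move=> /andP[x0 x1] /andP[y0 y1]; elim: k => [|k IH].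
  have dx := dyadic_index_lt 0 x0 x1; have dy := dyadic_index_lt 0 y0 y1.
  rewrite expn0 big_ord1 /= !walsh0 mulr1.
  by move: dx dy; rewrite expn0 !ltnS !leqn0 => /eqP -> /eqP ->.
have e2 : (2 ^ k.+1 = 2 ^ k + 2 ^ k)%N by rewrite expnS mul2n addnn.
rewrite e2 big_split_ord /=.
have -> : \sum_(i < 2 ^ k) walsh (2 ^ k + i) x * walsh (2 ^ k + i) y =
    (-1) ^+ (dyadic_index k.+1 x + dyadic_index k.+1 y) *
    \sum_(i < 2 ^ k) walsh i x * walsh i y.
  rewrite mulr_sumr; apply: eq_bigr => i _.
  have top z : 0 <= z -> walsh (2 ^ k + i) z = (-1) ^+ dyadic_index k.+1 z * walsh i z.
    move=> z0; rewrite -[X in walsh (X + _)]muln1 walsh_split//.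
    by rewrite walsh1 ?mulr_ge0 ?exprn_ge0// dyadic_index_scale addn1.
  by rewrite !top// exprD mulrACA.
rewrite IH -[X in X + _ = _]mul1r -mulrDl.
have dx := @dyadic_index_div k 1 x x0; have dy := @dyadic_index_div k 1 y y0.
rewrite addn1 expn1 in dx dy; rewrite dx dy.
set a := dyadic_index k.+1 x; set b := dyadic_index k.+1 y.
have [->|ab] := eqVneq a b.
  by rewrite !eqxx addnn -signr_odd odd_double expr0 exprS.
case: ifPn => [/eqP h|_]; last by rewrite mulr0.
rewrite -signr_odd; have -> : odd (a + b) by move: ab h; clear; lia.
by rewrite expr1 subrr mul0r.
Qed.

End WalshFunctions.

(** * Atoms and functions constant on them *)

Section DyadicAtoms.
Context (R : realType) (K : nat).
Implicit Types (x : R) (a : nat).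

Definition node a : R := a%:R / 2 ^+ K.

Definition atom a : set R := `[node a, node a.+1[%classic.

Let p0 : 0 < 2 ^+ K :> R. Proof. by rewrite exprn_gt0. Qed.

Lemma node_ge0 a : 0 <= node a.
Proof. by rewrite /node divr_ge0// exprn_ge0. Qed.

Lemma node_lt1 a : (a < 2 ^ K)%N -> node a < 1.
Proof. by move=> aK; rewrite /node ltr_pdivrMr// mul1r -natrX ltr_nat. Qed.

Lemma node_itv (a : 'I_(2 ^ K)) : 0 <= node a < 1.
Proof. by rewrite node_ge0 node_lt1. Qed.

Lemma dyadic_index_node i a : (i <= K)%N ->
  dyadic_index i (node a) = (a %/ 2 ^ (K - i))%N.
Proof.
move=> iK; rewrite (@dyadic_index_div _ i (K - i)) ?node_ge0//.
by rewrite subnKC// /dyadic_index /node mulrC divfK ?gt_eqF// natrK.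
Qed.

Lemma in_atom x a : 0 <= x -> (x \in atom a) = (dyadic_index K x == a).
Proof.
move=> x0; rewrite dyadic_indexE// mem_setE in_itv /= /node.
by rewrite ler_pdivrMr// ltr_pdivlMr// ![x * _]mulrC.
Qed.

Lemma atom_ge0 x a : atom a x -> 0 <= x.
Proof. by rewrite /atom /= in_itv /= => /andP[h _]; apply: le_trans h; exact: node_ge0. Qed.

Lemma atom_lt1 x (a : 'I_(2 ^ K)) : atom a x -> x < 1.
Proof.
rewrite /atom /= in_itv /= => /andP[_ h]; apply: lt_le_trans h _.
by rewrite /node ler_pdivrMr// mul1r -natrX ler_nat.
Qed.

Lemma measurable_atom a : measurable (atom a : set (measurableTypeR R)).
Proof. exact: measurable_itv. Qed.

Lemma measure_atom a : lebesgue_measure (atom a) = ((2 ^- K)%:E : \bar R).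
Proof.
rewrite /atom lebesgue_measure_itv /= lte_fin /node -EFinB.
have -> : a%:R / 2 ^+ K < a.+1%:R / 2 ^+ K :> R.
  by rewrite ltr_pM2r ?invr_gt0// ltr_nat.
by rewrite -mulrBl -natrB// subSnn mul1r.
Qed.

Lemma sum_atom (V : nmodType) (F : nat -> V) x : 0 <= x < 1 ->
  \sum_(a < 2 ^ K) (if x \in atom a then F a else 0) = F (dyadic_index K x).
Proof.
move=> /andP[x0 x1]; rewrite (bigD1 (Ordinal (dyadic_index_lt K x0 x1))) //=.
rewrite in_atom// eqxx big1 ?addr0// => a ha; rewrite in_atom//.
by case: ifPn => // /eqP e; rewrite -(inj_eq val_inj) /= e eqxx in ha.
Qed.

End DyadicAtoms.

Section StepFunctions.
Context (R : realType) (Y : completeNormedModType R) (f : R -> Y).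
Local Notation mu := (@lebesgue_measure R).
Local Notation D := (`]0, 1[%classic : set R).
Local Notation D' := (`[0, +oo[%classic : set R).
Hypothesis f1 : L1 mu D f.

Let mD : measurable (D : set (measurableTypeR R)). Proof. exact: measurable_itv. Qed.
Let mD' : measurable (D' : set (measurableTypeR R)). Proof. exact: measurable_itv. Qed.
Let DD' : D `<=` D'.
Proof. by move=> x; rewrite /= !in_itv /= => /andP[/ltW ->]. Qed.

Definition atom_integral K a : Y := bochner mu D (fun x => \1_(atom K a) x *: f x).

Definition step_on K (phi : R -> R) :=
  forall x, 0 <= x -> x < 1 -> phi x = phi (node R K (dyadic_index K x)).

(** On the unit interval such a function is a linear combination of
    indicators of atoms. *)
Lemma bochner_step K phi : step_on K phi ->
  L1 mu D (fun x => phi x *: f x) /\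
  bochner mu D (fun x => phi x *: f x) = \sum_(a < 2 ^ K) phi (node R K a) *: atom_integral K a.
Proof.
move=> hphi.
have La a : L1 mu D (fun x => \1_(atom K a) x *: f x).
  have b1 (x : R) : `|\1_(atom K a) x| <= 1 :> R.
    by rewrite indicE; case: (_ \in _); rewrite ?normr1 ?normr0.
  exact (L1_scale mD (finite_fibres_indic R (measurable_atom K a)) b1 f1).
have [L e] := L1_sum mD (index_enum 'I_(2 ^ K)) (fun a => phi (node R K a)) (fun a : 'I_(2 ^ K) => La a).
have eqD x : D x -> \sum_(a < 2 ^ K) phi (node R K a) *: (\1_(atom K a) x *: f x) = phi x *: f x.
  rewrite /= in_itv /= => /andP[/ltW x0 x1]; rewrite hphi//.
  rewrite -(@sum_atom R K _ (fun a => phi (node R K a) *: f x)) ?x0//.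
  apply: eq_bigr => a _; rewrite indicE; case: (_ \in _); rewrite ?scale1r//.
  by rewrite scale0r scaler0.
have [L2 e2] := L1_eq_on mD eqD L.
by split; rewrite // e2 e.
Qed.

Definition extend_by_zero x := \1_D x *: f x.

Lemma tile_coef_step K P : step_on K (wave_packet P) ->
  tile_coef extend_by_zero P = \sum_(a < 2 ^ K) wave_packet P (node R K a) *: atom_integral K a.
Proof.
move=> hP; have [L e] := bochner_step hP; rewrite -e.
have [_ <-] := bochner_restrict mD mD' DD' L.
rewrite /tile_coef /extend_by_zero; congr (bochner _ _ _); apply/funext => x.
by rewrite !scalerA mulrC.
Qed.

Lemma walsh_step K n : (n < 2 ^ K)%N -> step_on K (walsh n).
Proof.
move=> nK x x0 x1; apply: (walsh_const nK) => //; first exact: node_ge0.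
by rewrite dyadic_index_node// subnn divn1.
Qed.

Lemma walsh_coef_step K n : (n < 2 ^ K)%N ->
  walsh_coef f n = \sum_(a < 2 ^ K) walsh n (node R K a) *: atom_integral K a.
Proof. by move=> nK; have [_ <-] := bochner_step (walsh_step nK). Qed.

End StepFunctions.

(** * Wave packets and the finite model *)

Section DyadicTiles.
Context (R : realType).
Implicit Types (i m n : nat) (x : R).

Definition dtile i m n : tile := ((- i%:Z)%R, m, n).

Lemma dtile_length i m n : tile_length R (dtile i m n) = 2 ^- i.
Proof. by rewrite /tile_length /dtile /= -exprnN. Qed.

Lemma dtile_time i m n x :
  @tile_time R (dtile i m n) x <-> 0 <= x /\ dyadic_index i x = m.
Proof.
have p0 : 0 < 2 ^- i :> R by rewrite invr_gt0 exprn_gt0.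
have tE : @tile_time R (dtile i m n) x <-> m%:R <= 2 ^+ i * x < m.+1%:R.
  rewrite /tile_time !dtile_length /= in_itv /=.
  have {1 2}-> : x = 2 ^- i * (2 ^+ i * x) by rewrite mulKf// expf_neq0// pnatr_eq0.
  by rewrite ler_pM2l// ltr_pM2l.
rewrite tE; split=> [h|[x0 /eqP]]; last by rewrite dyadic_indexE.
have x0 : 0 <= x.
  have p : 0 < 2 ^+ i :> R by rewrite exprn_gt0.
  have /andP[h1 _] := h; rewrite -(ler_pM2l p) mulr0.
  exact: le_trans (ler0n _ _) h1.
by split => //; apply/eqP; rewrite dyadic_indexE.
Qed.

Lemma dtile_freq i m n x :
  @tile_freq R (dtile i m n) x <-> 0 <= x /\ dyadic_index 0 (2 ^- i * x) = n.
Proof.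
have p0 : 0 < 2 ^+ i :> R by rewrite exprn_gt0.
have tE : @tile_freq R (dtile i m n) x <-> n%:R <= 2 ^- i * x < n.+1%:R.
  rewrite /tile_freq !dtile_length /= in_itv /= invrK.
  have {1 2}-> : x = 2 ^+ i * (2 ^- i * x) by rewrite mulVKf// expf_neq0// pnatr_eq0.
  by rewrite ler_pM2l// ltr_pM2l.
have p : 0 < 2 ^- i :> R by rewrite invr_gt0.
rewrite tE; split=> [h|[x0 /eqP]]; last first.
  by rewrite dyadic_indexE ?mul1r ?mulr_ge0// ltW.
have x0 : 0 <= x.
  have /andP[h1 _] := h; rewrite -(ler_pM2l p) mulr0.
  exact: le_trans (ler0n _ _) h1.
by split => //; apply/eqP; rewrite dyadic_indexE ?mul1r ?mulr_ge0// ltW.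
Qed.

(** Frequency intervals are dyadic at scale 2^i, so an index at a coarser
    scale is a quotient of the index at a finer one. *)
Lemma freq_index_div i d x : 0 <= x ->
  dyadic_index 0 (2 ^- (i + d) * x) = (dyadic_index 0 (2 ^- i * x) %/ 2 ^ d)%N.
Proof.
move=> x0; have y0 : 0 <= 2 ^- (i + d) * x by rewrite mulr_ge0// invr_ge0 exprn_ge0.
have -> : 2 ^- i * x = 2 ^+ d * (2 ^- (i + d) * x).
  by rewrite mulrA exprD invfM mulrCA mulfV ?mulr1// expf_neq0// pnatr_eq0.
by rewrite dyadic_index_scale addn0 (dyadic_index_div 0 d y0) add0n.
Qed.

Lemma wave_packetE i m n x : 0 <= x ->
  wave_packet (dtile i m n) x =
  (Num.sqrt (2 ^- i))^-1 * (dyadic_index i x == m)%:R * walsh n (2 ^+ i * x).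
Proof.
move=> x0; rewrite /wave_packet.
have -> : x / tile_length R (dtile i m n) = 2 ^+ i * x.
  by rewrite dtile_length invrK mulrC.
rewrite dtile_length /= indicE; congr (_ * _ * _); congr (nat_of_bool _)%:R.
apply/idP/eqP => [/set_mem/dtile_time[_ ->]//|e].
by apply/mem_set/dtile_time.
Qed.

Context (K : nat).

Definition bitile_of (P : dbitile K) : bitile := dtile (scale_of P) (time_of P) (freq_of P).

Lemma bitile_of_inj : injective bitile_of.
Proof.
move=> P Q e; apply: dbitile_inj; last exact: (congr1 snd e).
  by have := congr1 (fun z : bitile => z.1.1) e => /oppr_inj[].
exact: (congr1 (fun z : bitile => z.1.2) e).
Qed.

Lemma tile_le_up (P T : dbitile K) : up_below P T ->
  tile_le R (up_tile (bitile_of P)) (up_tile (bitile_of T)).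
Proof.
move=> /and3P[s /eqP t /eqP f]; split=> x.
  move=> /dtile_time[x0 e]; apply/dtile_time; split => //.
  by rewrite -t -e (@dyadic_index_div _ (scale_of T) (scale_of P - scale_of T))// subnKC.
move=> /dtile_freq[x0 e]; apply/dtile_freq; split => //.
by rewrite -f -e -freq_index_div// subnKC.
Qed.

(** A common point of the two rectangles determines all the indices by
    division. *)
Lemma down_meet_of_rect (P Q : dbitile K) :
  @tile_rect R (down_tile (bitile_of P)) `&` @tile_rect R (down_tile (bitile_of Q)) !=set0 ->
  down_meet P Q.
Proof.
move=> [[x y] [[/= /dtile_time[x0 xP] /dtile_freq[y0 yP]] [/dtile_time[_ xQ] /dtile_freq[_ yQ]]]].
have aux (P1 P2 : dbitile K) : dyadic_index (scale_of P1) x = time_of P1 -> dyadic_index (scale_of P2) x = time_of P2 ->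
   dyadic_index 0 (2 ^- scale_of P1 * y) = (freq_of P1).*2 ->
   dyadic_index 0 (2 ^- scale_of P2 * y) = (freq_of P2).*2 -> (scale_of P2 <= scale_of P1)%N -> down_below P1 P2.
  move=> x1 x2 y1 y2 s; apply/and3P; split => //.
    by rewrite -x1 -x2 (@dyadic_index_div _ (scale_of P2) (scale_of P1 - scale_of P2))// subnKC.
  by rewrite -y1 -y2 -freq_index_div// subnKC.
rewrite /down_meet; have [le|/ltnW le] := leqP (scale_of Q) (scale_of P).
  by rewrite aux.
by rewrite [down_below Q P]aux ?orbT.
Qed.

(** Bitiles with frequencies below 2^K; their wave packets are constant on
    the atoms. *)
Definition small_bitiles : {set dbitile K} :=
  finset (fun P => ((freq_of P).+1 * 2 ^ (scale_of P).+1 <= 2 ^ K)%N).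

Lemma down_wave_step (P : dbitile K) : P \in small_bitiles ->
  step_on K (wave_packet (R := R) (down_tile (bitile_of P))).
Proof.
rewrite inE => PK x x0 x1; have iK := ltnW (scale_of_lt P).
rewrite !wave_packetE//; last exact: node_ge0.
rewrite dyadic_index_node//.
have -> : (dyadic_index K x %/ 2 ^ (K - scale_of P))%N = dyadic_index (scale_of P) x.
  by rewrite (@dyadic_index_div _ (scale_of P) (K - scale_of P))// subnKC.
congr (_ * _); apply: (@walsh_const _ _ (K - scale_of P)).
- rewrite -(ltn_pmul2r (m := 2 ^ scale_of P)) ?expn_gt0// -expnD subnK//.
  apply: leq_trans PK; rewrite expnS mulnA ltn_pmul2r ?expn_gt0//.
  by rewrite muln2 doubleS leqW.
- by rewrite mulr_ge0// exprn_ge0.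
- by rewrite mulr_ge0 ?exprn_ge0//; exact: node_ge0.
rewrite !dyadic_index_scale subnKC// dyadic_index_node//.
by rewrite subnn divn1.
Qed.

End DyadicTiles.

(** The interval [0, N) is cut into dyadic blocks, one for each binary digit
    1 of N: clearing the digits from the lowest up, digit i removes the
    block of length 2^i that precedes 2^i (N %/ 2^i). *)
Lemma sum_binary_blocks (V : nmodType) (h : nat -> V) (N K : nat) : (N < 2 ^ K)%N ->
  \sum_(n < N) h n = \sum_(i < K | odd (N %/ 2 ^ i))
    \sum_(j < 2 ^ i) h (2 ^ i * (N %/ 2 ^ i).-1 + j)%N.
Proof.
move=> NK.
suff main k : \sum_(n < N) h n = \sum_(n < 2 ^ k * (N %/ 2 ^ k)) h n +
    \sum_(i < k | odd (N %/ 2 ^ i)) \sum_(j < 2 ^ i) h (2 ^ i * (N %/ 2 ^ i).-1 + j)%N.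
  by rewrite (main K) divn_small// muln0 big_ord0 add0r.
elim: k => [|k IH]; first by rewrite big_ord0 addr0 expn0 mul1n divn1.
have blockD A B : \sum_(n < A + B) h n = \sum_(n < A) h n + \sum_(j < B) h (A + j)%N.
  by rewrite big_split_ord.
rewrite IH [X in _ = _ + X]big_mkcond big_ord_recr /= -big_mkcond addrCA addrC; congr (_ + _).
have -> : (N %/ 2 ^ k.+1 = (N %/ 2 ^ k)./2)%N by rewrite expnSr divnMA divn2.
set M := (N %/ 2 ^ k)%N; have := odd_double_half M; case: (odd M) => /= <-.
  rewrite add1n /= uphalf_double mulnS addnC blockD; congr (_ + _).
  by rewrite -mul2n mulnA -expnSr.
rewrite add0n doubleK addr0; congr (\sum_(n < _) h n).
by rewrite -mul2n mulnA -expnSr.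
Qed.

Section BitileExpansion.
Context (R : realType) (Y : completeNormedModType R) (f : R -> Y) (K : nat).
Local Notation mu := (@lebesgue_measure R).
Local Notation D := (`]0, 1[%classic : set R).
Hypothesis f1 : L1 mu D f.

Definition down_coef (P : dbitile K) : Y := tile_coef (extend_by_zero f) (down_tile (bitile_of P)).

Definition down_term (P : dbitile K) (a : 'I_(2 ^ K)) : Y :=
  wave_packet (down_tile (bitile_of P)) (node R K a) *: down_coef P.

Lemma down_term_supp P a : a \notin cell K (scale_of P) (time_of P) -> down_term P a = 0.
Proof.
rewrite inE => aP; rewrite /down_term wave_packetE ?node_ge0//.
rewrite dyadic_index_node; last exact: ltnW (scale_of_lt P).
by rewrite (negbTE aP) mulr0 mul0r scale0r.
Qed.

Definition walsh_sign (t : nat) (a : 'I_(2 ^ K)) : R := walsh t (node R K a).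

Lemma walsh_sign_sqr t a : walsh_sign t a * walsh_sign t a = 1.
Proof. by apply: walsh_sqr; exact: node_ge0. Qed.

(** On the time interval of P, w_t is the product of the Walsh function of
    P_d, of the Rademacher function that separates the two halves, and of a
    constant. *)
Lemma down_term_haar P t : (t %/ 2 ^ scale_of P = (freq_of P).*2.+1)%N ->
  exists c : Y, forall a, a \in cell K (scale_of P) (time_of P) ->
    down_term P a = (walsh_sign t a * (-1) ^+ (a %/ 2 ^ (K - (scale_of P).+1))%N) *: c.
Proof.
move=> tP; pose i := scale_of P; pose r := (t %% 2 ^ i)%N.
have iK : (i < K)%N := scale_of_lt P.
exists (((Num.sqrt (2 ^- i))^-1 * walsh r (node R i (time_of P))) *: down_coef P) => a aP.
have x0 : 0 <= node R K a by exact: node_ge0.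
have z0 : 0 <= 2 ^+ i * node R K a by rewrite mulr_ge0// exprn_ge0.
rewrite /down_term scalerA; congr (_ *: _).
have ai : dyadic_index i (node R K a) = time_of P.
  by rewrite dyadic_index_node ?(ltnW iK)//; apply/eqP; move: aP; rewrite inE.
rewrite wave_packetE// ai eqxx mulr1.
have rP : (r < 2 ^ i)%N by rewrite ltn_mod expn_gt0.
have <- : walsh r (node R K a) = walsh r (node R i (time_of P)).
  apply: (walsh_const rP) => //; first exact: node_ge0.
  by rewrite ai dyadic_index_node// subnn divn1.
have -> : walsh_sign t a = walsh (freq_of P) (2 ^+ 1 * (2 ^+ i * node R K a)) *
    (-1) ^+ (a %/ 2 ^ (K - i.+1))%N * walsh r (node R K a).
  rewrite /walsh_sign (divn_eq t (2 ^ i)) mulnC -/r walsh_split// tP; congr (_ * _).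
  rewrite -addn1 -mul2n -{1}(expn1 2) walsh_split//; congr (_ * _).
  by rewrite walsh1// dyadic_index_scale addn1 dyadic_index_node.
have -> : walsh (down_tile (bitile_of P)).2 (2 ^+ i * node R K a) =
    walsh (freq_of P) (2 ^+ 1 * (2 ^+ i * node R K a)).
  rewrite /= -[(freq_of P).*2]addn0 -mul2n -{1}(expn1 2) walsh_split// ?expn_gt0//.
  by rewrite walsh0 mulr1.
set w := walsh (freq_of P) _; set sg := (-1) ^+ _; set s := (Num.sqrt _)^-1.
have sg2 : sg * sg = 1 by rewrite -expr2 sqrr_sign.
have r2 := walsh_sqr r x0; set wr := walsh r _ in r2 *.
have -> : w * sg * wr * sg * (s * wr) = s * w * (sg * sg) * (wr * wr) by ring.
by rewrite sg2 r2 !mulr1.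
Qed.

Lemma down_coefE P : P \in small_bitiles K -> down_coef P =
  \sum_(b < 2 ^ K) wave_packet (down_tile (bitile_of P)) (node R K b) *: atom_integral f K b.
Proof. by move=> PU; rewrite /down_coef (tile_coef_step f1 (@down_wave_step R _ _ PU)). Qed.

(** The frequencies of P_d form a dyadic block, and the orthogonal
    projection onto the corresponding Walsh functions is, on the time
    interval of P, the projection onto the wave packet of P_d; this is
    walsh_kernel. *)
Lemma walsh_block P (a : 'I_(2 ^ K)) : P \in small_bitiles K -> a \in cell K (scale_of P) (time_of P) ->
  down_term P a = \sum_(j < 2 ^ scale_of P)
    walsh (2 ^ scale_of P * (freq_of P).*2 + j) (node R K a) *: walsh_coef f (2 ^ scale_of P * (freq_of P).*2 + j).
Proof.
move=> PU aP; pose i := scale_of P; have iK := ltnW (scale_of_lt P).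
have nK j : (j < 2 ^ i)%N -> (2 ^ i * (freq_of P).*2 + j < 2 ^ K)%N.
  move=> ji; move: PU; rewrite inE; apply: leq_trans.
  rewrite expnS -/i; move: ji; move: (2 ^ i)%N (freq_of P) => p n; clear; nia.
rewrite /down_term down_coefE// scaler_sumr.
transitivity (\sum_(j < 2 ^ i) \sum_(b < 2 ^ K)
  (walsh (2 ^ i * (freq_of P).*2 + j) (node R K a) *
   walsh (2 ^ i * (freq_of P).*2 + j) (node R K b)) *: atom_integral f K b); last first.
  apply: eq_bigr => j _; rewrite (@walsh_coef_step _ _ _ f1 K) ?nK// scaler_sumr.
  by apply: eq_bigr => b _; rewrite scalerA.
rewrite exchange_big /=; apply: eq_bigr => b _; rewrite scalerA -scaler_suml.
congr (_ *: _).
have xa := node_ge0 R K a; have xb := node_ge0 R K b.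
have ai : dyadic_index i (node R K a) = time_of P.
  by rewrite dyadic_index_node//; apply/eqP; move: aP; rewrite inE.
rewrite !wave_packetE// -/i ai eqxx mulr1.
transitivity (\sum_(j < 2 ^ i) (walsh (freq_of P).*2 (2 ^+ i * node R K a) *
   walsh (freq_of P).*2 (2 ^+ i * node R K b)) * (walsh j (node R K a) * walsh j (node R K b))); last first.
  by apply: eq_bigr => j _; rewrite !walsh_split// mulrACA.
rewrite -mulr_sumr walsh_kernel ?node_itv// ai eq_sym.
case: (time_of P == dyadic_index i (node R K b)); last by rewrite /= !(mulr0, mul0r).
have s2 : (Num.sqrt (2 ^- i))^-1 * (Num.sqrt (2 ^- i))^-1 = 2 ^+ i :> R.
  by rewrite -invfM -expr2 sqr_sqrtr ?invr_ge0 ?exprn_ge0// invrK.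
have -> : (bitile_of P).2 = freq_of P by [].
by rewrite mulr1 mulrACA s2 mulrC.
Qed.

(** The blocks of sum_binary_blocks are the frequency intervals of the
    down-tiles whose up-tile contains N(a). *)
Lemma linearized_walsh_sum (N : 'I_(2 ^ K) -> nat) a : (N a < 2 ^ K)%N ->
  linearized_sum down_term N (small_bitiles K) a = walsh_sum f (N a) (node R K a).
Proof.
move=> NK; rewrite /walsh_sum.
rewrite (@sum_binary_blocks _ (fun n => walsh n (node R K a) *: walsh_coef f n) _ K NK).
rewrite /linearized_sum (partition_big (fun P : dbitile K => P.1.1) xpredT) //=.
rewrite [RHS]big_mkcond /=; apply: eq_bigr => i _.
have iK : (i < K)%N := ltn_ord i.
have mK : (a %/ 2 ^ (K - i) < 2 ^ K)%N by apply: leq_ltn_trans (leq_div _ _) (ltn_ord a).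
have nK : (N a %/ 2 ^ i.+1 < 2 ^ K)%N by apply: leq_ltn_trans (leq_div _ _) NK.
pose P : dbitile K := (i, Ordinal mK, Ordinal nK).
have h : ((N a %/ 2 ^ i)./2 = freq_of P)%N by rewrite /freq_of /= expnSr divnMA divn2.
have aP : a \in cell K (scale_of P) (time_of P) by rewrite inE.
case: ifPn => [Nodd|Neven]; last first.
  rewrite big1// => Q /andP[/andP[_ /eqP uQ] /eqP Qi].
  by move: Neven; rewrite -Qi -/(scale_of Q) uQ /= odd_double.
have NP : (N a %/ 2 ^ i = (freq_of P).*2.+1)%N by rewrite -h -[LHS]odd_double_half Nodd.
have PU : P \in small_bitiles K.
  rewrite inE; have : (freq_of P < 2 ^ (K - i.+1))%N.
    rewrite /freq_of /= ltn_divLR ?expn_gt0// -expnD subnK//.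
  by move=> lt; rewrite -[X in (_ <= 2 ^ X)%N](subnK iK) expnD leq_mul2r lt orbT.
rewrite (bigD1 P) /=; last first.
  by rewrite PU /in_up NP !eqxx.
rewrite big1 ?addr0; last first.
  move=> Q /andP[/andP[/andP[_ /eqP uQ] /eqP Qi] QP].
  have sQ : scale_of Q = i by rewrite -Qi.
  apply: down_term_supp; apply: contra QP; rewrite inE => /eqP aQ.
  apply/eqP; apply: dbitile_inj => //; first by rewrite -aQ sQ.
  by move: uQ; rewrite sQ NP => -[]; clear; lia.
by rewrite (walsh_block PU aP) NP.
Qed.

End BitileExpansion.

Lemma pairwise_in (T : eqType) (r : rel T) (s : seq T) : symmetric r ->
  pairwise r s -> {in s &, forall x y, x != y -> r x y}.
Proof.
move=> sr; elim: s => [|z s IH] //= /andP[/allP zs /IH{}IH] x y.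
rewrite !inE => /orP[/eqP ->|xs] /orP[/eqP ->|ys] xy.
- by rewrite eqxx in xy.
- exact: zs.
- by rewrite sr zs.
- exact: IH.
Qed.

Definition tile_type_with (R : realType) (Y : completeNormedModType R) (q C : R) : Prop :=
  forall f : R -> Y,
  in_LY lebesgue_measure `[0, +oo[%classic q f ->
  forall TT : {fset {fset bitile}},
  (forall T, T \in TT -> up_tree R T) -> down_disjoint R TT ->
  ((\sum_(T <- TT)
      (LYnorm lebesgue_measure `[0%R, +oo[%classic q (tree_sum f T)) `^ q)
     `^ q^-1
   <= C%:E * LYnorm lebesgue_measure `[0%R, +oo[%classic q f)%E.

(** * Tile-type bounds the energy of disjoint up-trees *)

Section EnergyBound.
Context (R : realType) (Y : completeNormedModType R) (f : R -> Y) (K : nat) (q : R).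
Local Notation mu := (@lebesgue_measure R).
Local Notation D := (`]0, 1[%classic : set R).
Local Notation D' := (`[0, +oo[%classic : set R).
Hypothesis q1 : 1 <= q.
Hypothesis fq : in_LY mu D q f.

Let q0 : 0 < q. Proof. exact: lt_le_trans q1. Qed.
Let mD : measurable (D : set (measurableTypeR R)). Proof. exact: measurable_itv. Qed.
Let mD' : measurable (D' : set (measurableTypeR R)). Proof. exact: measurable_itv. Qed.
Let DD' : D `<=` D'.
Proof. by move=> x; rewrite /= !in_itv /= => /andP[/ltW ->]. Qed.

Lemma measure_unit_itv : mu D = 1%E.
Proof. by rewrite lebesgue_measure_itv /= lte_fin ltr01 -EFinB subr0. Qed.

Lemma in_LY_unit_L1 : L1 mu D f.
Proof.
have Doo : (mu D < +oo)%E by rewrite measure_unit_itv ltry.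
exact (in_LY_L1 mD q1 Doo fq).
Qed.

Let f1 := in_LY_unit_L1.

(** The q-th power of the norm, as a real number. *)
Definition moment : R := fine (\int[mu]_(x in D) (`|f x| `^ q)%:E)%E.

Lemma momentE : moment%:E = (\int[mu]_(x in D) (`|f x| `^ q)%:E)%E.
Proof.
have /(in_LY_int _ _ _ q0)[_ fi] := fq.
rewrite /moment fineK// ge0_fin_numE//.
by apply: integral_ge0 => x _; rewrite lee_fin powR_ge0.
Qed.

Lemma moment_ge0 : 0 <= moment.
Proof.
rewrite -lee_fin momentE; apply: integral_ge0 => x _.
by rewrite lee_fin powR_ge0.
Qed.

Lemma LYnorm_moment : LYnorm mu D q f = (moment `^ q^-1)%:E.
Proof.
rewrite -poweR_EFin momentE -(LYnorm_powR mu D f q0) -poweRrM mulfV ?gt_eqF//.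
by rewrite poweRe1// LYnorm_ge0.
Qed.

Lemma LYnorm_extend_by_zero : LYnorm mu D' q (extend_by_zero f) = LYnorm mu D q f.
Proof.
rewrite /LYnorm; congr (Lnorm _ _ _); apply/funext => x; rewrite !patchE /extend_by_zero indicE.
have [Dx|Dx] := pselect (D x).
  by rewrite !mem_set//; [rewrite scale1r|exact: DD'].
by rewrite [x \in D]memNset// scale0r normr0; case: ifP.
Qed.

Lemma in_LY_extend_by_zero : in_LY mu D' q (extend_by_zero f).
Proof.
split; last by rewrite LYnorm_extend_by_zero; case: fq.
by have [[sm _] _] := bochner_restrict mD mD' DD' f1.
Qed.

Definition fset_of (T : {set dbitile K}) : {fset bitile} :=
  seq_fset tt (map (@bitile_of K) (enum T)).

Lemma fset_ofP (T : {set dbitile K}) (P : bitile) :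
  reflect (exists2 Q, Q \in T & P = bitile_of Q) (P \in fset_of T).
Proof.
rewrite seq_fsetE; apply: (iffP mapP) => -[Q QT ->]; exists Q => //.
  by rewrite -mem_enum.
by rewrite mem_enum.
Qed.

Lemma big_fset_of (V : nmodType) (T : {set dbitile K}) (F : bitile -> V) :
  \sum_(P <- fset_of T) F P = \sum_(P in T) F (bitile_of P).
Proof.
rewrite (perm_big _ (seq_fset_perm _ _)) /= undup_id ?big_map ?big_enum//.
by rewrite map_inj_uniq ?enum_uniq//; exact: bitile_of_inj.
Qed.

(** Outside the unit interval the terms vanish, either through the wave
    packet or through its coefficient. *)
Lemma tree_sum_energy (T : {set dbitile K}) : T \subset small_bitiles K ->
  (LYnorm mu D' q (tree_sum (extend_by_zero f) (fset_of T)) `^ q =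
   (2 ^- K * energy q (@down_term _ _ f K) T)%:E)%E.
Proof.
move=> TU; rewrite LYnorm_powR//.
pose F n := `|\sum_(P in T) wave_packet (down_tile (bitile_of P)) (node R K n)
  *: down_coef f P| `^ q.
have F0 n : 0 <= F n by exact: powR_ge0.
transitivity (\int[mu]_(x in D')
    (\sum_(a < 2 ^ K) ((F a)%:E * (\1_(@atom R K a) x)%:E))%E)%E.
  apply: eq_integral => x; rewrite inE /= in_itv /= andbT => x0.
  rewrite /tree_sum big_fset_of.
  transitivity (\sum_(a < 2 ^ K) (if x \in @atom R K a then F a else 0))%:E; last first.
    rewrite -sumEFin; apply: eq_bigr => a _; rewrite indicE.
    by case: (x \in _); rewrite ?mule1 ?mule0.
  have [x1|x1] := ltP x 1.
    have x01 : 0 <= x < 1 by rewrite x0 x1.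
    rewrite (@sum_atom R K _ F x x01); congr (`|_| `^ _)%:E.
    apply: eq_bigr => P PT; congr (_ *: _).
    exact: (down_wave_step (fintype.subsetP TU _ PT)).
  rewrite [X in _ = X%:E]big1; last first.
    by move=> a _; case: ifPn => // /set_mem /atom_lt1; rewrite ltNge x1.
  rewrite big1 ?normr0 ?powR0 ?gt_eqF// => P PT.
  rewrite wave_packetE//; have [e|] := eqVneq (dyadic_index (scale_of P) x) (time_of P); last first.
    by rewrite mulr0 mul0r scale0r.
  have -> : tile_coef (extend_by_zero f) (down_tile (bitile_of P)) = down_coef f P by [].
  rewrite (down_coefE f1 (fintype.subsetP TU _ PT)).
  rewrite big1 ?scaler0// => b _; rewrite wave_packetE ?node_ge0//.
  have -> : (dyadic_index (scale_of P) (node R K b) == time_of P) = false; last first.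
    by rewrite mulr0 mul0r scale0r.
  apply/eqP => e'.
  have := dyadic_index_lt (scale_of P) (node_ge0 R K b) (node_lt1 R (ltn_ord b)).
  rewrite e' -e ltnNge => /negP; apply.
  rewrite /dyadic_index truncn_ge_nat ?mulr_ge0 ?exprn_ge0//.
  by rewrite natrX ler_peMr ?exprn_ge0.
rewrite ge0_integral_sum//; last 2 first.
- move=> a; apply: measurable_funeM; apply/measurable_EFinP.
  by apply: measurable_indic; exact: measurable_atom.
- by move=> a x _; rewrite mule_ge0// lee_fin.
rewrite /energy mulr_sumr -sumEFin; apply: eq_bigr => a _.
rewrite ge0_integralZl//; last 2 first.
- by apply/measurable_EFinP; apply: measurable_indic; exact: measurable_atom.
- by rewrite lee_fin.
rewrite integral_indic//; last exact: measurable_atom.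
have -> : @atom R K a `&` D' = @atom R K a.
  by apply/setIidl => x /atom_ge0; rewrite /= in_itv /= andbT.
by rewrite [X in (_ * X)%E]measure_atom -EFinM mulrC.
Qed.

(** The trees of the sequence are pairwise different because they are
    nonempty and disjoint, so no tree is lost in the passage to a finite set
    of trees. *)
Lemma energy_bound (C : R) (l : seq ({set dbitile K} * dbitile K)) :
  tile_type_with Y q C ->
  tree_seq_ok (small_bitiles K) l ->
  \sum_(x <- l) energy q (@down_term _ _ f K) x.1 <= 2 ^+ K * (`|C| `^ q * moment).
Proof.
move=> htile /andP[/allP okl disj].
have xU x : x \in l -> x.1 \subset small_bitiles K by move=> /okl /and3P[].
have x0 x : x \in l -> x.1 != finset.set0 by move=> /okl /and3P[].
have xT x P : x \in l -> P \in x.1 -> up_below P x.2.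
  by move=> /okl /and3P[_ _ /forall_inP h] /h.
pose s := map (fun x : {set dbitile K} * dbitile K => fset_of x.1) l.
have us : uniq s.
  rewrite uniq_pairwise pairwise_map.
  apply: (@sub_in_pairwise _ (mem l)) disj; last exact/allP.
  move=> x y xl yl /forall_inP h; apply/negP => /eqP e.
  have /set0Pn[P Px] := x0 _ xl.
  have : bitile_of P \in fset_of y.1 by rewrite -e; apply/fset_ofP; exists P.
  move=> /fset_ofP[Q Qy /bitile_of_inj PQ]; rewrite -PQ in Qy.
  have := h P Px => /forall_inP/(_ P Qy); rewrite /down_meet orbb.
  by rewrite /down_below /ancestor subnn !divn1 leqnn !eqxx.
pose TT : {fset {fset bitile}} := seq_fset tt s.
have upTT T : T \in TT -> up_tree R T.
  rewrite seq_fsetE => /mapP[x xl ->]; exists (bitile_of x.2) => P /fset_ofP[Q Qx ->].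
  exact: tile_le_up (xT _ _ xl Qx).
have symm : symmetric (fun x y : {set dbitile K} * dbitile K =>
    [forall P in x.1, forall Q in y.1, ~~ down_meet P Q]).
  move=> x y; apply/forall_inP/forall_inP => h P Px; apply/forall_inP => Q Qy;
    by rewrite down_meet_sym; have /forall_inP := h Q Qy; apply.
have ddTT : down_disjoint R TT.
  move=> P1 P2 T1 T2 P1T1; rewrite seq_fsetE => /mapP[x xl eT1] P2T2.
  rewrite seq_fsetE => /mapP[y yl eT2] neq.
  move: P1T1 P2T2; rewrite eT1 eT2 => /fset_ofP[Q1 Q1x e1] /fset_ofP[Q2 Q2y e2].
  apply/eqP; apply/negPn/negP; rewrite e1 e2 => /set0P /down_meet_of_rect dm.
  have [xy|xy] := eqVneq x y; last first.
    have := pairwise_in symm disj xl yl xy => /forall_inP/(_ _ Q1x)/forall_inP/(_ _ Q2y).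
    by rewrite dm.
  apply: neq; rewrite eT1 eT2 xy; congr (_, _); rewrite e1 e2; congr bitile_of.
  by apply: (up_tree_down_meet (xT _ _ xl Q1x)) dm; apply: (xT x) => //; rewrite xy.
have := htile _ in_LY_extend_by_zero TT upTT ddTT.
have -> : (\sum_(T <- TT) LYnorm mu D' q (tree_sum (extend_by_zero f) T) `^ q)%E =
    (2 ^- K * \sum_(x <- l) energy q (@down_term _ _ f K) x.1)%:E.
  rewrite (perm_big _ (seq_fset_perm _ _)) /= undup_id// big_map mulr_sumr -sumEFin.
  rewrite big_seq [RHS]big_seq; apply: eq_bigr => x xl.
  by rewrite tree_sum_energy// xU.
set S := \sum_(x <- l) _; rewrite LYnorm_extend_by_zero LYnorm_moment poweR_EFin -EFinM lee_fin => h.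
have S0 : 0 <= 2 ^- K * S.
  rewrite mulr_ge0// ?invr_ge0 ?exprn_ge0// sumr_ge0// => x _.
  by rewrite sumr_ge0// => a _; exact: powR_ge0.
have h2 : (2 ^- K * S) `^ q^-1 <= `|C| * moment `^ q^-1.
  by apply: le_trans h _; rewrite ler_wpM2r ?powR_ge0// ler_norm.
have := @ge0_ler_powR R q (ltW q0) _ _ _ _ h2.
rewrite !nnegrE powR_ge0 mulr_ge0 ?powR_ge0// => /(_ isT isT).
have root z : 0 <= z -> (z `^ q^-1) `^ q = z.
  by move=> z0; rewrite -powRrM mulVf ?gt_eqF// powRr1.
rewrite (root _ S0) powRM ?powR_ge0// (root _ moment_ge0).
by rewrite mulrC ler_pdivrMr ?exprn_gt0// [_ * 2 ^+ K]mulrC.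
Qed.

End EnergyBound.

Lemma carleson_const_ge0 (R : realType) (q : R) : 2 <= q -> 0 <= carleson_const q.
Proof.
move=> hq; rewrite addr_ge0// divr_ge0// subr_ge0.
  by rewrite ler_pdivrMr// mul1r (ltW (root_lt2 hq)).
by rewrite invf_le1 ?(ltW (root_gt1 hq))// powR_gt0.
Qed.

(** * The maximal inequality *)

Section WeakType.
Context (R : realType) (Y : completeNormedModType R) (q C : R).
Local Notation mu := (@lebesgue_measure R).
Local Notation D := (`]0, 1[%classic : set R).
Hypothesis hq : 2 <= q.
Hypothesis htile : tile_type_with Y q C.

Let q1 : 1 <= q. Proof. by apply: le_trans hq; rewrite ler1n. Qed.
Let q0 : 0 < q. Proof. exact: lt_le_trans q1. Qed.
Let mD : measurable (D : set (measurableTypeR R)). Proof. exact: measurable_itv. Qed.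

Definition weak_const := carleson_const q * `|C|.

Lemma weak_const_ge0 : 0 <= weak_const.
Proof. by rewrite mulr_ge0// carleson_const_ge0. Qed.

Context (f : R -> Y).
Hypothesis fq : in_LY mu D q f.

Let f1 : L1 mu D f. Proof. exact (in_LY_unit_L1 q1 fq). Qed.

Lemma walsh_sum_step K N x : (N < 2 ^ K)%N -> 0 <= x -> x < 1 ->
  walsh_sum f N x = walsh_sum f N (node R K (dyadic_index K x)).
Proof.
move=> NK x0 x1; apply: eq_bigr => n _; congr (_ *: _).
by apply: walsh_step => //; exact: ltn_trans (ltn_ord n) NK.
Qed.

Section FixedScale.
Context (K : nat) (lam : R).
Hypothesis lam0 : 0 < lam.

Definition exceed : {set 'I_(2 ^ K)} :=
  finset (fun a : 'I_(2 ^ K) => [exists N : 'I_(2 ^ K), lam < `|walsh_sum f N (node R K a)|]).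

Definition exceed_freq (a : 'I_(2 ^ K)) : nat :=
  oapp (@nat_of_ord _) 0%N [pick N : 'I_(2 ^ K) | lam < `|walsh_sum f N (node R K a)|].

Lemma exceed_freq_lt a : (exceed_freq a < 2 ^ K)%N.
Proof. by rewrite /exceed_freq; case: pickP => [N _|_] /=; rewrite ?expn_gt0. Qed.

Lemma exceed_freqP a : a \in exceed -> lam < `|walsh_sum f (exceed_freq a) (node R K a)|.
Proof.
rewrite inE => /existsP[N hN]; rewrite /exceed_freq; case: pickP => [//|h].
by rewrite h in hN.
Qed.

(** The discrete theorem asks for a positive bound on the energies, and the
    moment may vanish; hence the auxiliary e'. *)
Lemma card_exceed : lam `^ q * #|exceed|%:R / 2 ^+ K <= weak_const `^ q * moment f q.
Proof.
have [->|E0] := posnP #|exceed|.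
  by rewrite mulr0 mul0r mulr_ge0 ?powR_ge0 ?moment_ge0.
have cc0 := carleson_const_ge0 hq.
have m0 : 0 <= `|C| `^ q * moment f q by rewrite mulr_ge0 ?powR_ge0 ?moment_ge0.
have k0 : 0 <= carleson_const q `^ q by exact: powR_ge0.
have p0 : 0 < 2 ^+ K :> R by rewrite exprn_gt0.
rewrite /weak_const powRM// -[leRHS]mulrA; apply/ler_addgt0Pr => e e0.
pose e' := e / (carleson_const q `^ q + 1).
have k1 : 0 < carleson_const q `^ q + 1 by rewrite ltr_wpDl.
have e'0 : 0 < e' by rewrite divr_gt0.
(* 2^K converts lengths into numbers of atoms *)
pose B := 2 ^+ K * (`|C| `^ q * moment f q + e').
have B0 : 0 < B by rewrite mulr_gt0// ltr_wpDl.
have Ble l : tree_seq_ok (small_bitiles K) l ->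
    \sum_(x <- l) energy q (@down_term _ _ f K) x.1 <= B.
  move=> okl; apply: le_trans (energy_bound q1 fq htile okl) _.
  by rewrite ler_pM2l// lerDl ltW.
have haar P t (_ : P \in small_bitiles K) := @down_term_haar R Y f K P t.
have := @discrete_weak_type R Y q K hq _ _ _ (@down_term_supp R Y f K)
  (@walsh_sign_sqr R K) haar exceed exceed_freq B B0 Ble E0 lam (ltW lam0).
move=> /(_ _)/wrap[].
  move=> a aE; rewrite (linearized_walsh_sum f1 (exceed_freq_lt a)).
  exact: ltW (exceed_freqP aE).
move=> h; rewrite ler_pdivrMr//; apply: le_trans h _.
have -> : carleson_const q `^ q * B =
    (carleson_const q `^ q * (`|C| `^ q * moment f q) + carleson_const q `^ q * e') * 2 ^+ K.
  by rewrite /B; ring.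
rewrite ler_pM2r// lerD2l /e' mulrA ler_pdivrMr// mulrC ler_pM2l//.
by rewrite lerDl.
Qed.

Definition exceed_set : set (measurableTypeR R) :=
  [set x | D x /\ exists2 N, (N < 2 ^ K)%N & lam < `|walsh_sum f N x|].

Lemma exceed_setE :
  exceed_set = D `&` \big[setU/set0]_(a in exceed) (atom K a : set (measurableTypeR R)).
Proof.
rewrite -big_enum -bigcup_seq; apply/seteqP; split=> x.
  move=> [Dx [N NK lN]]; split => //.
  have /andP[/ltW x0 x1] : 0 < x < 1 by move: Dx; rewrite /= in_itv.
  exists (Ordinal (dyadic_index_lt K x0 x1)) => /=.
    rewrite mem_enum inE; apply/existsP; exists (Ordinal NK) => /=.
    by rewrite -walsh_sum_step.
  by apply/set_mem; rewrite in_atom.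
move=> [Dx [a /=]]; rewrite mem_enum inE => /existsP[N lN] xa; split => //.
have /andP[/ltW x0 x1] : 0 < x < 1 by move: Dx; rewrite /= in_itv.
exists N; first exact: ltn_ord.
rewrite (walsh_sum_step (ltn_ord N) x0 x1).
by move/mem_set: xa; rewrite in_atom// => /eqP ->.
Qed.

Lemma measurable_exceed_set : measurable exceed_set.
Proof.
rewrite exceed_setE; apply: measurableI => //.
by apply: bigsetU_measurable => a _; exact: measurable_atom.
Qed.

Lemma measure_exceed_set :
  (mu exceed_set <= (weak_const `^ q * moment f q / lam `^ q)%:E)%E.
Proof.
apply: (@le_trans _ _ (#|exceed|%:R / 2 ^+ K)%:E); last first.
  rewrite lee_fin ler_pdivlMr ?powR_gt0//; apply: le_trans card_exceed.
  by rewrite mulrC mulrA.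
have sub : exceed_set `<=` \bigcup_(a in [set` enum exceed]) (atom K a : set (measurableTypeR R)).
  by rewrite exceed_setE -big_enum -bigcup_seq => x [].
have := content_sub_fsum mu (finite_seq (enum exceed))
  (fun a _ => @measurable_atom R K a) measurable_exceed_set sub.
rewrite -fsbig_seq ?enum_uniq// big_enum /= => /le_trans; apply.
under eq_bigr do rewrite measure_atom.
by rewrite sumEFin lee_fin sumr_const -[leLHS]mulr_natl.
Qed.

End FixedScale.

Definition maximal_exceed_set (lam : R) : set (measurableTypeR R) :=
  [set x | D x /\ exists N, lam < `|walsh_sum f N x|].

Lemma maximal_exceed_setE lam :
  maximal_exceed_set lam = \bigcup_K exceed_set K lam.
Proof.
apply/seteqP; split=> x.
  by move=> [Dx [N lN]]; exists N => //; split => //; exists N => //; exact: ltn_expl.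
by move=> [K _ [Dx [N _ lN]]]; split => //; exists N.
Qed.

Lemma measurable_maximal_exceed_set lam : measurable (maximal_exceed_set lam).
Proof.
by rewrite maximal_exceed_setE; apply: bigcup_measurable => K _; exact: measurable_exceed_set.
Qed.

(** The bound does not depend on K, and the exceptional sets increase with
    K. *)
Lemma measure_maximal_exceed_set lam : 0 < lam ->
  (mu (maximal_exceed_set lam) <= (weak_const `^ q * moment f q / lam `^ q)%:E)%E.
Proof.
move=> lam0; have mK K := measurable_exceed_set K lam.
have mU : measurable (\bigcup_K exceed_set K lam) by exact: bigcup_measurable.
have hom : {homo (fun K => exceed_set K lam) : n m / (n <= m)%N >-> (n <= m)%O}.
  move=> n m nm; rewrite subsetEset => x [Dx [N Nn lN]]; split => //.
  by exists N => //; apply: leq_trans Nn _; rewrite leq_exp2l.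
have cv := @nondecreasing_cvg_mu _ _ _ mu _ mK mU hom.
rewrite maximal_exceed_setE.
have -> : mu (\bigcup_K exceed_set K lam) = lim ((mu \o (fun K => exceed_set K lam)) K @[K --> \oo]).
  by apply/esym/cvg_lim.
apply: lime_le; first by apply/cvg_ex; eexists; exact: cv.
by apply: nearW => K; exact: measure_exceed_set.
Qed.

Lemma weak_Lnorm_walsh_maximal :
  (weak_Lnorm mu D q (walsh_maximal f) <= weak_const%:E * LYnorm mu D q f)%E.
Proof.
apply: ge_ereal_sup => _ [lam /= lam0 <-].
have -> : D `&` [set x | (lam%:E < `|walsh_maximal f x|)%E] = maximal_exceed_set lam.
  have max0 x : (0 <= walsh_maximal f x)%E.
    by apply: (@le_trans _ _ `|walsh_sum f 0 x|%:E) => //; apply: ereal_sup_ubound; exists 0%N.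
  apply/seteqP; split=> x [Dx] /=; rewrite gee0_abs//.
    by move=> /ereal_sup_gt[_ [N _ <-]]; rewrite lte_fin => lN; split => //; exists N.
  move=> [N lN]; split => //=.
  apply: (@lt_le_trans _ _ `|walsh_sum f N x|%:E); first by rewrite lte_fin.
  by apply: ereal_sup_ubound; exists N.
have M0 : 0 <= weak_const `^ q * moment f q by rewrite mulr_ge0 ?powR_ge0 ?moment_ge0.
apply: (@le_trans _ _ (lam%:E * (weak_const `^ q * moment f q / lam `^ q)%:E `^ q^-1)%E).
  rewrite lee_pmul2l//; apply: gt0_ler_poweR.
  - by rewrite invr_ge0 ltW.
  - by rewrite in_itv /= leey measure_ge0.
  - by rewrite in_itv /= leey andbT lee_fin divr_ge0 ?powR_ge0.
  exact: measure_maximal_exceed_set.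
rewrite (LYnorm_moment q1 fq) poweR_EFin -!EFinM lee_fin.
have root z : 0 <= z -> (z `^ q) `^ q^-1 = z.
  by move=> z0; rewrite -powRrM mulfV ?gt_eqF// powRr1.
have -> : weak_const `^ q * moment f q / lam `^ q =
   (weak_const / lam) `^ q * moment f q.
  have e : weak_const = weak_const / lam * lam by rewrite divfK// gt_eqF.
  rewrite {1}e powRM ?divr_ge0 ?weak_const_ge0 ?(ltW lam0)//.
  by rewrite mulrAC mulfK// gt_eqF// powR_gt0.
rewrite powRM ?powR_ge0 ?moment_ge0// root ?divr_ge0 ?weak_const_ge0 ?(ltW lam0)//.
by rewrite mulrA [lam * _]mulrC divfK// gt_eqF.
Qed.

End WeakType.

Lemma measure_unit_atom (R : realType) L (b : 'I_(2 ^ L)) :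
  @lebesgue_measure R (`]0, 1[%classic `&` atom L b) = (2 ^- L)%:E.
Proof.
have [b0|b0] := posnP b.
  have -> : `]0, 1[%classic `&` atom L b = `]0, (2 ^- L : R)[%classic.
    have L1 : 2 ^- L <= 1 :> R by rewrite invf_le1 ?exprn_gt0// exprn_ege1// ler1n.
    rewrite /atom b0 /node mul0r mul1r; apply/seteqP; split=> x /=; rewrite !in_itv /=.
      by move=> [/andP[-> _] /andP[_ ->]].
    by move=> /andP[x0 xL]; rewrite x0 xL ltW//= (lt_le_trans xL).
  by rewrite lebesgue_measure_itv /= lte_fin invr_gt0 exprn_gt0// -EFinB subr0.
rewrite setIidr ?measure_atom// => x bx; rewrite /= in_itv /=.
rewrite (atom_lt1 bx) andbT; move: bx; rewrite /atom /= in_itv /= => /andP[h _].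
by apply: lt_le_trans h; rewrite /node divr_gt0 ?exprn_gt0// ltr0n.
Qed.

(** By walsh_kernel the columns of the matrix of Walsh values at the nodes
    are orthogonal; a square matrix with orthogonal columns of equal norm
    has orthogonal rows. *)
Lemma walsh_orthogonal (R : realType) L (n m : 'I_(2 ^ L)) :
  \sum_(b < 2 ^ L) walsh n (node R L b) * walsh m (node R L b) =
  if n == m then 2 ^+ L else 0.
Proof.
pose W : 'M[R]_(2 ^ L) := \matrix_(j, a) walsh j (node R L a).
have c0 : 2 ^+ L != 0 :> R by rewrite expf_neq0// pnatr_eq0.
have WtW : (2 ^- L *: W^T) *m W = 1%:M.
  apply/matrixP => a b; rewrite -scalemxAl !mxE.
  under eq_bigr do rewrite !mxE.
  rewrite walsh_kernel ?node_itv// !dyadic_index_node// subnn !divn1.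
  rewrite (inj_eq val_inj); case: (a == b); last by rewrite mulr0.
  by rewrite mulVf.
have := mulmx1C WtW => /matrixP/(_ n m).
rewrite -scalemxAr !mxE; under eq_bigr do rewrite !mxE.
move=> h; apply: (mulfI (invr_neq0 c0)); rewrite h.
by case: (n == m); rewrite ?mulr0 ?mulVf.
Qed.

(** * Walsh series of dyadic step functions *)

Section StepWalshSums.
Context (R : realType) (Y : completeNormedModType R) (g : R -> Y) (K : nat).
Local Notation mu := (@lebesgue_measure R).
Local Notation D := (`]0, 1[%classic : set R).
Hypothesis g1 : L1 mu D g.
Hypothesis g_step : forall x, 0 <= x -> x < 1 -> g x = g (node R K (dyadic_index K x)).

Let mD : measurable (D : set (measurableTypeR R)). Proof. exact: measurable_itv. Qed.

Lemma atom_integral_step L (b : 'I_(2 ^ L)) : (K <= L)%N ->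
  atom_integral g L b = 2 ^- L *: g (node R L b).
Proof.
move=> KL; have fin : (mu (D `&` atom L b) < +oo)%E by rewrite measure_unit_atom ltry.
have [La ea] := bochner_indic mD (g (node R L b)) (@measurable_atom R L b) fin.
have -> : 2 ^- L = fine (mu (D `&` atom L b)) by rewrite measure_unit_atom.
rewrite -ea; apply: (L1_eq_on mD _ La).2 => x Dx; rewrite indicE.
case: (boolP (x \in atom L b)) => [xb|_]; last by rewrite !scale0r.
have /andP[/ltW x0 x1] : 0 < x < 1 by move: Dx; rewrite /= in_itv.
move: xb; rewrite in_atom// => /eqP xb; congr (_ *: _).
rewrite (g_step x0 x1) (g_step (node_ge0 _ _ _) (node_lt1 _ (ltn_ord b))).
congr (g (node R K _)); rewrite dyadic_index_node// (@dyadic_index_div _ K (L - K))//.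
by rewrite subnKC// xb.
Qed.

Definition step_coef m : Y := 2 ^- K *: \sum_(a < 2 ^ K) walsh m (node R K a) *: g (node R K a).

Lemma step_expansion x : 0 <= x < 1 -> g x = \sum_(m < 2 ^ K) walsh m x *: step_coef m.
Proof.
move=> x01; have /andP[x0 x1] := x01.
transitivity (2 ^- K *: \sum_(a < 2 ^ K)
    (\sum_(m < 2 ^ K) walsh m x * walsh m (node R K a)) *: g (node R K a)).
  rewrite (bigD1 (Ordinal (dyadic_index_lt K x0 x1)))//=.
  rewrite walsh_kernel ?node_ge0 ?node_lt1 ?dyadic_index_lt//.
  rewrite dyadic_index_node// subnn divn1 eqxx big1 ?addr0.
    rewrite scalerA mulVf ?scale1r ?expf_neq0 ?pnatr_eq0//.
    exact: g_step.
  move=> a ha; rewrite walsh_kernel ?node_itv// dyadic_index_node// subnn divn1.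
  case: ifPn => [/eqP e|_]; last by rewrite scale0r.
  by rewrite -(inj_eq val_inj) /= e eqxx in ha.
under eq_bigr do rewrite scaler_suml.
rewrite exchange_big /= scaler_sumr; apply: eq_bigr => m _.
rewrite /step_coef !scaler_sumr; apply: eq_bigr => a _.
by rewrite !scalerA mulrCA mulrA.
Qed.

Lemma walsh_coef_step_fun n :
  walsh_coef g n = if (n < 2 ^ K)%N then step_coef n else 0.
Proof.
(* a generation fine enough for both w_n and g *)
pose L := maxn n K; have KL : (K <= L)%N := leq_maxr _ _.
have nL : (n < 2 ^ L)%N.
  by apply: leq_trans (ltn_expl n (ltnSn 1)) _; rewrite leq_exp2l// leq_maxl.
have K2L : (2 ^ K <= 2 ^ L)%N by rewrite leq_exp2l.
have c0 : 2 ^+ L != 0 :> R by rewrite expf_neq0// pnatr_eq0.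
rewrite (walsh_coef_step g1 nL).
transitivity (\sum_(m < 2 ^ K) (2 ^- L * \sum_(b < 2 ^ L)
    walsh n (node R L b) * walsh m (node R L b)) *: step_coef m).
  transitivity (\sum_(b < 2 ^ L) \sum_(m < 2 ^ K)
     (2 ^- L * (walsh n (node R L b) * walsh m (node R L b))) *: step_coef m).
    apply: eq_bigr => b _; rewrite atom_integral_step// (step_expansion (node_itv R b)).
    rewrite !scaler_sumr; apply: eq_bigr => m _; rewrite !scalerA; congr (_ *: _); ring.
  by rewrite exchange_big; apply: eq_bigr => m _; rewrite -scaler_suml mulr_sumr.
have orth (m : 'I_(2 ^ K)) : 2 ^- L * \sum_(b < 2 ^ L)
    walsh n (node R L b) * walsh m (node R L b) = (n == m)%:R.
  have := walsh_orthogonal R (Ordinal nL) (widen_ord K2L m).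
  rewrite -(inj_eq val_inj) /= => ->.
  by case: (n == m); rewrite ?mulr0 ?mulVf.
under eq_bigr do rewrite orth.
case: ifPn => [nK|nK].
  rewrite (bigD1 (Ordinal nK))//= eqxx scale1r big1 ?addr0// => m hm.
  case: eqP => [e|_]; last by rewrite scale0r.
  by rewrite -(inj_eq val_inj) /= e eqxx in hm.
rewrite big1// => m _; case: eqP => [e|_]; last by rewrite scale0r.
by rewrite e ltn_ord in nK.
Qed.

(** A step function on the atoms of generation K is a combination of the
    first 2^K Walsh functions. *)
Lemma walsh_sum_step_fun N x : (2 ^ K <= N)%N -> 0 <= x < 1 -> walsh_sum g N x = g x.
Proof.
move=> KN x01; rewrite (step_expansion x01) /walsh_sum.
under eq_bigr do rewrite walsh_coef_step_fun.
rewrite -(subnKC KN) big_split_ord /= [X in _ + X]big1 ?addr0.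
  by apply: eq_bigr => m _; rewrite ltn_ord.
by move=> m _; rewrite ltnNge leq_addr scaler0.
Qed.

End StepWalshSums.

Section LinearWalshSums.
Context (R : realType) (Y : completeNormedModType R).
Local Notation mu := (@lebesgue_measure R).
Local Notation D := (`]0, 1[%classic : set R).

Let mD : measurable (D : set (measurableTypeR R)). Proof. exact: measurable_itv. Qed.

Lemma walsh_sum_lin (a b : R) (f g : R -> Y) N x : L1 mu D f -> L1 mu D g ->
  walsh_sum (fun x => a *: f x + b *: g x) N x = a *: walsh_sum f N x + b *: walsh_sum g N x.
Proof.
move=> f1 g1; rewrite /walsh_sum !scaler_sumr -big_split /=; apply: eq_bigr => n _.
have L1n (h : R -> Y) : L1 mu D h -> L1 mu D (fun x => walsh n x *: h x).
  by move=> h1; case: (bochner_step h1 (walsh_step (ltn_expl n (ltnSn 1)))).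
have -> : walsh_coef (fun x => a *: f x + b *: g x) n = a *: walsh_coef f n + b *: walsh_coef g n.
  rewrite /walsh_coef -(bochner_lin mD a b (L1n _ f1) (L1n _ g1)).
  congr (bochner _ _ _); apply/funext => y.
  by rewrite scalerDr !scalerA ![walsh n y * _]mulrC.
by rewrite scalerDr !scalerA ![walsh n x * _]mulrC.
Qed.

End LinearWalshSums.

(** The intersection of measurable sets of measure at most 1 / (j + 1) that
    contain B has measure zero. *)
Lemma negligible_small (d : measure_display) (T : measurableType d) (R : realType)
    (mu : {measure set T -> \bar R}) (B : set T) :
  (forall e : R, 0 < e -> exists Z, [/\ measurable Z, B `<=` Z & (mu Z <= e%:E)%E]) ->
  mu.-negligible B.
Proof.
move=> h; have pos j : 0 < (j.+1%:R)^-1 :> R by rewrite invr_gt0.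
have /choice[Z hZ] : forall j, exists Z, [/\ measurable Z, B `<=` Z & (mu Z <= ((j.+1%:R)^-1)%:E)%E].
  by move=> j; exact: h (pos j).
have mZ : measurable (\bigcap_j Z j) by apply: bigcapT_measurable => j; case: (hZ j).
exists (\bigcap_j Z j); split => //; last by move=> x Bx j _; case: (hZ j) => _ + _; exact.
apply/eqP; rewrite eq_le measure_ge0 andbT; apply/lee_addgt0Pr => e e0; rewrite add0e.
have [j hj] : exists j, (j.+1%:R)^-1 <= e.
  exists (Num.truncn e^-1); rewrite invf_ple ?posrE ?ltr0n//.
  by rewrite ltW// truncnS_gt.
apply: (@le_trans _ _ (mu (Z j))).
  by apply: le_measure; rewrite ?inE//; [case: (hZ j)|exact: bigcap_inf].
by case: (hZ j) => _ _ /le_trans; apply; rewrite lee_fin.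
Qed.

(** * Almost everywhere convergence *)

Section AlmostEverywhere.
Context (R : realType) (Y : completeNormedModType R).
Local Notation mu := (@lebesgue_measure R).
Local Notation D := (`]0, 1[%classic : set R).
Let mD : measurable (D : set (measurableTypeR R)). Proof. exact: measurable_itv. Qed.

Definition ae_convergent (f : R -> Y) := {ae mu, forall x : R, D x ->
  walsh_sum f N x @[N --> \oo] --> f x}.

Lemma ae_convergent_lin (a b : R) (f g : R -> Y) : L1 mu D f -> L1 mu D g ->
  ae_convergent f -> ae_convergent g -> ae_convergent (fun x => a *: f x + b *: g x).
Proof.
move=> f1 g1 cf cg; apply: negligibleS (negligibleU cf cg) => x /= nx.
have [fx|fx] := pselect (D x -> walsh_sum f N x @[N --> \oo] --> f x); last by left.
right=> gx; apply: nx => Dx.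
under eq_fun do rewrite (walsh_sum_lin a b _ _ f1 g1).
by apply: cvgD; apply: cvgZl_tmp; [exact: fx|exact: gx].
Qed.

Lemma ae_convergent_step (g : R -> Y) K : L1 mu D g ->
  (forall x, 0 <= x -> x < 1 -> g x = g (node R K (dyadic_index K x))) ->
  ae_convergent g.
Proof.
move=> g1 gs; apply: aeW => x Dx; apply: cvg_near_cst.
exists (2 ^ K)%N => // N /= KN; apply: (walsh_sum_step_fun g1 gs KN).
by move: Dx; rewrite /= in_itv /= => /andP[/ltW -> ->].
Qed.

Lemma measure_superlevel (q delta : R) (h : R -> Y) : 0 < q -> 0 < delta ->
  strongly_measurable measurable (D : set (measurableTypeR R)) h ->
  measurable (D `&` [set x | delta < `|h x|] : set (measurableTypeR R)) /\
  ((delta `^ q)%:E * mu (D `&` [set x | (delta < `|h x|)%R])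
     <= \int[mu]_(x in D) (`|h x| `^ q)%:E)%E.
Proof.
move=> q0 d0 sh; set S := D `&` _.
have mS : measurable (S : set (measurableTypeR R)).
  have -> : S = D `\` (D `&` [set x | `|h x| <= delta]).
    apply/seteqP; split=> x [Dx /= hx].
      by split => // -[_ /=]; rewrite leNgt hx.
    by split => //=; rewrite ltNge; apply/negP => h'; apply: hx.
  apply: measurableD => //; apply: measurable_fun_le => //.
  exact: strongly_measurable_norm.
split => //.
have -> : mu S = (\int[mu]_(x in D) (\1_S x)%:E)%E.
  by rewrite integral_indic//; congr (mu _); rewrite setIidl// => x [].
rewrite -ge0_integralZl//; last 2 first.
- by apply/measurable_EFinP; exact: measurable_indic.
- by rewrite lee_fin powR_ge0.
apply: ge0_le_integral => //.
- by move=> x _; rewrite mule_ge0// ?lee_fin// powR_ge0.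
- by apply: measurable_funeM; apply/measurable_EFinP; exact: measurable_indic.
- exact: measurable_norm_powR (ltW q0) sh.
move=> x Dx; rewrite indicE; case: (boolP (x \in S)) => [/set_mem[_ /= hx]|_].
  by rewrite mule1 lee_fin ge0_ler_powR ?nnegrE ?(ltW q0) ?(ltW d0)// ltW.
by rewrite mule0 lee_fin powR_ge0.
Qed.

Context (q C : R).
Hypothesis hq : 2 <= q.
Hypothesis htile : tile_type_with Y q C.

Let q1 : 1 <= q. Proof. by apply: le_trans hq; rewrite ler1n. Qed.
Let q0 : 0 < q. Proof. exact: lt_le_trans q1. Qed.

(** Where S_N g tends to g, the oscillation of S_N f - f is controlled by
    the maximal function of f - g and by f - g itself, and both are small
    outside a set of small measure. *)
Lemma ae_convergent_closed (f : R -> Y) : in_LY mu D q f ->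
  (forall e : R, 0 < e -> exists g, [/\ in_LY mu D q g, ae_convergent g &
     (\int[mu]_(x in D) (`|f x - g x| `^ q)%:E <= e%:E)%E]) ->
  ae_convergent f.
Proof.
move=> fq approx.
pose bad (delta : R) := [set x : R | D x /\
  ~ exists N0, forall N, (N0 <= N)%N -> `|walsh_sum f N x - f x| <= 3 * delta].
have negl delta : 0 < delta -> mu.-negligible (bad delta).
  move=> d0; apply: negligible_small => eta eta0.
  pose W := weak_const q C `^ q + 1.
  have W0 : 0 < W by rewrite ltr_wpDl ?powR_ge0.
  have dq : 0 < delta `^ q by exact: powR_gt0.
  have e0 : 0 < eta * delta `^ q / W by rewrite divr_gt0 ?mulr_gt0.
  have [g [gq [Ng [mNg Ng0 gNg]] int]] := approx _ e0.
  pose h x := f x - g x.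
  have sh : strongly_measurable measurable (D : set (measurableTypeR R)) h.
    by apply: strongly_measurableB; [case: fq|case: gq].
  have hqL : in_LY mu D q h.
    by apply/(in_LY_int _ _ _ q0); split => //; apply: le_lt_trans int (ltry _).
  have mom : moment h q <= eta * delta `^ q / W by rewrite -lee_fin (momentE q1 hqL).
  have [mE hE] := measure_superlevel q0 d0 sh.
  have mM := measurable_maximal_exceed_set h delta.
  have hM := measure_maximal_exceed_set hq htile hqL d0.
  exists (Ng `|` (maximal_exceed_set h delta `|` (D `&` [set x | delta < `|h x|]))); split.
  - by apply: measurableU => //; exact: measurableU.
  - move=> x [Dx nx]; apply: contrapT => /not_orP[nN /not_orP[nM nE]]; apply: nx.
    have gx : walsh_sum g N x @[N --> \oo] --> g x.
      by apply: contrapT => ng; apply: nN; apply: gNg => /= /(_ Dx).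
    have hx : `|h x| <= delta by rewrite leNgt; apply/negP => hx; apply: nE.
    have Sx N : `|walsh_sum h N x| <= delta.
      by rewrite leNgt; apply/negP => Sx; apply: nM; split => //; exists N.
    have /cvgrPdist_le/(_ _ d0)[N0 _ hN0] := gx; exists N0 => N NN.
    have f1 := in_LY_unit_L1 q1 fq; have g1 := in_LY_unit_L1 q1 gq.
    have := walsh_sum_lin 1 (-1) N x f1 g1; rewrite scale1r scaleN1r.
    have -> : (fun x => 1 *: f x + -1 *: g x) = h.
      by apply/funext => y; rewrite scale1r scaleN1r.
    move=> e; have := hN0 N NN => /= gN.
    have -> : walsh_sum f N x - f x = walsh_sum h N x - h x - (g x - walsh_sum g N x).
      rewrite e /h !opprB -addrA [g x - f x + _]addrC [_ - g x + _]addrA subrK.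
      by rewrite addrA subrK.
    apply: le_trans (ler_normB _ _) _; apply: le_trans (lerD (ler_normB _ _) (lexx _)) _.
    have := Sx N; lra.
  have mZ : measurable (maximal_exceed_set h delta `|` (D `&` [set x | delta < `|h x|]) : set (measurableTypeR R)).
    exact: measurableU.
  have U1 : (mu (Ng `|` (maximal_exceed_set h delta `|` (D `&` [set x | (delta < `|h x|)%R])))
      <= mu Ng + mu (maximal_exceed_set h delta `|` (D `&` [set x | (delta < `|h x|)%R])))%E.
    exact: measureU2.
  have U2 : (mu (maximal_exceed_set h delta `|` (D `&` [set x | (delta < `|h x|)%R]))
      <= mu (maximal_exceed_set h delta) + mu (D `&` [set x | (delta < `|h x|)%R]))%E.
    exact: measureU2.
  apply: le_trans U1 _; rewrite [X in (X + _)%E](_ : _ = 0%E) ?add0e; last exact: Ng0.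
  apply: le_trans U2 _.
  have hE' : (mu (D `&` [set x | (delta < `|h x|)%R]) <= (moment h q / delta `^ q)%:E)%E.
    rewrite EFinM lee_pdivlMr// muleC; apply: le_trans hE _.
    by rewrite (momentE q1 hqL).
  apply: le_trans (leeD hM hE') _; rewrite -EFinD lee_fin -mulrDl ler_pdivrMr//.
  rewrite -[X in _ + X]mul1r -mulrDl -/W mulrC -ler_pdivlMr//.
have : mu.-negligible (\bigcup_k bad (k.+1%:R)^-1).
  by apply: negligible_bigcup => k; apply: negl; rewrite invr_gt0.
apply: negligibleS => x /= nx; apply: contrapT => nb; apply: nx => Dx.
apply/cvgrPdist_le => e e0.
have [k hk] : exists k, 3 * (k.+1%:R)^-1 <= e.
  exists (Num.truncn (3 / e)); rewrite ler_pdivrMr ?ltr0n// mulrC -ler_pdivrMr//.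
  by rewrite ltW// truncnS_gt.
have : ~ bad (k.+1%:R)^-1 x by move=> bx; apply: nb; exists k.
move=> /not_andP[//|/contrapT[N0 hN]]; exists N0 => // N /= NN.
by rewrite distrC; apply: le_trans hk; exact: hN.
Qed.

End AlmostEverywhere.

(** * Density of the step functions *)

Section DyadicApproximation.
Context (R : realType).
Local Notation mu := (@lebesgue_measure R).
Local Notation D := (`]0, 1[%classic : set R).
Let mD : measurable (D : set (measurableTypeR R)). Proof. exact: measurable_itv. Qed.

Definition dyadic_interior (U : set R) K : set (measurableTypeR R) :=
  [set x | 0 <= x < 1 /\ atom K (dyadic_index K x) `<=` U].

Lemma dyadic_interior_sub U K : dyadic_interior U K `<=` U.
Proof.
move=> x [/andP[x0 x1]]; apply; apply/set_mem.
by rewrite in_atom.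
Qed.

Lemma measurable_dyadic_interior U K : measurable (dyadic_interior U K).
Proof.
have -> : dyadic_interior U K = \big[setU/set0]_(a < 2 ^ K | `[< atom K a `<=` U >])
    (atom K a : set (measurableTypeR R)).
  rewrite -(big_filter _ (fun a : 'I_(2 ^ K) => `[< atom K a `<=` U >])) -bigcup_seq.
  apply/seteqP; split=> x.
    move=> [/andP[x0 x1] xU]; exists (Ordinal (dyadic_index_lt K x0 x1)) => /=.
      by rewrite mem_filter mem_index_enum andbT; apply/asboolP.
    by apply/set_mem; rewrite in_atom.
  move=> [a /=]; rewrite mem_filter => /andP[/asboolP aU _] xa; have x0 := atom_ge0 xa.
  split; first by rewrite x0 (atom_lt1 xa).
  by move/mem_set: xa; rewrite in_atom// => /eqP ->.
by apply: bigsetU_measurable => a _; exact: measurable_atom.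
Qed.

Lemma atom_mono (x : R) K L : 0 <= x -> (K <= L)%N ->
  atom L (dyadic_index L x) `<=` (atom K (dyadic_index K x) : set R).
Proof.
move=> x0 KL y yL; have y0 := atom_ge0 yL; move/mem_set: yL.
rewrite in_atom// => /eqP yx; apply/set_mem; rewrite in_atom//.
rewrite (@dyadic_index_div _ K (L - K) y)// (@dyadic_index_div _ K (L - K) x)//.
by rewrite subnKC// yx.
Qed.

Lemma dyadic_interior_mono U K L : (K <= L)%N ->
  dyadic_interior U K `<=` dyadic_interior U L.
Proof.
move=> KL x [x01 xU]; split => //; apply: subset_trans xU; apply: atom_mono => //.
by case/andP: x01.
Qed.

Lemma dyadic_interior_open (U : set R) (x : R) : open U -> U x -> 0 <= x < 1 ->
  exists K, dyadic_interior U K x.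
Proof.
move=> oU Ux x01; have /andP[x0 x1] := x01.
have /nbhs_ballP[r /= r0 rU] : nbhs x U by exact: open_nbhs_nbhs.
have [K hK] : exists K, 2 ^- K < r.
  exists (Num.truncn r^-1); rewrite invf_plt ?posrE ?exprn_gt0//.
  apply: lt_le_trans (truncnS_gt _) _; rewrite -natrX ler_nat.
  exact: ltn_expl.
exists K; split => // y yK; apply: rU.
have y0 := atom_ge0 yK; have xK : (atom K (dyadic_index K x) : set R) x.
  by apply/set_mem; rewrite in_atom.
move: xK yK; rewrite /atom /= !in_itv /= => /andP[x2 x3] /andP[y2 y3].
rewrite -ball_normE /=; apply: lt_trans hK; rewrite ltr_norml.
have w : node R K (dyadic_index K x).+1 - node R K (dyadic_index K x) = 2 ^- K.
  by rewrite /node -mulrBl -natrB// subSnn mul1r.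
by apply/andP; split; lra.
Qed.

(** Outer regularity gives an open set U slightly larger than A on the unit
    interval, and the dyadic interiors of U increase to U. *)
Lemma dyadic_set_approximation (A : set (measurableTypeR R)) (e : R) :
  measurable A -> 0 < e -> exists (U : set R) K,
  (mu (D `&` ((A `\` dyadic_interior U K) `|` (dyadic_interior U K `\` A))) <= e%:E)%E.
Proof.
move=> mA e0; have e2 : 0 < e / 2 by rewrite divr_gt0.
have mAD : measurable (A `&` D) by exact: measurableI.
have ADoo : (mu (A `&` D) < +oo)%E.
  apply: (@le_lt_trans _ _ (mu D)); last by rewrite measure_unit_itv ltry.
  by apply: le_measure; rewrite ?inE//; exact: subIsetr.
have [U [oU AU UA]] := lebesgue_regularity_outer mAD ADoo e2.
have mU : measurable (U : set (measurableTypeR R)) by exact: open_measurable.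
pose G K := (D `&` U) `\` dyadic_interior U K.
have mG K : measurable (G K : set (measurableTypeR R)).
  by apply: measurableD; [exact: measurableI|exact: measurable_dyadic_interior].
have G0 : \bigcap_K G K = set0.
  apply/seteqP; split=> // x Gx; have [[Dx Ux] _] := Gx 0%N I.
  have x01 : 0 <= x < 1 by move: Dx; rewrite /= in_itv /= => /andP[/ltW -> ->].
  have [K xK] := dyadic_interior_open oU Ux x01.
  by have [_] := Gx K I; exact.
have cvG : mu (G K) @[K --> \oo] --> 0%E.
  rewrite -(measure0 mu) -G0; apply: nonincreasing_cvg_mu => //.
  - apply: (@le_lt_trans _ _ (mu D)); last by rewrite measure_unit_itv ltry.
    by apply: le_measure; rewrite ?inE// => x [[]].
  - by rewrite G0.
  by move=> n m nm; rewrite subsetEset => x [DU nx]; split => // /(dyadic_interior_mono nm).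
have [K _ hK] := ecvg0_le cvG e2.
exists U, K; set B := dyadic_interior U K.
apply: (@le_trans _ _ (mu ((U `\` (A `&` D)) `|` G K))).
  have mB : measurable B by exact: measurable_dyadic_interior.
  apply: le_measure; rewrite ?inE.
  - by apply: measurableI => //; apply: measurableU; exact: measurableD.
  - by apply: measurableU => //; exact: measurableD.
  move=> x [Dx [[Ax nB]|[Bx nA]]].
    by right; split => //; split => //; apply: AU.
  by left; split; [exact: dyadic_interior_sub Bx|move=> [Ax _]].
have U1 : (mu ((U `\` (A `&` D)) `|` G K) <= mu (U `\` (A `&` D)) + mu (G K))%E.
  by apply: measureU2 => //; exact: measurableD.
apply: le_trans U1 _; rewrite [e in leRHS](splitr e) EFinD; apply: leeD; first exact: ltW.
exact: hK (leqnn K).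
Qed.

End DyadicApproximation.

Section Density.
Context (R : realType) (Y : completeNormedModType R) (q C : R).
Local Notation mu := (@lebesgue_measure R).
Local Notation D := (`]0, 1[%classic : set R).
Let mD : measurable (D : set (measurableTypeR R)). Proof. exact: measurable_itv. Qed.
Hypothesis hq : 2 <= q.
Hypothesis htile : tile_type_with Y q C.

Let q1 : 1 <= q. Proof. by apply: le_trans hq; rewrite ler1n. Qed.
Let q0 : 0 < q. Proof. exact: lt_le_trans q1. Qed.

Lemma measure_unit_lty (A : set (measurableTypeR R)) : measurable A -> (mu (D `&` A) < +oo)%E.
Proof.
move=> mA; apply: (@le_lt_trans _ _ (mu D)); last by rewrite measure_unit_itv ltry.
by apply: le_measure; rewrite ?inE//; exact: measurableI.
Qed.

Lemma in_LY_indic (A : set (measurableTypeR R)) (y : Y) : measurable A ->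
  in_LY mu D q (fun x => \1_A x *: y).
Proof.
move=> mA; have [[sA _] _] := bochner_indic mD y mA (measure_unit_lty mA).
apply/(in_LY_int _ _ _ q0); split => //.
apply: (@le_lt_trans _ _ (\int[mu]_(x in D) (cst (`|y| `^ q)%:E) x)%E).
  apply: ge0_le_integral => //.
  - exact: measurable_norm_powR (ltW q0) sA.
  move=> x _; rewrite lee_fin ge0_ler_powR ?nnegrE ?(ltW q0)// normrZ ler_piMl//.
  by rewrite indicE; case: (_ \in _); rewrite ?normr1 ?normr0.
have Doo : (mu D < +oo)%E by rewrite measure_unit_itv ltry.
by rewrite integral_cst// lte_mul_pinfty ?lee_fin ?powR_ge0.
Qed.

Lemma ae_convergent_indic (A : set (measurableTypeR R)) (y : Y) : measurable A ->
  ae_convergent (fun x => \1_A x *: y).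
Proof.
move=> mA; apply: (ae_convergent_closed hq htile); first exact: in_LY_indic.
move=> e e0; pose M := `|y| `^ q + 1.
have M0 : 0 < M by rewrite ltr_wpDl ?powR_ge0.
have eM : 0 < e / M by exact: divr_gt0.
have [U [K hUK]] := dyadic_set_approximation mA eM.
pose B := dyadic_interior U K; have mB : measurable B by exact: measurable_dyadic_interior.
exists (fun x => \1_B x *: y); split; first exact: in_LY_indic.
  have [L _] := bochner_indic mD y mB (measure_unit_lty mB).
  apply: (ae_convergent_step (K := K) L) => x x0 x1; congr (_ *: _).
  rewrite !indicE; congr (nat_of_bool _)%:R.
  have n0 := node_ge0 R K (dyadic_index K x).
  have n1 := node_lt1 R (dyadic_index_lt K x0 x1).
  have i : dyadic_index K (node R K (dyadic_index K x)) = dyadic_index K x.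
    by rewrite dyadic_index_node// subnn divn1.
  apply/idP/idP => /set_mem[_ h]; apply/mem_set.
    by split; [rewrite n0 n1|rewrite i].
  by split; [rewrite x0 x1|rewrite -i].
pose S := D `&` ((A `\` B) `|` (B `\` A)).
have mS : measurable (S : set (measurableTypeR R)).
  by apply: measurableI => //; apply: measurableU; exact: measurableD.
apply: (@le_trans _ _ ((`|y| `^ q)%:E * mu S)%E); last first.
  apply: (@le_trans _ _ (M%:E * (e / M)%:E)%E).
    by apply: lee_pmul => //; rewrite ?lee_fin ?powR_ge0// lerDl.
  by rewrite -EFinM lee_fin mulrC divfK// gt_eqF.
have -> : mu S = (\int[mu]_(x in D) (\1_S x)%:E)%E.
  by rewrite integral_indic//; congr (mu _); rewrite setIidl// => x [].
have mI : measurable_fun D (fun x : measurableTypeR R => (\1_S x)%:E : \bar R).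
  by apply/measurable_EFinP; exact: measurable_indic.
have I0 (x : measurableTypeR R) : D x -> (0 <= (\1_S x : R)%:E)%E by rewrite lee_fin.
have y0 : (0 <= (`|y| `^ q)%:E)%E by rewrite lee_fin powR_ge0.
rewrite -(ge0_integralZl mu mD mI I0 y0).
have [[sA _] _] := bochner_indic mD y mA (measure_unit_lty mA).
have [[sB _] _] := bochner_indic mD y mB (measure_unit_lty mB).
apply: ge0_le_integral => //.
- exact: measurable_norm_powR (ltW q0) (strongly_measurableB sA sB).
- exact: measurable_funeM.
move=> x Dx; rewrite -EFinM lee_fin -scalerBl normrZ powRM// mulrC ler_wpM2l ?powR_ge0//.
rewrite !indicE; have [Ax|Ax] := pselect (A x); have [Bx|Bx] := pselect (B x).
- by rewrite (mem_set Ax) (mem_set Bx) subrr normr0 powR0 ?gt_eqF.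
- rewrite (mem_set Ax) (memNset Bx) subr0 normr1 powR1 mem_set//.
  by split => //; left.
- rewrite (memNset Ax) (mem_set Bx) sub0r normrN1 powR1 mem_set//.
  by split => //; right.
by rewrite (memNset Ax) (memNset Bx) subrr normr0 powR0 ?gt_eqF.
Qed.

Lemma ae_convergent_simple (s : R -> Y) :
  simple_function (@measurable _ (measurableTypeR R)) s -> ae_convergent s.
Proof.
move=> /simple_functionP[r [ur sr ms]].
pose g (w : seq Y) x := \sum_(y <- w) 1 *: (\1_(s @^-1` [set y]) x *: y).
have Li y : L1 mu D (fun x => \1_(s @^-1` [set y]) x *: y).
  exact: (bochner_indic mD y (ms y) (measure_unit_lty (ms y))).1.
have -> : s = g r.
  apply/funext => x; rewrite /g (bigD1_seq (s x))//= big1 ?addr0.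
    by rewrite indicE mem_set// !scale1r.
  move=> y yx; rewrite indicE memNset ?scale0r ?scaler0// => /= e.
  by rewrite e eqxx in yx.
elim: r {ur sr} => [|y w IH].
  apply: aeW => x Dx.
  have -> : g [::] = (fun x => 0 *: (\1_(s @^-1` [set 0]) x *: (0 : Y)) + 0 *: (\1_(s @^-1` [set 0]) x *: (0 : Y))).
    by apply/funext => z; rewrite /g big_nil !scale0r addr0.
  under eq_fun do rewrite (walsh_sum_lin 0 0 _ _ (Li 0) (Li 0)) !scale0r addr0.
  by rewrite !scale0r addr0; exact: cvg_cst.
have -> : g (y :: w) = (fun x => 1 *: (\1_(s @^-1` [set y]) x *: y) + 1 *: g w x).
  by apply/funext => x; rewrite /g big_cons !scale1r.
apply: ae_convergent_lin => //; last exact: ae_convergent_indic (ms y).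
exact: (L1_sum mD w (fun=> 1) Li).1.
Qed.

Lemma ae_convergent_all (f : R -> Y) : in_LY mu D q f -> ae_convergent f.
Proof.
move=> fq; have /(in_LY_int _ _ _ q0)[sf fi] := fq.
have [t [st tf tcvg]] := simple_approximation mD sf.
have mt n := simple_strongly_measurable D (st n).
have tq n : in_LY mu D q (t n).
  apply/(in_LY_int _ _ _ q0); split; first exact: mt.
  apply: (@le_lt_trans _ _ (\int[mu]_(x in D) ((2 `^ q)%:E * (`|f x| `^ q)%:E))%E).
    apply: ge0_le_integral => //.
    - exact: measurable_norm_powR (ltW q0) (mt n).
    - by apply: measurable_funeM; exact: measurable_norm_powR (ltW q0) sf.
    move=> x Dx; rewrite -EFinM lee_fin -powRM//.
    by rewrite ge0_ler_powR ?nnegrE ?(ltW q0) ?mulr_ge0// tf.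
  have I0 (x : measurableTypeR R) : D x -> (0 <= (`|f x| `^ q)%:E)%E.
    by rewrite lee_fin powR_ge0.
  have k0 : (0 <= (2 `^ q : R)%:E)%E by rewrite lee_fin powR_ge0.
  rewrite (ge0_integralZl mu mD (measurable_norm_powR (ltW q0) sf) I0 k0).
  by rewrite lte_mul_pinfty.
have cv : (\int[mu]_(x in D) (`|f x - t n x| `^ q)%:E)%E @[n --> \oo] --> 0%E.
  rewrite -(integral0 mu D).
  apply: (@dominated_cvg _ _ _ mu D mD (fun n x => (`|f x - t n x| `^ q)%:E) (fun=> 0%E)
    (fun x => ((3 `^ q)%:E * (`|f x| `^ q)%:E)%E)) => //.
  - move=> n; apply: measurable_norm_powR (ltW q0) _.
    exact: strongly_measurableB.
  - move=> x Dx; apply: cvg_EFin; first exact: nearW.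
    apply/cvgrPdist_le => e e0; have r0 : 0 < e `^ q^-1 by exact: powR_gt0.
    have /cvgrPdist_le/(_ _ r0)[N _ hN] := tcvg x Dx; exists N => // n Nn /=.
    rewrite sub0r normrN ger0_norm ?powR_ge0//.
    have -> : e = (e `^ q^-1) `^ q by rewrite -powRrM mulVf ?gt_eqF// powRr1// ltW.
    by rewrite ge0_ler_powR ?nnegrE ?(ltW q0) ?(ltW r0)//; exact: hN.
  - apply: integrableZl => //; apply/integrableP; split.
      exact: measurable_norm_powR (ltW q0) sf.
    by under eq_integral do rewrite gee0_abs ?lee_fin ?powR_ge0//.
  - move=> n x Dx; rewrite gee0_abs ?lee_fin ?powR_ge0// -powRM//.
    rewrite ge0_ler_powR ?nnegrE ?(ltW q0) ?mulr_ge0//.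
    by apply: le_trans (ler_normB _ _) _; have := tf n x Dx; lra.
apply: (ae_convergent_closed hq htile) => // e e0.
have [n _ hn] := ecvg0_le cv e0.
exists (t n); split; [exact: tq|exact: ae_convergent_simple|exact: hn (leqnn n)].
Qed.

End Density.

Theorem mainTheorem2 (R : realType) (Y : completeNormedModType R) (q : R)
    (hq : 2 <= q) (hUMD : UMD Y) (htile : tile_type Y q) :
  (exists C : R, forall f : R -> Y,
     in_LY lebesgue_measure `]0, 1[%classic q f ->
     (weak_Lnorm lebesgue_measure `]0%R, 1%R[%classic q (walsh_maximal f)
      <= C%:E * LYnorm lebesgue_measure `]0%R, 1%R[%classic q f)%E) /\
  (forall f : R -> Y,
     in_LY lebesgue_measure `]0, 1[%classic q f ->
     {ae lebesgue_measure, forall x : R, `]0, 1[%classic x ->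
        walsh_sum f N x @[N --> \oo] --> f x}).
Proof.
have [C hC] := htile; split.
  by exists (weak_const q C) => f; exact: weak_Lnorm_walsh_maximal.
by move=> f fq; exact (ae_convergent_all hq hC fq).
Qed.
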